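(* Let $d>0$ be an integer, let $\mathcal{E}$ be an exact category with enough projectives, let $\mathcal{P}$ be the full subcategory of projective objects of $\mathcal{E}$, and let $\mathcal{M}$ be a $d\mathbb{Z}$-cluster tilting subcategory of $\mathcal{E}$. Then the full subcategory $$\{P^{\bullet}\in K^{-,b}(\mathcal{P})/K^b(\mathcal{P}) \mid Z^{di}(P^{\bullet})\in \mathcal{M} \text{ for all } i\ll 0\}$$ is a $d\mathbb{Z}$-cluster tilting subcategory of the triangulated category $K^{-,b}(\mathcal{P})/K^b(\mathcal{P})$.
   Context: Exact categories are in the sense of Quillen (conventions of Bühler). $\mathcal{E}$ has enough projectives if every $E\in\mathcal{E}$ admits an admissible epimorphism $P\to E$ with $P$ projective. $K^b(\mathcal{P})$ is the homotopy category of bounded complexes over $\mathcal{P}$, and $K^{-,b}(\mathcal{P})$ is the homotopy category of right bounded complexes over $\mathcal{P}$ (i.e. $P^n=0$ for $n\gg 0$; differentials raise degree) with bounded homology, i.e. which are exact, in the sense of the exact category $\mathcal{E}$, in all sufficiently negative degrees. The quotient $K^{-,b}(\mathcal{P})/K^b(\mathcal{P})$ is the Verdier quotient (the singularity category of $\mathcal{E}$). $Z^{n}(P^\bullet)=\operatorname{Ker}(P^n\to P^{n+1})$, computed in $\mathcal{E}$ (it exists for $n\ll 0$). Cluster tilting: let $\mathcal{A}$ be an exact category or a triangulated category with suspension $\Sigma$; in the triangulated case put $\operatorname{Ext}^i_{\mathcal{A}}(A,B)=\operatorname{Hom}_{\mathcal{A}}(A,\Sigma^i B)$. A full subcategory $\mathcal{N}\subseteq\mathcal{A}$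 is $d$-cluster tilting if (1) $\mathcal{N}$ is functorially finite in $\mathcal{A}$, i.e. for each $A\in\mathcal{A}$ there is a morphism $N\to A$ with $N\in\mathcal{N}$ such that $\operatorname{Hom}(N',N)\to\operatorname{Hom}(N',A)$ is surjective for all $N'\in\mathcal{N}$, and a morphism $A\to N$ with $N\in\mathcal{N}$ such that $\operatorname{Hom}(N,N')\to\operatorname{Hom}(A,N')$ is surjective for all $N'\in\mathcal{N}$; (2) $\mathcal{N}=\{A\mid \operatorname{Ext}^i_{\mathcal{A}}(A,\mathcal{N})=0,\ 1\le i\le d-1\}=\{A\mid \operatorname{Ext}^i_{\mathcal{A}}(\mathcal{N},A)=0,\ 1\le i\le d-1\}$; (3) if $\mathcal{A}$ is exact, then for every $A\in\mathcal{A}$ there are an admissible monomorphism $A\to N$ and an admissible epimorphism $N'\to A$ with $N,N'\in\mathcal{N}$. It is $d\mathbb{Z}$-cluster tilting if moreover $\operatorname{Ext}^i_{\mathcal{A}}(\mathcal{N},\mathcal{N})=0$ for all $i\notin d\mathbb{Z}$. *)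

(* Defs.v *)
From HB Require Import structures.
From mathcomp Require Import all_boot all_order all_algebra.
From mathcomp Require Import boolp.
From Stdlib Require Import Relation_Operators.

Set Implicit Arguments.
Unset Strict Implicit.
Unset Printing Implicit Defensive.

Import Order.TTheory GRing.Theory Num.Theory.
Local Open Scope ring_scope.
Local Open Scope quotient_scope.

Declare Scope cat_scope.
Delimit Scope cat_scope with cat.
Local Open Scope cat_scope.

Record category := Category {
  obj :> Type;
  hom : obj -> obj -> Type;
  idm : forall A, hom A A;
  comp : forall A B C, hom B C -> hom A B -> hom A C;
  compA : forall A B C D (h : hom C D) (g : hom B C) (f : hom A B),
    comp h (comp g f) = comp (comp h g) f;
  comp1m : forall A B (f : hom A B), comp (idm B) f = f;
  compm1 : forall A B (f : hom A B), comp f (idm A) = f }.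

Arguments hom {c} A B.
Arguments idm {c} A.
Arguments comp {c A B C} g f.
Notation "g ∘ f" := (comp g f) (at level 40, left associativity) : cat_scope.

Definition is_iso (C : category) (A B : C) (f : hom A B) : Prop :=
  exists2 g : hom B A, g ∘ f = idm A & f ∘ g = idm B.

Definition isomorphic (C : category) (A B : C) : Prop :=
  exists f : hom A B, is_iso f.

Definition full_subcategory (C : category) (P : C -> Prop) : category :=
  @Category {A : C | P A} (fun A B => hom (sval A) (sval B))
    (fun A => idm (sval A)) (fun _ _ _ g f => g ∘ f)
    (fun _ _ _ _ h g f => compA h g f)
    (fun _ _ f => comp1m f) (fun _ _ f => compm1 f).

(** Homs modulo a congruence: the data of a category whose laws only hold up
    to a relation [req] on raw homs, and the category it presents. *)
Record raw_category := RawCategory {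
  robj : Type;
  rhom : robj -> robj -> Type;
  req : forall A B, rhom A B -> rhom A B -> Prop;
  rid : forall A, rhom A A;
  rcomp : forall A B C, rhom B C -> rhom A B -> rhom A C;
  req_refl : forall A B (f : rhom A B), req f f;
  req_sym : forall A B (f g : rhom A B), req f g -> req g f;
  req_trans : forall A B (f g h : rhom A B), req f g -> req g h -> req f h;
  rcomp_req : forall A B C (g g' : rhom B C) (f f' : rhom A B),
    req g g' -> req f f' -> req (rcomp g f) (rcomp g' f');
  rcompA : forall A B C D (h : rhom C D) (g : rhom B C) (f : rhom A B),
    req (rcomp h (rcomp g f)) (rcomp (rcomp h g) f);
  rcomp1m : forall A B (f : rhom A B), req (rcomp (rid B) f) f;
  rcompm1 : forall A B (f : rhom A B), req (rcomp f (rid A)) f }.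

Section QuotientCategory.
Variable C : raw_category.

Definition reqb (A B : robj C) : rel {classic rhom A B} :=
  fun f g => `[< req f g >].

Lemma reqb_equiv (A B : robj C) : equiv_class_of (@reqb A B).
Proof.
split.
- by move=> f; apply/asboolP/req_refl.
- by move=> f g; apply/asboolP/asboolP; apply: req_sym.
- by move=> g f h /asboolP fg /asboolP gh; apply/asboolP/(req_trans fg gh).
Qed.

Canonical reqb_equiv_rel (A B : robj C) := EquivRelPack (@reqb_equiv A B).

Definition qhom (A B : robj C) : Type := {eq_quot (@reqb A B)}.

Definition mkhom (A B : robj C) (f : rhom A B) : qhom A B :=
  \pi_{eq_quot (@reqb A B)} (f : {classic rhom A B}).

Definition rephom (A B : robj C) (f : qhom A B) : rhom A B :=
  repr (f : {eq_quot (@reqb A B)}).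

Lemma rephomK (A B : robj C) (f : qhom A B) : mkhom (rephom f) = f.
Proof. exact: reprK. Qed.

Lemma mkhomP (A B : robj C) (f g : rhom A B) : mkhom f = mkhom g <-> req f g.
Proof.
split=> [/eqquotP /asboolP //|fg].
by apply/eqquotP/asboolP.
Qed.

Lemma rephom_mkhom (A B : robj C) (f : rhom A B) : req (rephom (mkhom f)) f.
Proof. by apply/mkhomP; rewrite rephomK. Qed.

Definition qcomp (X Y Z : robj C) (g : qhom Y Z) (f : qhom X Y) : qhom X Z :=
  mkhom (rcomp (rephom g) (rephom f)).

Lemma qcompE (X Y Z : robj C) (g : rhom Y Z) (f : rhom X Y) :
  qcomp (mkhom g) (mkhom f) = mkhom (rcomp g f).
Proof. by apply/mkhomP/rcomp_req; apply: rephom_mkhom. Qed.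

Lemma qcompA (X Y Z T : robj C) (h : qhom Z T) (g : qhom Y Z) (f : qhom X Y) :
  qcomp h (qcomp g f) = qcomp (qcomp h g) f.
Proof.
rewrite -[h]rephomK -[g]rephomK -[f]rephomK !qcompE.
exact/mkhomP/rcompA.
Qed.

Lemma qcomp1m (X Y : robj C) (f : qhom X Y) : qcomp (mkhom (rid Y)) f = f.
Proof. by rewrite -[f]rephomK qcompE; apply/mkhomP/rcomp1m. Qed.

Lemma qcompm1 (X Y : robj C) (f : qhom X Y) : qcomp f (mkhom (rid X)) = f.
Proof. by rewrite -[f]rephomK qcompE; apply/mkhomP/rcompm1. Qed.

Definition quotient_category : category :=
  Category qcompA qcomp1m qcompm1.

End QuotientCategory.

(** The Gabriel-Zisman localization of [C] at a class [S] of morphisms: words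
    in the morphisms of [C] and formal inverses of the elements of [S], modulo
    the least congruence making it a category under [C] where [S] is inverted. *)

Section Localization.
Variables (C : category) (S : forall A B : C, hom A B -> Prop).

Inductive word : C -> C -> Type :=
| word_mor A B of hom A B : word A B
| word_inv A B (s : hom A B) of S s : word B A
| word_comp X Y Z of word Y Z & word X Y : word X Z.

Inductive word_eq : forall A B, word A B -> word A B -> Prop :=
| we_refl A B (u : word A B) : word_eq u u
| we_sym A B (u v : word A B) : word_eq u v -> word_eq v u
| we_trans A B (u v w : word A B) : word_eq u v -> word_eq v w -> word_eq u w
| we_comp X Y Z (u u' : word Y Z) (v v' : word X Y) :
    word_eq u u' -> word_eq v v' ->
    word_eq (word_comp u v) (word_comp u' v')
| we_assoc X Y Z T (u : word Z T) (v : word Y Z) (w : word X Y) :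
    word_eq (word_comp u (word_comp v w)) (word_comp (word_comp u v) w)
| we_1m A B (u : word A B) : word_eq (word_comp (word_mor (idm B)) u) u
| we_m1 A B (u : word A B) : word_eq (word_comp u (word_mor (idm A))) u
| we_mor X Y Z (g : hom Y Z) (f : hom X Y) :
    word_eq (word_mor (g ∘ f)) (word_comp (word_mor g) (word_mor f))
| we_invl A B (s : hom A B) (Ss : S s) :
    word_eq (word_comp (word_inv Ss) (word_mor s)) (word_mor (idm A))
| we_invr A B (s : hom A B) (Ss : S s) :
    word_eq (word_comp (word_mor s) (word_inv Ss)) (word_mor (idm B)).

Definition localization : category :=
  quotient_category (RawCategory we_refl we_sym we_trans we_comp
    we_assoc we_1m we_m1).

End Localization.

Record preadditive := Preadditive {
  pcat :> category;
  hom0 : forall A B : pcat, hom A B;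
  homN : forall A B : pcat, hom A B -> hom A B;
  homD : forall A B : pcat, hom A B -> hom A B -> hom A B;
  homDA : forall A B : pcat, associative (@homD A B);
  homDC : forall A B : pcat, commutative (@homD A B);
  hom0D : forall A B : pcat, left_id (hom0 A B) (@homD A B);
  homND : forall A B : pcat, left_inverse (hom0 A B) (@homN A B) (@homD A B);
  compDl : forall (X Y Z : pcat) (g h : hom Y Z) (f : hom X Y),
    homD g h ∘ f = homD (g ∘ f) (h ∘ f);
  compDr : forall (X Y Z : pcat) (g : hom Y Z) (f h : hom X Y),
    g ∘ homD f h = homD (g ∘ f) (g ∘ h) }.

HB.instance Definition _ (C : preadditive) (A B : C) :=
  gen_eqMixin (@hom (pcat C) A B).
HB.instance Definition _ (C : preadditive) (A B : C) :=
  gen_choiceMixin (@hom (pcat C) A B).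
HB.instance Definition _ (C : preadditive) (A B : C) :=
  GRing.isZmodule.Build (@hom (pcat C) A B)
    (@homDA C A B) (@homDC C A B) (@hom0D C A B) (@homND C A B).

Section PreadditiveTheory.
Variable C : preadditive.

Lemma compmDl (X Y Z : C) (g h : hom Y Z) (f : hom X Y) :
  (g + h) ∘ f = g ∘ f + h ∘ f.
Proof. exact: compDl. Qed.

Lemma compmDr (X Y Z : C) (g : hom Y Z) (f h : hom X Y) :
  g ∘ (f + h) = g ∘ f + g ∘ h.
Proof. exact: compDr. Qed.

Lemma comp0m (X Y Z : C) (f : hom X Y) : (0 : hom Y Z) ∘ f = 0.
Proof. by apply: (addrI ((0 : hom Y Z) ∘ f)); rewrite -compmDl !addr0. Qed.

Lemma compm0 (X Y Z : C) (g : hom Y Z) : g ∘ (0 : hom X Y) = 0.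
Proof. by apply: (addrI (g ∘ (0 : hom X Y))); rewrite -compmDr !addr0. Qed.

Lemma compNm (X Y Z : C) (g : hom Y Z) (f : hom X Y) : (- g) ∘ f = - (g ∘ f).
Proof. by apply: (addrI (g ∘ f)); rewrite -compmDl !subrr comp0m. Qed.

Lemma compmN (X Y Z : C) (g : hom Y Z) (f : hom X Y) : g ∘ (- f) = - (g ∘ f).
Proof. by apply: (addrI (g ∘ f)); rewrite -compmDr !subrr compm0. Qed.

Lemma compmBl (X Y Z : C) (g h : hom Y Z) (f : hom X Y) :
  (g - h) ∘ f = g ∘ f - h ∘ f.
Proof. by rewrite compmDl compNm. Qed.

Lemma compmBr (X Y Z : C) (g : hom Y Z) (f h : hom X Y) :
  g ∘ (f - h) = g ∘ f - g ∘ h.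
Proof. by rewrite compmDr compmN. Qed.

Definition zero_obj (A : C) : Prop := idm A = 0.

Definition is_biproduct (A B X : C) (i1 : hom A X) (i2 : hom B X)
    (p1 : hom X A) (p2 : hom X B) : Prop :=
  [/\ p1 ∘ i1 = idm A, p2 ∘ i2 = idm B, p1 ∘ i2 = 0, p2 ∘ i1 = 0
    & i1 ∘ p1 + i2 ∘ p2 = idm X].

Definition is_additive : Prop :=
  (exists A : C, zero_obj A) /\
  (forall A B : C, exists (X : C) (i1 : hom A X) (i2 : hom B X)
    (p1 : hom X A) (p2 : hom X B), is_biproduct i1 i2 p1 p2).

Definition is_kernel (X Y Z : C) (i : hom X Y) (p : hom Y Z) : Prop :=
  p ∘ i = 0 /\
  forall (T : C) (f : hom T Y), p ∘ f = 0 -> exists! g : hom T X, i ∘ g = f.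

Definition is_cokernel (X Y Z : C) (p : hom Y Z) (i : hom X Y) : Prop :=
  p ∘ i = 0 /\
  forall (T : C) (f : hom Y T), f ∘ i = 0 -> exists! g : hom Z T, g ∘ p = f.

Definition is_pushout (A B A' B' : C) (i : hom A B) (f : hom A A')
    (i' : hom A' B') (f' : hom B B') : Prop :=
  f' ∘ i = i' ∘ f /\
  forall (T : C) (u : hom B T) (v : hom A' T), u ∘ i = v ∘ f ->
    exists! w : hom B' T, w ∘ f' = u /\ w ∘ i' = v.

Definition is_pullback (A B A' B' : C) (p' : hom A' B') (f' : hom A' A)
    (f : hom B' B) (p : hom A B) : Prop :=
  p ∘ f' = f ∘ p' /\
  forall (T : C) (u : hom T A) (v : hom T B'), p ∘ u = f ∘ v ->
    exists! w : hom T A', f' ∘ w = u /\ p' ∘ w = v.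

End PreadditiveTheory.

Section ExactStructure.
Variables (C : preadditive)
  (conf : forall X Y Z : C, hom X Y -> hom Y Z -> Prop).

Definition admissible_mono (X Y : C) (i : hom X Y) : Prop :=
  exists (Z : C) (p : hom Y Z), conf i p.

Definition admissible_epi (Y Z : C) (p : hom Y Z) : Prop :=
  exists (X : C) (i : hom X Y), conf i p.

(** Bühler, "Exact categories", Definition 2.1. *)
Record exact_structure : Prop := ExactStructure {
  conf_kernel : forall (X Y Z : C) (i : hom X Y) (p : hom Y Z),
    conf i p -> is_kernel i p;
  conf_cokernel : forall (X Y Z : C) (i : hom X Y) (p : hom Y Z),
    conf i p -> is_cokernel p i;
  conf_iso : forall (X Y Z X' Y' Z' : C) (i : hom X Y) (p : hom Y Z)
      (i' : hom X' Y') (p' : hom Y' Z')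
      (a : hom X X') (b : hom Y Y') (c : hom Z Z'),
    is_iso a -> is_iso b -> is_iso c -> b ∘ i = i' ∘ a -> c ∘ p = p' ∘ b ->
    conf i p -> conf i' p';
  mono_id : forall A : C, admissible_mono (idm A);
  epi_id : forall A : C, admissible_epi (idm A);
  mono_comp : forall (X Y Z : C) (j : hom Y Z) (i : hom X Y),
    admissible_mono j -> admissible_mono i -> admissible_mono (j ∘ i);
  epi_comp : forall (X Y Z : C) (q : hom Y Z) (p : hom X Y),
    admissible_epi q -> admissible_epi p -> admissible_epi (q ∘ p);
  mono_pushout : forall (A B A' : C) (i : hom A B) (f : hom A A'),
    admissible_mono i -> exists (B' : C) (i' : hom A' B') (f' : hom B B'),
      is_pushout i f i' f' /\ admissible_mono i';
  epi_pullback : forall (A B B' : C) (p : hom A B) (f : hom B' B),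
    admissible_epi p -> exists (A' : C) (p' : hom A' B') (f' : hom A' A),
      is_pullback p' f' f p /\ admissible_epi p' }.

End ExactStructure.

Record exact_category := ExactCategory {
  ecat :> preadditive;
  ecat_additive : is_additive ecat;
  conflation : forall X Y Z : ecat, hom X Y -> hom Y Z -> Prop;
  conflation_exact : exact_structure conflation }.

Section ExactCategory.
Variable E : exact_category.

Definition adm_mono (X Y : E) (i : hom X Y) : Prop :=
  admissible_mono (@conflation E) i.

Definition adm_epi (Y Z : E) (p : hom Y Z) : Prop :=
  admissible_epi (@conflation E) p.

Definition projective (P : E) : Prop :=
  forall (Y Z : E) (p : hom Y Z) (f : hom P Z), adm_epi p ->
    exists g : hom P Y, p ∘ g = f.

Definition enough_projectives : Prop :=
  forall A : E, exists (P : E) (p : hom P A), projective P /\ adm_epi p.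

(** Yoneda extensions.  [yext n A B] is the type of [n.+1]-extensions
    [0 -> B -> X_(n+1) -> ... -> X_1 -> A -> 0], spliced from conflations. *)
Record ses (X Z : E) := Ses {
  ses_mid : E;
  ses_inc : hom X ses_mid;
  ses_prj : hom ses_mid Z;
  ses_conf : conflation ses_inc ses_prj }.

Definition ses_map (X Z X' Z' : E) (a : hom X X') (c : hom Z Z')
    (s : ses X Z) (s' : ses X' Z') : Prop :=
  exists b : hom (ses_mid s) (ses_mid s'),
    b ∘ ses_inc s = ses_inc s' ∘ a /\ ses_prj s' ∘ b = c ∘ ses_prj s.

Fixpoint yext (n : nat) (A B : E) : Type :=
  match n with
  | 0 => ses B A
  | n.+1 => {K : E & (yext n K B * ses K A)%type}
  end.

(** There is a morphism of extensions inducing [a] on the right-hand end and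
    the identity of [B] on the left-hand end. *)
Fixpoint yext_map (n : nat) (A A' B : E) (a : hom A A') :
    yext n A B -> yext n A' B -> Prop :=
  match n with
  | 0 => fun x x' => ses_map (idm B) a x x'
  | n.+1 => fun x x' => exists k : hom (tag x) (tag x'),
      yext_map k (tagged x).1 (tagged x').1 /\
      ses_map k a (tagged x).2 (tagged x').2
  end.

Definition yext_equiv (n : nat) (A B : E) : yext n A B -> yext n A B -> Prop :=
  clos_refl_sym_trans _ (@yext_map n A A B (idm A)).

(** [Ext^i(A, B) = 0].  For [i > 0] the group [Ext^i(A, B)] is the class of
    [i]-extensions modulo [yext_equiv]; it always contains the class of the
    trivial extension, so it vanishes iff any two extensions are equivalent. *)
Definition exact_ext_vanish (i : int) (A B : E) : Prop :=
  match i with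
  | Posz 0 => forall f g : hom A B, f = g
  | Posz n.+1 => forall x y : yext n A B, yext_equiv x y
  | Negz _ => True
  end.

End ExactCategory.

Section ClusterTilting.
Variable A : category.

Definition functorially_finite (N : A -> Prop) : Prop :=
  forall X : A,
    (exists (Y : A) (f : hom Y X), N Y /\
       forall (Y' : A) (g : hom Y' X), N Y' -> exists h : hom Y' Y, f ∘ h = g) /\
    (exists (Y : A) (f : hom X Y), N Y /\
       forall (Y' : A) (g : hom X Y'), N Y' -> exists h : hom Y Y', h ∘ f = g).

(** [ext0 i X Y] stands for [Ext^i(X, Y) = 0]. *)
Variable ext0 : int -> A -> A -> Prop.

Definition ext_orthogonal (d : nat) (N : A -> Prop) : Prop :=
  (forall X : A, N X <->
     forall (i : nat) (Y : A), (1 <= i <= d.-1)%N -> N Y -> ext0 i X Y) /\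
  (forall X : A, N X <->
     forall (i : nat) (Y : A), (1 <= i <= d.-1)%N -> N Y -> ext0 i Y X).

Definition dZ_rigid (d : nat) (N : A -> Prop) : Prop :=
  forall (i : int) (X Y : A), ~~ (d %| i)%Z -> N X -> N Y -> ext0 i X Y.

End ClusterTilting.

Definition exact_cluster_tilting (E : exact_category) (d : nat)
    (N : E -> Prop) : Prop :=
  [/\ functorially_finite N,
      ext_orthogonal (@exact_ext_vanish E) d N
    & forall A : E,
        (exists (X : E) (i : hom A X), N X /\ adm_mono i) /\
        (exists (X : E) (p : hom X A), N X /\ adm_epi p)].

Definition exact_dZ_cluster_tilting (E : exact_category) (d : nat)
    (N : E -> Prop) : Prop :=
  exact_cluster_tilting d N /\ dZ_rigid (@exact_ext_vanish E) d N.

(** For a triangulated category [T], the definition only involves the category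
    [T] and the action [Sigma i] on objects of the powers of the suspension:
    [Ext^i(X, Y) = Hom(X, Sigma^i Y)], a group which is zero iff any two of its
    elements are equal. *)
Definition tri_ext_vanish (T : category) (Sigma : int -> T -> T)
    (i : int) (X Y : T) : Prop :=
  forall f g : hom X (Sigma i Y), f = g.

Definition tri_cluster_tilting (T : category) (Sigma : int -> T -> T) (d : nat)
    (N : T -> Prop) : Prop :=
  functorially_finite N /\ ext_orthogonal (tri_ext_vanish Sigma) d N.

Definition tri_dZ_cluster_tilting (T : category) (Sigma : int -> T -> T)
    (d : nat) (N : T -> Prop) : Prop :=
  tri_cluster_tilting Sigma d N /\ dZ_rigid (tri_ext_vanish Sigma) d N.

Section Complexes.
Variable C : preadditive.

(** The differential is given for all pairs of degrees and required to vanish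
    outside [j = i + 1]; this avoids transports along equalities of degrees. *)
Record complex := Complex {
  cx :> int -> C;
  cd : forall i j : int, hom (cx i) (cx j);
  cd_shape : forall i j : int, j != i + 1 -> cd i j = 0;
  cd_sq : forall i j k : int, cd j k ∘ cd i j = 0 }.

Record cmap (X Y : complex) := Cmap {
  cm :> forall n : int, hom (X n) (Y n);
  cm_comm : forall i j : int, cm j ∘ cd X i j = cd Y i j ∘ cm i }.

Definition cmap_id (X : complex) : cmap X X.
Proof.
by exists (fun n => idm (X n)) => i j; rewrite comp1m compm1.
Defined.

Definition cmap_comp (X Y Z : complex) (g : cmap Y Z) (f : cmap X Y) :
  cmap X Z.
Proof.
exists (fun n => g n ∘ f n) => i j.
by rewrite -compA cm_comm compA cm_comm compA.
Defined.

Definition homotopic (X Y : complex) (f g : cmap X Y) : Prop :=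
  exists h : forall i j : int, hom (X i) (Y j), forall n : int,
    f n - g n = cd Y (n - 1) n ∘ h n (n - 1) + h (n + 1) n ∘ cd X n (n + 1).

Lemma homotopic_refl (X Y : complex) (f : cmap X Y) : homotopic f f.
Proof.
by exists (fun _ _ => 0) => n; rewrite subrr compm0 comp0m addr0.
Qed.

Lemma homotopic_sym (X Y : complex) (f g : cmap X Y) :
  homotopic f g -> homotopic g f.
Proof.
case=> h fg; exists (fun i j => - h i j) => n.
by rewrite -opprB fg compmN compNm opprD.
Qed.

Lemma homotopic_trans (X Y : complex) (f g k : cmap X Y) :
  homotopic f g -> homotopic g k -> homotopic f k.
Proof.
move=> [h fg] [h' gk]; exists (fun i j => h i j + h' i j) => n.
by rewrite -(subrKA (g n)) fg gk compmDr compmDl addrACA.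
Qed.

Lemma homotopic_comp (X Y Z : complex) (g g' : cmap Y Z) (f f' : cmap X Y) :
  homotopic g g' -> homotopic f f' ->
  homotopic (cmap_comp g f) (cmap_comp g' f').
Proof.
move=> [h gg'] [k ff'].
exists (fun i j => h i j ∘ f i + g' j ∘ k i j) => n /=.
have -> : g n ∘ f n - g' n ∘ f' n = (g n - g' n) ∘ f n + g' n ∘ (f n - f' n).
  by rewrite compmBl compmBr subrKA.
rewrite gg' ff' ?(compmDl, compmDr) -!compA cm_comm !compA -cm_comm.
by rewrite -!compA addrACA.
Qed.

Lemma homotopic_eq (X Y : complex) (f g : cmap X Y) :
  (forall n, f n = g n) -> homotopic f g.
Proof.
move=> fg; exists (fun _ _ => 0) => n.
by rewrite fg subrr compm0 comp0m addr0.
Qed.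

Definition raw_homotopy_category : raw_category.
Proof.
apply: (@RawCategory complex cmap homotopic cmap_id cmap_comp).
- exact: homotopic_refl.
- exact: homotopic_sym.
- exact: homotopic_trans.
- exact: homotopic_comp.
- by move=> *; apply: homotopic_eq => n /=; rewrite compA.
- by move=> *; apply: homotopic_eq => n /=; rewrite comp1m.
- by move=> *; apply: homotopic_eq => n /=; rewrite compm1.
Defined.

Definition homotopy_category : category :=
  quotient_category raw_homotopy_category.

Definition homotopy_class (X Y : complex) (f : cmap X Y) :
    @hom homotopy_category X Y :=
  @mkhom raw_homotopy_category X Y f.

(** [Z] is a mapping cone of [f : X -> Y]: [Z^n = X^(n+1) (+) Y^n], with
    differential [(x, y) |-> (- d x, f x + d y)]. *)
Definition is_cone (X Y : complex) (f : cmap X Y) (Z : complex) : Prop :=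
  exists (i1 : forall n : int, hom (X (n + 1)) (Z n))
         (i2 : forall n : int, hom (Y n) (Z n))
         (p1 : forall n : int, hom (Z n) (X (n + 1)))
         (p2 : forall n : int, hom (Z n) (Y n)),
    forall n : int,
      is_biproduct (i1 n) (i2 n) (p1 n) (p2 n) /\
      cd Z n (n + 1) =
        - (i1 (n + 1) ∘ cd X (n + 1) (n + 1 + 1) ∘ p1 n)
        + i2 (n + 1) ∘ f (n + 1) ∘ p1 n
        + i2 (n + 1) ∘ cd Y n (n + 1) ∘ p2 n.

(** [shift k X] is [Sigma^k X]: [(Sigma^k X)^n = X^(n+k)], with differential
    [(-1)^k d]. *)
Definition shift_d (k : int) (X : complex) (i j : int) :
    hom (X (i + k)) (X (j + k)) :=
  if odd `|k|%N then - cd X (i + k) (j + k) else cd X (i + k) (j + k).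

Lemma shift_d_shape (k : int) (X : complex) (i j : int) :
  j != i + 1 -> shift_d k X i j = 0.
Proof.
move=> ij; rewrite /shift_d cd_shape ?oppr0 ?if_same //.
by rewrite addrAC (inj_eq (addIr k)).
Qed.

Lemma shift_d_sq (k : int) (X : complex) (i j l : int) :
  shift_d k X j l ∘ shift_d k X i j = 0.
Proof.
by rewrite /shift_d; case: ifP => _; rewrite ?compNm ?compmN ?opprK cd_sq.
Qed.

Definition shift (k : int) (X : complex) : complex :=
  @Complex (fun n => X (n + k)) (shift_d k X)
    (@shift_d_shape k X) (@shift_d_sq k X).

End Complexes.

Section SingularityCategory.
Variable E : exact_category.

Definition over_projectives (X : complex E) : Prop :=
  forall n : int, projective (X n).

Definition right_bounded (X : complex E) : Prop :=
  exists N : int, forall n : int, N <= n -> zero_obj (X n).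

Definition left_bounded (X : complex E) : Prop :=
  exists N : int, forall n : int, n <= N -> zero_obj (X n).

(** Exactness at [X^n] in the exact category: [X^(n-1) -> X^n] factors as an
    admissible epimorphism, cokernel of [X^(n-2) -> X^(n-1)], followed by an
    admissible monomorphism, kernel of [X^n -> X^(n+1)]. *)
Definition exact_at (X : complex E) (n : int) : Prop :=
  exists (Z : E) (p : hom (X (n - 1)) Z) (i : hom Z (X n)),
    [/\ adm_epi p, adm_mono i, i ∘ p = cd X (n - 1) n,
        is_cokernel p (cd X (n - 2) (n - 1))
      & is_kernel i (cd X n (n + 1))].

Definition eventually_exact (X : complex E) : Prop :=
  exists N : int, forall n : int, n <= N -> exact_at X n.

Definition in_Kmb (X : complex E) : Prop :=
  [/\ over_projectives X, right_bounded X & eventually_exact X].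

Definition in_Kb (X : complex E) : Prop :=
  [/\ over_projectives X, right_bounded X & left_bounded X].

Definition Kmb : category :=
  @full_subcategory (homotopy_category E) in_Kmb.

(** The Verdier quotient [K^{-,b}(P)/K^b(P)] inverts the morphisms whose cone
    lies in [K^b(P)], i.e. is isomorphic in the homotopy category to an object
    of [K^b(P)]. *)
Definition cone_in_Kb (X Y : Kmb) (phi : hom X Y) : Prop :=
  exists (f : cmap (sval X) (sval Y)) (Z B : complex E),
    [/\ phi = homotopy_class f, is_cone f Z, in_Kb B
      & @isomorphic (homotopy_category E) Z B].

Definition singularity_category : category :=
  localization cone_in_Kb.

Lemma is_iso_id (A : E) : is_iso (idm A).
Proof. by exists (idm A); rewrite comp1m. Qed.

Lemma adm_epiN (Y Z : E) (p : hom Y Z) : adm_epi p -> adm_epi (- p).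
Proof.
case=> X [i ip]; exists X, i.
apply: (conf_iso (c := - idm Z) (conflation_exact E)
  (is_iso_id X) (is_iso_id Y) _ _ _ ip).
- by exists (- idm Z); rewrite compNm compmN comp1m opprK.
- by rewrite comp1m compm1.
- by rewrite compNm comp1m compm1.
Qed.

Lemma is_kernelN (X Y Z : E) (i : hom X Y) (p : hom Y Z) :
  is_kernel i p -> is_kernel i (- p).
Proof.
case=> pi0 ker; split; first by rewrite compNm pi0 oppr0.
by move=> T f /eqP; rewrite compNm oppr_eq0 => /eqP /ker.
Qed.

Lemma is_cokernelNN (X Y Z : E) (p : hom Y Z) (i : hom X Y) :
  is_cokernel p i -> is_cokernel (- p) (- i).
Proof.
case=> pi0 coker; split; first by rewrite compNm compmN pi0 !oppr0.
move=> T f /eqP; rewrite compmN oppr_eq0 => /eqP /coker [g [gp gu]].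
exists (- g); split; first by rewrite compNm compmN opprK.
by move=> h hp; rewrite (gu (- h)) ?opprK // -hp compNm compmN.
Qed.

Lemma exact_at_shift (k : int) (X : complex E) (n : int) :
  exact_at X (n + k) -> exact_at (shift k X) n.
Proof.
rewrite /exact_at (addrAC n k (- 1)) (addrAC n k (- 2)) (addrAC n k 1).
case=> Z [p [i [ep mi ipd cokp keri]]].
rewrite /= /shift_d; case: ifP => _; last by exists Z, p, i.
exists Z, (- p), i; split=> //.
- exact: adm_epiN.
- by rewrite compmN ipd.
- exact: is_cokernelNN.
- exact: is_kernelN.
Qed.

Lemma shift_Kmb (k : int) (X : complex E) : in_Kmb X -> in_Kmb (shift k X).
Proof.
case=> projX [N rX] [M eX]; split.
- by move=> n; apply: projX.
- by exists (N - k) => n; rewrite lerBlDr => /rX.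
- by exists (M - k) => n; rewrite lerBrDr => /eX /exact_at_shift.
Qed.

Definition Sigma (k : int) (X : singularity_category) : singularity_category :=
  exist in_Kmb (shift k (sval X)) (shift_Kmb k (svalP X)).

(** Membership of some kernel in [M] includes its existence; a cluster tilting
    [M] is closed under isomorphism, so the choice of kernel is immaterial. *)
Definition eventual_cycles_in (d : nat) (M : E -> Prop)
    (P : singularity_category) : Prop :=
  exists N : int, forall i : int, i <= N ->
    exists (Z : E) (z : hom Z (sval P (d%:Z * i))),
      is_kernel z (cd (sval P) (d%:Z * i) (d%:Z * i + 1)) /\ M Z.

End SingularityCategory.

(* Main.v *)
Require Import Defs.
From mathcomp Require Import all_boot all_order all_algebra.
From mathcomp Require Import boolp zify.
Import Defs.

(** Why the theorem holds.

    Write [S] for the suspension and [N] for the subcategory of the theorem.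
    The morphisms [X -> Y] of the singularity category are the germs at minus
    infinity of chain maps, modulo germs of homotopies ([sing_germ_full],
    [sing_germ_faithful]).  Indeed the projection of [Y] onto its part in very
    negative degrees has a bounded cone, hence is inverted, and a chain map
    that is only defined in very negative degrees extends by zero to such a
    truncation.  Conversely, a contraction of the germ of the cone of a chain
    map consists of an inverse of its germ and of the two homotopies.

    In negative degrees the complexes are projective resolutions of their
    cycles.  So a germ [X -> Y] is null as soon as, for one sufficiently
    negative [n], the map [Z^n X -> Z^n Y] extends to [X^n]; the obstruction
    lies in [Ext^1(Z^(n+1) X, Z^n Y)].  Suppose that the cycles of [X] and [Y]
    lie in [M] in two distinct residue classes of degrees modulo [d].  Choosing
    [n] with [Z^n Y] in [M], dimension shifting turns this group into some
    [Ext^j(Z^(n+j) X, Z^n Y)] with [0 < j < d] and both arguments in [M], and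
    it vanishes.  This is the rigidity of [N] ([tilted_null]).

    For the approximations, choose [n] divisible by [d] and a right
    [M]-approximation [M_0 -> Z^n X].  The projective resolution [Y] of [M_0]
    belongs to [N], because [M] is closed under [d]-th syzygies
    ([tilting_syzygy]; this uses that [Ext^i(M, M)] also vanishes for
    [d < i < 2 d]).  The approximation lifts to a germ [Y -> X], the [n]-th
    cycles of whose cocone are a pullback, and one more group [Ext^i(M, -)]
    vanishes on them than on [Z^n X] ([approximation_step]).  After [d - 1]
    steps the cycles lie in [M], so that [X] is built from objects of [N],
    [S N], ..., [S^(d-1) N] ([tilted_resolved]).  By rigidity the first map
    [Y -> X] of this resolution is a right approximation of [X], and the
    composite of its connecting maps, up to a suspension, a left approximation
    ([resolved_right_approx], [resolved_left_approx]).  The universal property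
    of these approximations also holds for every object which satisfies the
    orthogonality condition, in particular for [X] itself if it does; then [X]
    is a retract of an object of [N], and [N] is closed under retracts
    ([tilted_retract]).

    Complexes are handled through the sequences of their terms in degrees
    [0, -1, -2, ...], indexed by natural numbers, and the inverse suspension
    [Om] is used instead of the suspension, because on such sequences it is a
    mere reindexing. *)

Set Implicit Arguments.
Unset Strict Implicit.
Unset Printing Implicit Defensive.

Import Order.TTheory GRing.Theory Num.Theory.
Local Open Scope ring_scope.
Local Open Scope cat_scope.

(** * Dependent families *)

(** Complexes are indexed by integers while the constructions below are
    recursive over natural numbers.  A family given along an injection of
    indices extends to all indices without any transport in its statement. *)
Lemma extend_inj (I J : Type) (a : I -> J) (T : J -> Type) (t0 : forall j, T j)
    (y : forall i, T (a i)) : injective a ->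
  exists x : forall j, T j,
    (forall i, x (a i) = y i) /\
    (forall j, (forall i, a i <> j) -> x j = t0 j).
Proof.
move=> inja.
have ex j : exists v : T j, (forall i (e : a i = j), ecast j (T j) e (y i) = v)
    /\ ((forall i, a i <> j) -> v = t0 j).
  have [[i <-]|no] := pselect (exists i, a i = j).
    exists (y i); split=> [i' e|/(_ i) []//].
    have ii' := inja _ _ e; rewrite ii' in e *.
    by rewrite (Prop_irrelevance e erefl).
  exists (t0 j); split=> // i e.
  by case: no; exists i.
exists (fun j => sval (cid (ex j))); split=> [i|j].
  by case: (cid _) => v /= [/(_ i erefl) /= <-].
by move=> no; case: (cid _) => v /= [_]; apply.
Qed.

(** The family is total, with defaults before [N], so that its type does not
    mention [N]. *)
Lemma dep_choice (T : nat -> Type) (t0 : forall j, T j) (N : nat) (x0 : T N)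
    (P : forall j, T j -> Prop) (Q : forall j, T j -> T j.+1 -> Prop) :
  P N x0 ->
  (forall j x, (N <= j)%N -> P j x -> exists2 y, P j.+1 y & Q j x y) ->
  exists x : forall j, T j, x N = x0 /\
    forall j, (N <= j)%N -> P j (x j) /\ Q j (x j) (x j.+1).
Proof.
move=> P0 step.
have step' m (x : {x : T (m + N)%N | P _ x}) :
    exists y : {y : T (m.+1 + N)%N | P _ y}, Q (m + N)%N (sval x) (sval y).
  case: x => x /= Px; have [|y Py Qy] := step _ x _ Px; first exact: leq_addl.
  by exists (exist _ y Py).
pose z := nat_rect (fun m => {x : T (m + N)%N | P _ x}) (exist _ x0 P0)
  (fun m x => sval (cid (step' m x))).
have [] := @extend_inj nat nat (fun m => (m + N)%N) T t0 (fun m => sval (z m)).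
  exact: addIn.
move=> x [xE _]; exists x; split; first exact: (xE 0%N).
move=> j /subnK <-; set m := (j - N)%N.
have xS : x (m + N).+1 = sval (z m.+1) := xE m.+1.
rewrite xS (xE m); split; first exact: (svalP (z m)).
exact: svalP (cid (step' m (z m))).
Qed.

(** * Eventual properties *)

Definition eventually (P : nat -> Prop) : Prop :=
  exists N, forall k, (N <= k)%N -> P k.

Lemma eventually_and (P Q : nat -> Prop) :
  eventually P -> eventually Q -> eventually (fun k => P k /\ Q k).
Proof.
move=> [M PM] [N QN]; exists (maxn M N) => k.
by rewrite geq_max => /andP[/PM ? /QN ?].
Qed.

Lemma eventually_mono (P Q : nat -> Prop) :
  (forall k, P k -> Q k) -> eventually P -> eventually Q.
Proof. by move=> PQ [N PN]; exists N => k /PN /PQ. Qed.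

Lemma eventually_all (P : nat -> Prop) : (forall k, P k) -> eventually P.
Proof. by move=> allP; exists 0%N. Qed.

Lemma eventuallyS (P : nat -> Prop) :
  eventually P <-> eventually (fun k => P k.+1).
Proof.
split=> [[N PN]|[N PN]]; first by exists N => k Nk; apply/PN/leqW.
by exists N.+1 => -[|k] //; apply: PN.
Qed.

(** * Additive and exact categories *)

Section Preadditive.
Variable C : preadditive.

Lemma zero_obj_to (O X : C) (f : hom X O) : zero_obj O -> f = 0.
Proof. by move=> O0; rewrite -(comp1m f) O0 comp0m. Qed.

Lemma zero_obj_from (O X : C) (f : hom O X) : zero_obj O -> f = 0.
Proof. by move=> O0; rewrite -(compm1 f) O0 compm0. Qed.

Record biproduct (A B : C) := Biproduct {
  bobj : C;
  bi1 : hom A bobj;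
  bi2 : hom B bobj;
  bp1 : hom bobj A;
  bp2 : hom bobj B;
  biproductP : is_biproduct bi1 bi2 bp1 bp2 }.

Section Biproduct.
Variables (A B : C) (D : biproduct A B).

Definition bpair (T : C) (u : hom T A) (v : hom T B) : hom T (bobj D) :=
  bi1 D ∘ u + bi2 D ∘ v.

Definition bcopair (T : C) (u : hom A T) (v : hom B T) : hom (bobj D) T :=
  u ∘ bp1 D + v ∘ bp2 D.

Lemma bp1i1 : bp1 D ∘ bi1 D = idm A. Proof. by case: (biproductP D). Qed.
Lemma bp2i2 : bp2 D ∘ bi2 D = idm B. Proof. by case: (biproductP D). Qed.
Lemma bp1i2 : bp1 D ∘ bi2 D = 0. Proof. by case: (biproductP D). Qed.
Lemma bp2i1 : bp2 D ∘ bi1 D = 0. Proof. by case: (biproductP D). Qed.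
Lemma bi_p : bi1 D ∘ bp1 D + bi2 D ∘ bp2 D = idm (bobj D).
Proof. by case: (biproductP D). Qed.

Lemma bp1_pair T (u : hom T A) (v : hom T B) : bp1 D ∘ bpair u v = u.
Proof. by rewrite compmDr !compA bp1i1 bp1i2 comp1m comp0m addr0. Qed.

Lemma bp2_pair T (u : hom T A) (v : hom T B) : bp2 D ∘ bpair u v = v.
Proof. by rewrite compmDr !compA bp2i2 bp2i1 comp1m comp0m add0r. Qed.

Lemma bcopair_i1 T (u : hom A T) (v : hom B T) : bcopair u v ∘ bi1 D = u.
Proof. by rewrite compmDl -!compA bp1i1 bp2i1 compm1 compm0 addr0. Qed.

Lemma bcopair_i2 T (u : hom A T) (v : hom B T) : bcopair u v ∘ bi2 D = v.
Proof. by rewrite compmDl -!compA bp2i2 bp1i2 compm1 compm0 add0r. Qed.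

Lemma bpairE T (f : hom T (bobj D)) : f = bpair (bp1 D ∘ f) (bp2 D ∘ f).
Proof. by rewrite /bpair !compA -compmDl bi_p comp1m. Qed.

Lemma bpair_eq T (f g : hom T (bobj D)) :
  bp1 D ∘ f = bp1 D ∘ g -> bp2 D ∘ f = bp2 D ∘ g -> f = g.
Proof. by move=> e1 e2; rewrite (bpairE f) (bpairE g) e1 e2. Qed.

Lemma bcopair_eq T (f g : hom (bobj D) T) :
  f ∘ bi1 D = g ∘ bi1 D -> f ∘ bi2 D = g ∘ bi2 D -> f = g.
Proof.
by move=> e1 e2; rewrite -(compm1 f) -(compm1 g) -bi_p !compmDr !compA e1 e2.
Qed.

Lemma bcopair_pair T S (u : hom A T) (v : hom B T) (w : hom S A) (x : hom S B) :
  bcopair u v ∘ bpair w x = u ∘ w + v ∘ x.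
Proof. by rewrite compmDl -!compA bp1_pair bp2_pair. Qed.

Lemma bpair_comp T S (u : hom T A) (v : hom T B) (w : hom S T) :
  bpair u v ∘ w = bpair (u ∘ w) (v ∘ w).
Proof. by rewrite /bpair compmDl -!compA. Qed.

End Biproduct.

Lemma kernel_mono (X Y Z : C) (i : hom X Y) (p : hom Y Z) :
  is_kernel i p -> forall (T : C) (u v : hom T X), i ∘ u = i ∘ v -> u = v.
Proof.
move=> [pi0 ker] T u v uv.
have [|w [_ wu]] := ker T (i ∘ v); first by rewrite compA pi0 comp0m.
by rewrite -(wu _ uv) (wu v).
Qed.

Lemma kernel_lift (X Y Z : C) (i : hom X Y) (p : hom Y Z) :
  is_kernel i p -> forall (T : C) (f : hom T Y), p ∘ f = 0 ->
  exists g : hom T X, i ∘ g = f.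
Proof. by move=> [_ ker] T f /ker [g [gf _]]; exists g. Qed.

Lemma cokernel_epi (X Y Z : C) (p : hom Y Z) (i : hom X Y) :
  is_cokernel p i -> forall (T : C) (u v : hom Z T), u ∘ p = v ∘ p -> u = v.
Proof.
move=> [pi0 coker] T u v uv.
have [|w [_ wu]] := coker T (v ∘ p); first by rewrite -compA pi0 compm0.
by rewrite -(wu _ uv) (wu v).
Qed.

Lemma cokernel_desc (X Y Z : C) (p : hom Y Z) (i : hom X Y) :
  is_cokernel p i -> forall (T : C) (f : hom Y T), f ∘ i = 0 ->
  exists g : hom Z T, g ∘ p = f.
Proof. by move=> [_ coker] T f /coker [g [gf _]]; exists g. Qed.

Lemma kernel_intro (X Y Z : C) (i : hom X Y) (p : hom Y Z) :
  p ∘ i = 0 ->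
  (forall (T : C) (u v : hom T X), i ∘ u = i ∘ v -> u = v) ->
  (forall (T : C) (f : hom T Y), p ∘ f = 0 -> exists g : hom T X, i ∘ g = f) ->
  is_kernel i p.
Proof.
move=> pi0 mono lift; split=> // T f /lift [g gf]; exists g; split=> // g' g'f.
by apply: mono; rewrite gf g'f.
Qed.

Lemma kernel_iso (X X' Y Z Z' : C) (i : hom X Y) (p : hom Y Z)
    (i' : hom X' Y) (p' : hom Y Z') :
  is_kernel i p -> is_kernel i' p' ->
  (forall (T : C) (f : hom T Y), p ∘ f = 0 <-> p' ∘ f = 0) ->
  exists2 a : hom X X', is_iso a & i' ∘ a = i.
Proof.
move=> k k' kk'; have [pi0 _] := k; have [pi0' _] := k'.
have [a ia] := kernel_lift k' (proj1 (kk' _ i) pi0).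
have [b ib] := kernel_lift k (proj2 (kk' _ i') pi0').
exists a => //; exists b.
  by apply: (kernel_mono k); rewrite compA ib ia compm1.
by apply: (kernel_mono k'); rewrite compA ia ib compm1.
Qed.

Lemma pullback_eq (A B A' B' : C) (p' : hom A' B') (f' : hom A' A)
    (f : hom B' B) (p : hom A B) : is_pullback p' f' f p ->
  forall (T : C) (u v : hom T A'), f' ∘ u = f' ∘ v -> p' ∘ u = p' ∘ v -> u = v.
Proof.
move=> [pf univ] T u v fuv puv.
have [|w [_ wu]] := univ T (f' ∘ v) (p' ∘ v); first by rewrite !compA pf.
by rewrite -(wu u) // (wu v).
Qed.

Lemma pullback_lift (A B A' B' : C) (p' : hom A' B') (f' : hom A' A)
    (f : hom B' B) (p : hom A B) : is_pullback p' f' f p ->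
  forall (T : C) (u : hom T A) (v : hom T B'), p ∘ u = f ∘ v ->
  exists w : hom T A', f' ∘ w = u /\ p' ∘ w = v.
Proof. by move=> [_ univ] T u v /univ [w [ww _]]; exists w. Qed.

Lemma pullback_intro (A B A' B' : C) (p' : hom A' B') (f' : hom A' A)
    (f : hom B' B) (p : hom A B) :
  p ∘ f' = f ∘ p' ->
  (forall (T : C) (u v : hom T A'),
    f' ∘ u = f' ∘ v -> p' ∘ u = p' ∘ v -> u = v) ->
  (forall (T : C) (u : hom T A) (v : hom T B'), p ∘ u = f ∘ v ->
    exists w : hom T A', f' ∘ w = u /\ p' ∘ w = v) ->
  is_pullback p' f' f p.
Proof.
move=> pf mono lift; split=> // T u v /lift [w [wu wv]].
exists w; split=> // w' [wu' wv'].
by apply: mono; rewrite ?wu ?wv ?wu' ?wv'.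
Qed.

Lemma pushout_desc (A B A' B' : C) (i : hom A B) (f : hom A A')
    (i' : hom A' B') (f' : hom B B') : is_pushout i f i' f' ->
  forall (T : C) (u : hom B T) (v : hom A' T), u ∘ i = v ∘ f ->
  exists w : hom B' T, w ∘ f' = u /\ w ∘ i' = v.
Proof. by move=> [_ univ] T u v /univ [w [ww _]]; exists w. Qed.

Lemma pushout_eq (A B A' B' : C) (i : hom A B) (f : hom A A')
    (i' : hom A' B') (f' : hom B B') : is_pushout i f i' f' ->
  forall (T : C) (u v : hom B' T), u ∘ f' = v ∘ f' -> u ∘ i' = v ∘ i' -> u = v.
Proof.
move=> [fi univ] T u v fuv iuv.
have [|w [_ wu]] := univ T (v ∘ f') (v ∘ i'); first by rewrite -!compA fi.
by rewrite -(wu u) // (wu v).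
Qed.

Lemma is_iso_inv (A B : C) (f : hom A B) :
  is_iso f -> exists2 g : hom B A, is_iso g & g ∘ f = idm A /\ f ∘ g = idm B.
Proof. by case=> g gf fg; exists g; [exists f|split]. Qed.

End Preadditive.

Section Exact.
Variable E : exact_category.

Lemma biproduct_ex (A B : E) : inhabited (biproduct A B).
Proof.
have [_ /(_ A B) [X [i1 [i2 [p1 [p2 bip]]]]]] := ecat_additive E.
exact: inhabits (Biproduct bip).
Qed.

Definition bsum (A B : E) : biproduct A B :=
  inhabited_witness (biproduct_ex A B).

Definition zobj : E := sval (cid (proj1 (ecat_additive E))).

Lemma zobjP : zero_obj zobj.
Proof. exact: (svalP (cid (proj1 (ecat_additive E)))). Qed.

Lemma conf_ker (X Y Z : E) (i : hom X Y) (p : hom Y Z) :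
  conflation i p -> is_kernel i p.
Proof. exact: (conf_kernel (conflation_exact E)). Qed.

Lemma conf_coker (X Y Z : E) (i : hom X Y) (p : hom Y Z) :
  conflation i p -> is_cokernel p i.
Proof. exact: (conf_cokernel (conflation_exact E)). Qed.

Lemma conf_epi (X Y Z : E) (i : hom X Y) (p : hom Y Z) :
  conflation i p -> adm_epi p.
Proof. by move=> c; exists X, i. Qed.

Lemma adm_epi_epi (Y Z : E) (p : hom Y Z) : adm_epi p ->
  forall (T : E) (u v : hom Z T), u ∘ p = v ∘ p -> u = v.
Proof. by case=> X [i /conf_coker c]; apply: cokernel_epi c. Qed.

Lemma deflation_conflation (X Y Z : E) (i : hom X Y) (p : hom Y Z) :
  adm_epi p -> is_kernel i p -> conflation i p.
Proof.
move=> [X' [i' c]] ker.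
have [a isoa ia] := kernel_iso (conf_ker c) ker (fun _ _ => iff_refl _).
apply: (conf_iso (conflation_exact E) isoa (is_iso_id Y) (is_iso_id Z) _ _ c).
  by rewrite comp1m ia.
by rewrite comp1m compm1.
Qed.

Lemma inflation_conflation (X Y Z : E) (i : hom X Y) (p : hom Y Z) :
  adm_mono i -> is_cokernel p i -> conflation i p.
Proof.
move=> [Z' [p' c]] coker; have coker' := conf_coker c.
have [pi0 _] := coker; have [pi0' _] := coker'.
have [a ap] := cokernel_desc coker' pi0.
have [b bp] := cokernel_desc coker pi0'.
have isoa : is_iso a.
  exists b; first by apply: (cokernel_epi coker'); rewrite -compA ap bp comp1m.
  by apply: (cokernel_epi coker); rewrite -compA bp ap comp1m.
apply: (conf_iso (conflation_exact E) (is_iso_id X) (is_iso_id Y) isoa _ _ c).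
  by rewrite comp1m compm1.
by rewrite compm1.
Qed.

Lemma adm_epi_comp (X Y Z : E) (q : hom Y Z) (p : hom X Y) :
  adm_epi q -> adm_epi p -> adm_epi (q ∘ p).
Proof. exact: (epi_comp (conflation_exact E)). Qed.

Lemma adm_epi_iso (W Y Z : E) (p : hom Y Z) (w : hom W Y) :
  adm_epi p -> is_iso w -> adm_epi (p ∘ w).
Proof.
move=> [X [i c]] /is_iso_inv [w' isow' [w'w ww']]; exists X, (w' ∘ i).
apply: (conf_iso (conflation_exact E) (is_iso_id X) isow' (is_iso_id Z) _ _ c).
  by rewrite compm1.
by rewrite comp1m -compA ww' compm1.
Qed.

(** The axioms only provide some pullback that is a deflation; any other one
    differs from it by an isomorphism. *)
Lemma pullback_deflation (A B A' B' : E) (p' : hom A' B') (f' : hom A' A)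
    (f : hom B' B) (p : hom A B) :
  is_pullback p' f' f p -> adm_epi p -> adm_epi p'.
Proof.
move=> pb /(epi_pullback (conflation_exact E) f) [A2 [p2 [f2 [pb2 ep2]]]].
have [pf _] := pb; have [pf2 _] := pb2.
have [a [fa pa]] := pullback_lift pb2 pf.
have [b [fb pb']] := pullback_lift pb pf2.
rewrite -pa; apply: adm_epi_iso => //; exists b.
  by apply: (pullback_eq pb); rewrite compA ?fb ?pb' ?fa ?pa compm1.
by apply: (pullback_eq pb2); rewrite compA ?fa ?pa ?fb ?pb' compm1.
Qed.

(** The map in question is the pullback of the deflation [q] along [l]: this
    pullback splits as [Q + K] because [q] lifts through [l]. *)
Lemma bcopair_deflation (K L A Q : E) (k : hom K L) (l : hom L A)
    (q : hom Q A) (m : hom Q L) (D : biproduct Q K) :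
  conflation k l -> adm_epi q -> l ∘ m = q -> adm_epi (bcopair D m k).
Proof.
move=> c epq lm; have kerk := conf_ker c; have [lk0 _] := kerk.
have lD : l ∘ bcopair D m k = q ∘ bp1 D.
  by rewrite compmDr !compA lk0 lm comp0m addr0.
apply: (pullback_deflation (p := q) (f := l) (f' := bp1 D)) => //.
apply: pullback_intro => [//|T u v e1 e2|T u v quv].
  apply: bpair_eq => //; apply: (kernel_mono kerk).
  move: e2; rewrite /bcopair !compmDl -!compA e1.
  exact: addrI.
have [|w kw] := kernel_lift kerk (f := v - m ∘ u).
  by rewrite compmBr compA lm quv subrr.
by exists (bpair D u w); rewrite bp1_pair bcopair_pair kw addrC subrK.
Qed.

(** This map is the pullback of [p] along the projection [Q + Z -> Z]. *)
Lemma bsum_deflation (Q P Z : E) (p : hom P Z) (D : biproduct Q P)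
    (D' : biproduct Q Z) : adm_epi p ->
  adm_epi (bpair D' (bp1 D) (p ∘ bp2 D)).
Proof.
apply: (pullback_deflation (f' := bp2 D) (f := bp2 D')).
apply: pullback_intro => [|T u v e1 e2|T u v e].
- by rewrite bp2_pair.
- apply: bpair_eq => //.
  by have := congr1 (comp (bp1 D')) e2; rewrite !compA bp1_pair.
- exists (bpair D (bp1 D' ∘ v) u); rewrite bp2_pair; split=> //.
  rewrite bpair_comp bp1_pair -compA bp2_pair e; exact/esym/bpairE.
Qed.

Lemma projective_zero (O : E) : zero_obj O -> projective O.
Proof.
by move=> O0 Y Z p f _; exists 0; rewrite compm0 (zero_obj_from f O0).
Qed.

Lemma projective_bsum (P Q : E) (D : biproduct P Q) :
  projective P -> projective Q -> projective (bobj D).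
Proof.
move=> pP pQ Y Z p f ep.
have [u pu] := pP _ _ p (f ∘ bi1 D) ep.
have [v pv] := pQ _ _ p (f ∘ bi2 D) ep.
exists (bcopair D u v); apply: (bcopair_eq (D := D)).
  by rewrite -compA bcopair_i1.
by rewrite -compA bcopair_i2.
Qed.

Lemma projective_retract (P Q : E) (u : hom Q P) (v : hom P Q) :
  v ∘ u = idm Q -> projective P -> projective Q.
Proof.
move=> vu pP Y Z p f ep; have [g pg] := pP _ _ p (f ∘ v) ep.
by exists (g ∘ u); rewrite compA pg -compA vu compm1.
Qed.

End Exact.

(** * Yoneda extensions and projective resolutions *)

Section YonedaExt.
Variable E : exact_category.

(** [yext_map] fixes the left-hand end.  Both ends must be free to compare an
    extension of [A] by [B] with a resolution of [A], whose left-hand end is a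
    syzygy of [A]. *)
Fixpoint ymap (n : nat) (A A' B B' : E) (a : hom A A') (b : hom B B') :
    yext n A B -> yext n A' B' -> Prop :=
  match n with
  | 0 => fun x x' => ses_map b a x x'
  | n.+1 => fun x x' => exists k : hom (tag x) (tag x'),
      ymap k b (tagged x).1 (tagged x').1 /\
      ses_map k a (tagged x).2 (tagged x').2
  end.

Fixpoint projective_yext (n : nat) (A K : E) : yext n A K -> Prop :=
  match n with
  | 0 => fun s => projective (ses_mid s)
  | n.+1 => fun x => projective_yext (tagged x).1 /\
      projective (ses_mid (tagged x).2)
  end.

(** For a projective resolution with left-hand syzygy [K], the maps [c] with
    this property are those that represent zero in [Ext(A, B)]. *)
Fixpoint extends_along (n : nat) (A K B : E) (c : hom K B) :
    yext n A K -> Prop :=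
  match n with
  | 0 => fun s => exists c', c' ∘ ses_inc s = c
  | n.+1 => fun x => extends_along c (tagged x).1
  end.

(** The differences of maps between right-hand ends over which comparison maps
    are homotopic. *)
Definition lifts_along (n : nat) (A B T : E) (g : hom T A) :
    yext n A B -> Prop :=
  match n with
  | 0 => fun s => exists h, ses_prj s ∘ h = g
  | n.+1 => fun x => exists h, ses_prj (tagged x).2 ∘ h = g
  end.

Lemma ses_inc_mono (X Z : E) (s : ses X Z) (T : E) (u v : hom T X) :
  ses_inc s ∘ u = ses_inc s ∘ v -> u = v.
Proof. exact: (kernel_mono (conf_ker (ses_conf s))). Qed.

Lemma ses_prj_inc (X Z : E) (s : ses X Z) : ses_prj s ∘ ses_inc s = 0.
Proof. by case: (conf_ker (ses_conf s)). Qed.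

Lemma ses_prj_lift (X Z P : E) (s : ses X Z) (f : hom P Z) :
  projective P -> exists g, ses_prj s ∘ g = f.
Proof. by move=> pP; apply: pP; apply: conf_epi (ses_conf s). Qed.

Lemma ses_inc_lift (X Z T : E) (s : ses X Z) (f : hom T (ses_mid s)) :
  ses_prj s ∘ f = 0 -> exists g, ses_inc s ∘ g = f.
Proof. exact: (kernel_lift (conf_ker (ses_conf s))). Qed.

Lemma extends_alongB (n : nat) (A K B : E) (c c' : hom K B) (x : yext n A K) :
  extends_along c x -> extends_along c' x -> extends_along (c - c') x.
Proof.
elim: n A x => [A s [u <-] [u' <-]|n IH A x] /=; last exact: IH.
by exists (u - u'); rewrite compmBl.
Qed.

Lemma extends_alongN (n : nat) (A K B : E) (c : hom K B) (x : yext n A K) :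
  extends_along c x -> extends_along (- c) x.
Proof.
by move=> ec; have := extends_alongB (extends_alongB ec ec) ec;
  rewrite subrr sub0r.
Qed.

Lemma lifts_along_factor (n : nat) (A B T P : E) (u : hom T P) (v : hom P A)
    (x : yext n A B) : projective P -> lifts_along (v ∘ u) x.
Proof.
case: n x => [s|n x] /= pP.
  by have [h <-] := ses_prj_lift s v pP; exists (h ∘ u); rewrite compA.
by have [h <-] := ses_prj_lift (tagged x).2 v pP; exists (h ∘ u); rewrite compA.
Qed.

Lemma lifts_along0 (n : nat) (A B T : E) (g : hom T A) (x : yext n A B) :
  lifts_along (g - g) x.
Proof.
have -> : g - g = (0 : hom (zobj E) A) ∘ (0 : hom T (zobj E)).
  by rewrite subrr comp0m.
exact: lifts_along_factor (projective_zero (zobjP E)).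
Qed.

Lemma ses_map_ex (K A0 B A : E) (s : ses K A0) (s' : ses B A) (a : hom A0 A) :
  projective (ses_mid s) -> exists f, ses_map f a s s'.
Proof.
move=> pP; have [b pb] := ses_prj_lift s' (a ∘ ses_prj s) pP.
have [|f fE] := ses_inc_lift (f := b ∘ ses_inc s).
  by rewrite compA pb -compA ses_prj_inc compm0.
by exists f, b.
Qed.

(** Comparison theorem: lift through one epimorphism after the other, starting
    from the right-hand end. *)
Lemma ymap_ex (n : nat) (A0 A B K : E) (a : hom A0 A) (r : yext n A0 K)
    (x : yext n A B) : projective_yext r -> exists f, ymap a f r x.
Proof.
elim: n A0 A a r x => [|n IH] A0 A a r x /=; first exact: ses_map_ex.
move=> [pr pm]; have [k kE] := ses_map_ex (tagged x).2 a pm.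
by have [f fE] := IH _ _ k _ (tagged x).1 pr; exists f, k.
Qed.

Lemma ses_map_homotopy (K A0 B A : E) (s : ses K A0) (s' : ses B A)
    (a a' : hom A0 A) (f f' : hom K B) (h : hom A0 (ses_mid s')) :
  ses_map f a s s' -> ses_map f' a' s s' -> ses_prj s' ∘ h = a - a' ->
  exists u, f - f' = u ∘ ses_inc s.
Proof.
move=> [b [bi pb]] [b' [bi' pb']] ph.
have [|u uE] := ses_inc_lift (f := b - b' - h ∘ ses_prj s).
  by rewrite !compmBr pb pb' compA ph compmBl subrr.
exists u; apply: (@ses_inc_mono _ _ s').
rewrite compA uE !compmBl compmBr -bi -bi' -(compA h) ses_prj_inc.
by rewrite compm0 subr0.
Qed.

(** A homotopy is pushed from the right-hand end to the left-hand end: at each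
    splice it factors through a projective and so lifts once more. *)
Lemma ymap_homotopy (n : nat) (A0 A B K : E) (a a' : hom A0 A) (f f' : hom K B)
    (r : yext n A0 K) (x : yext n A B) :
  projective_yext r -> ymap a f r x -> ymap a' f' r x ->
  lifts_along (a - a') x -> extends_along (f - f') r.
Proof.
elim: n A0 A a a' r x => [|n IH] A0 A a a' r x /=.
  by move=> _ m m' [h hE]; have [u ->] := ses_map_homotopy m m' hE; exists u.
move=> [pr pm] [k [mk sk]] [k' [mk' sk']] [h hE].
have [u kk'] := ses_map_homotopy sk sk' hE.
apply: (IH _ _ k k' _ _ pr mk mk').
by rewrite kk'; apply: lifts_along_factor.
Qed.

Lemma ses_map_comp (X Z X' Z' X2 Z2 : E) (a : hom X X') (c : hom Z Z')
    (a' : hom X' X2) (c' : hom Z' Z2) (s : ses X Z) (s' : ses X' Z')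
    (s2 : ses X2 Z2) :
  ses_map a c s s' -> ses_map a' c' s' s2 -> ses_map (a' ∘ a) (c' ∘ c) s s2.
Proof.
move=> [b [bi pb]] [b' [bi' pb']]; exists (b' ∘ b); split.
  by rewrite -compA bi compA bi' compA.
by rewrite compA pb' -compA pb compA.
Qed.

Lemma ymap_comp (n : nat) (A A' B K : E) (a : hom A A') (c : hom K B) A0
    (a0 : hom A0 A) (r : yext n A0 K) (x : yext n A B) (x' : yext n A' B) :
  ymap a0 c r x -> yext_map a x x' -> ymap (a ∘ a0) c r x'.
Proof.
elim: n A A' A0 a a0 r x x' => [|n IH] A A' A0 a a0 r x x' /=.
  by move=> m m'; have := ses_map_comp m m'; rewrite comp1m.
move=> [k [mk sk]] [k' [mk' sk']]; exists (k' ∘ k); split.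
  exact: IH mk mk'.
exact: ses_map_comp sk sk'.
Qed.

(** Besides the existence of the pushout conflation, its universal property is
    needed: every map of extensions factors through the pushout. *)
Lemma ses_pushout (K A B : E) (s : ses K A) (c : hom K B) :
  exists t : ses B A, ses_map c (idm A) s t /\
    forall A' (s' : ses B A') (a : hom A A'),
      ses_map c a s s' -> ses_map (idm B) a t s'.
Proof.
have [|B' [i' [f' [po mi']]]] :=
  mono_pushout (conflation_exact E) (i := ses_inc s) c.
  by exists A, (ses_prj s); apply: ses_conf.
have [poE _] := po.
have [|p' [pf' pi']] := pushout_desc po (u := ses_prj s) (v := 0 : hom B A).
  by rewrite ses_prj_inc comp0m.
have c' : conflation i' p'.
  apply: inflation_conflation => //; split=> // T g gi0.
  have [|h hE] := cokernel_desc (conf_coker (ses_conf s)) (f := g ∘ f').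
    by rewrite -compA poE compA gi0 comp0m.
  exists h; split.
    apply: (pushout_eq po); first by rewrite -compA pf' hE.
    by rewrite -compA pi' compm0 gi0.
  move=> h' h'E; apply: (cokernel_epi (conf_coker (ses_conf s))).
  by rewrite hE -h'E -compA pf'.
exists (Ses c'); split; first by exists f'; rewrite comp1m.
move=> A' s' a [b [bi pb]].
have [w [wf wi]] := pushout_desc po bi.
exists w; split=> /=; first by rewrite compm1.
apply: (pushout_eq po); first by rewrite -!compA wf pf'.
by rewrite -!compA wi pi' ses_prj_inc compm0.
Qed.

(** Only the leftmost conflation of [r] changes, so this reduces to
    [ses_pushout]. *)
Lemma yext_pushout (n : nat) (A K B : E) (r : yext n A K) (c : hom K B) :
  exists y : yext n A B, ymap (idm A) c r y /\
    forall A' (x : yext n A' B) (a : hom A A'), ymap a c r x -> yext_map a y x.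
Proof.
elim: n A r => [|n IH] A r /=; first exact: ses_pushout.
have [y [ym yu]] := IH _ (tagged r).1.
exists (Tagged (fun K => (yext n K B * ses K A)%type) (y, (tagged r).2)).
split=> /=.
  exists (idm _); split=> //; exists (idm _).
  by rewrite !comp1m !compm1.
by move=> A' x a [k [mk sk]]; exists k; split=> //; apply: yu.
Qed.

(** An extension of [f] to the leftmost projective can be subtracted from the
    comparison map there, without changing it elsewhere. *)
Lemma ymap_kill (n : nat) (A0 A B K : E) (a : hom A0 A) (f : hom K B)
    (r : yext n A0 K) (x : yext n A B) :
  ymap a f r x -> extends_along f r -> ymap a 0 r x.
Proof.
elim: n A0 A a r x => [|n IH] A0 A a r x /=.
  move=> [b [bi pb]] [c cE]; exists (b - ses_inc x ∘ c); split.
    by rewrite compmBl bi -compA cE subrr compm0.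
  by rewrite compmBr pb compA ses_prj_inc comp0m subr0.
by move=> [k [mk sk]] ex; exists k; split=> //; apply: IH ex.
Qed.

(** The class of an extension, seen as a map out of a syzygy modulo the maps
    that extend to the projective, is invariant under equivalence. *)
Lemma yext_equiv_class (n : nat) (A K B : E) (r : yext n A K) (c : hom K B)
    (x y : yext n A B) : projective_yext r -> yext_equiv x y ->
  (exists2 f, ymap (idm A) f r x & extends_along (f - c) r) <->
  (exists2 f, ymap (idm A) f r y & extends_along (f - c) r).
Proof.
move=> pr; elim=> {x y} [x y xy|x|x y _ IH|x y z _ IH _ IH']; last 3 first.
- by [].
- by split=> /IH.
- by split=> [/IH/IH'|/IH'/IH].
have push f : ymap (idm A) f r x -> ymap (idm A) f r y.
  by move=> m; have := ymap_comp m xy; rewrite comp1m.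
split=> -[f mf ef]; first by exists f => //; apply: push.
have [f0 mf0] := ymap_ex (idm A) x pr; exists f0 => //.
rewrite -(subrKA f) -[f - c]opprK; apply: extends_alongB.
  exact: (ymap_homotopy pr (push _ mf0) mf (lifts_along0 _ _)).
exact: extends_alongN.
Qed.

(** If extensions are all equivalent, the pushouts along [c] and along [0] have
    the same class.  Conversely, if all classes vanish, then every extension
    receives a map from the pushout along [0]. *)
Lemma yext_vanishP (n : nat) (A K B : E) (r : yext n A K) :
  projective_yext r ->
  ((forall x y : yext n A B, yext_equiv x y) <->
   (forall c : hom K B, extends_along c r)).
Proof.
move=> pr; split=> [eqv c|ext].
  have [y [my _]] := yext_pushout r c.
  have [z [mz _]] := yext_pushout r (0 : hom K B).
  have [|f mf ef] := proj1 (yext_equiv_class c pr (eqv y z)).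
    exists c => //; rewrite subrr.
    have [f0 mf0] := ymap_ex (idm A) y pr.
    rewrite -(subrr f0).
    exact: (ymap_homotopy pr mf0 mf0 (lifts_along0 _ _)).
  have e0 := ymap_homotopy pr mf mz (lifts_along0 _ _).
  by have := extends_alongB e0 ef; rewrite subr0 subKr.
have [z [_ zu]] := yext_pushout r (0 : hom K B).
have zx x : yext_equiv z x.
  apply: Relation_Operators.rst_step; apply: zu.
  have [f mf] := ymap_ex (idm A) x pr.
  exact: ymap_kill mf (ext f).
move=> x y; apply: Relation_Operators.rst_trans (zx y).
exact/Relation_Operators.rst_sym/zx.
Qed.

(** Vanishing of the [n.+1]-st cohomology of [Hom(P, B)] for all projective
    resolutions [P] of [A], unrolled one syzygy at a time. *)
Fixpoint ext_vanish (n : nat) (A B : E) : Prop :=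
  match n with
  | 0 => forall (K : E) (s : ses K A), projective (ses_mid s) ->
      forall c : hom K B, exists c', c' ∘ ses_inc s = c
  | n.+1 => forall (K : E) (s : ses K A), projective (ses_mid s) ->
      ext_vanish n K B
  end.

Lemma ext_vanishP (n : nat) (A B : E) :
  ext_vanish n A B <-> forall K (r : yext n A K), projective_yext r ->
    forall c : hom K B, extends_along c r.
Proof.
elim: n A => [|n IH] A //=; split=> [ext K [K0 [r s]] /= [pr ps]|ext K s ps].
  by have /IH := ext _ s ps; apply.
apply/IH => K' r pr c.
exact: (ext K' (Tagged (fun K => (yext n K K' * ses K A)%type) (r, s))).
Qed.

Hypothesis proj_enough : enough_projectives E.

Lemma ses_cover (A : E) : exists (K : E) (s : ses K A), projective (ses_mid s).
Proof.
by have [P [p [pP [K [i c]]]]] := proj_enough A; exists K, (Ses c).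
Qed.

Lemma projective_yext_ex (n : nat) (A : E) :
  exists (K : E) (r : yext n A K), projective_yext r.
Proof.
elim: n A => [|n IH] A; have [K [s ps]] := ses_cover A; first by exists K, s.
have [K' [r pr]] := IH K.
by exists K', (Tagged (fun K => (yext n K K' * ses K A)%type) (r, s)).
Qed.

Lemma exact_ext_vanishP (n : nat) (A B : E) :
  exact_ext_vanish n.+1 A B <-> ext_vanish n A B.
Proof.
rewrite ext_vanishP; split=> [eqv K r pr|ext].
  exact/(yext_vanishP B pr).
have [K [r pr]] := projective_yext_ex n A.
exact/(yext_vanishP B pr)/ext.
Qed.

End YonedaExt.

(** * Germs of chain maps *)

(** A sequence [... -> R 1 -> R 0]: the part of a complex in degrees [<= 0],
    with [R k] in degree [- k]. *)
Record sequence (C : category) := Sequence {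
  sob :> nat -> C;
  sdiff : forall k, hom (sob k.+1) (sob k) }.

(** Families are total and unconstrained; being a chain map is asked only
    eventually, by [germ]. *)
Definition family (C : category) (R S : sequence C) : Type :=
  forall k, hom (R k) (S k).

Definition fcomp (C : category) (R S T : sequence C) (g : family S T)
    (f : family R S) : family R T := fun k => g k ∘ f k.

Definition fid (C : category) (R : sequence C) : family R R :=
  fun k => idm (R k).

Section Germs.
Variable C : preadditive.

Definition germ (R S : sequence C) (f : family R S) : Prop :=
  eventually (fun k => sdiff S k ∘ f k.+1 = f k ∘ sdiff R k).

Definition germ_homotopic (R S : sequence C) (f g : family R S) : Prop :=
  exists h : forall k, hom (R k) (S k.+1), eventually (fun k =>
    f k.+1 - g k.+1 = sdiff S k.+1 ∘ h k.+1 + h k ∘ sdiff R k).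

Definition null_germs (R S : sequence C) : Prop :=
  forall f : family R S, germ f -> germ_homotopic f (fun _ => 0).

Lemma germ_comp (R S T : sequence C) (g : family S T) (f : family R S) :
  germ g -> germ f -> germ (fcomp g f).
Proof.
move=> gg gf; apply: eventually_mono (eventually_and gg gf) => k [eg ef].
by rewrite /fcomp compA eg -compA ef compA.
Qed.

Lemma germ_id (R : sequence C) : germ (fid R).
Proof. by apply: eventually_all => k; rewrite /fid compm1 comp1m. Qed.

Lemma germB (R S : sequence C) (f g : family R S) :
  germ f -> germ g -> germ (fun k => f k - g k).
Proof.
move=> gf gg; apply: eventually_mono (eventually_and gf gg) => k [ef eg].
by rewrite compmBr compmBl ef eg.
Qed.

Lemma germ_homotopic_eq (R S : sequence C) (f g : family R S) :
  eventually (fun k => f k = g k) -> germ_homotopic f g.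
Proof.
move=> fg; exists (fun _ => 0);
  apply: eventually_mono (proj1 (eventuallyS _) fg).
by move=> k ->; rewrite subrr compm0 comp0m addr0.
Qed.

Lemma germ_homotopic_refl (R S : sequence C) (f : family R S) :
  germ_homotopic f f.
Proof. exact/germ_homotopic_eq/eventually_all. Qed.

Lemma germ_homotopic_sym (R S : sequence C) (f g : family R S) :
  germ_homotopic f g -> germ_homotopic g f.
Proof.
case=> h fg; exists (fun k => - h k); apply: eventually_mono fg => k fg.
by rewrite -opprB fg compmN compNm opprD.
Qed.

Lemma germ_homotopic_trans (R S : sequence C) (f g k : family R S) :
  germ_homotopic f g -> germ_homotopic g k -> germ_homotopic f k.
Proof.
move=> [h fg] [h' gk]; exists (fun j => h j + h' j).
apply: eventually_mono (eventually_and fg gk) => j [ef eg].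
by rewrite -(subrKA (g j.+1)) ef eg compmDr compmDl addrACA.
Qed.

Lemma germ_homotopic_compl (R S T : sequence C) (g : family S T)
    (f f' : family R S) :
  germ g -> germ_homotopic f f' -> germ_homotopic (fcomp g f) (fcomp g f').
Proof.
move=> /eventuallyS gg [h ff']; exists (fun k => g k.+1 ∘ h k).
apply: eventually_mono (eventually_and gg ff') => k [eg ef].
by rewrite /fcomp -compmBr ef compmDr !compA eg.
Qed.

Lemma germ_homotopic_compr (R S T : sequence C) (g g' : family S T)
    (f : family R S) :
  germ f -> germ_homotopic g g' -> germ_homotopic (fcomp g f) (fcomp g' f).
Proof.
move=> gf [h gg']; exists (fun k => h k ∘ f k).
apply: eventually_mono (eventually_and gf gg') => k [ef eg].
by rewrite /fcomp -compmBl eg compmDl -!compA ef.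
Qed.

Lemma germ_homotopic_comp (R S T : sequence C) (g g' : family S T)
    (f f' : family R S) : germ g -> germ f' ->
  germ_homotopic g g' -> germ_homotopic f f' ->
  germ_homotopic (fcomp g f) (fcomp g' f').
Proof.
move=> gg gf' eg ef.
exact: germ_homotopic_trans (germ_homotopic_compl gg ef)
  (germ_homotopic_compr gf' eg).
Qed.

Lemma null_germs_eq (R S : sequence C) (f g : family R S) :
  null_germs R S -> germ f -> germ g -> germ_homotopic f g.
Proof.
move=> null gf gg; have [h e] := null _ (germB gf gg).
by exists h; apply: eventually_mono e => k; rewrite subr0.
Qed.

(** The inverse suspension, up to the sign of the differential. *)
Definition Om (R : sequence C) : sequence C :=
  Sequence (fun k => sdiff R k.+1).

Definition Omf (R S : sequence C) (f : family R S) : family (Om R) (Om S) :=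
  fun k => f k.+1.

Lemma germ_Om (R S : sequence C) (f : family R S) : germ f -> germ (Omf f).
Proof. by move/eventuallyS. Qed.

End Germs.

Section Cocone.
Variable E : exact_category.
Implicit Types R S T X Y : sequence E.

(** Up to sign this is the suspension; the zero object in degree [0] does not
    affect germs. *)
Definition prepend R : sequence E :=
  @Sequence E (fun k => if k is k'.+1 then R k' else zobj E)
    (fun k => if k is k'.+1 then sdiff R k' else 0).

Lemma Om_prepend R : Om (prepend R) = R.
Proof. by case: R. Qed.

(** The cocone of [f : Y -> X]; the sign makes [Om X -> V] a chain map. *)
Definition cocone Y X (f : family Y X) : sequence E :=
  @Sequence E (fun k => bobj (bsum (Y k) (X k.+1))) (fun k =>
    bpair _ (- sdiff Y k ∘ bp1 _) (bcopair _ (f k.+1) (sdiff X k.+1))).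

Definition cocone_in Y X (f : family Y X) : family (Om X) (cocone f) :=
  fun k => bi2 (bsum (Y k) (X k.+1)).

Lemma germ_cocone_in Y X (f : family Y X) : germ (cocone_in f).
Proof.
apply: eventually_all => k; rewrite /cocone_in /=.
rewrite bpair_comp -compA bp1i2 compm0 bcopair_i2.
by rewrite /bpair compm0 add0r.
Qed.

(** Exactness of [Hom(T, -)] on the triangle [V -> Y -> X -> S V]: the two
    components of a null homotopy of [Om T -> V = Y + Om X] are a germ [T -> Y]
    and a homotopy from its image in [X] to [g]. *)
Lemma cocone_lift T Y X (f : family Y X) (g : family T X) :
  germ_homotopic (fcomp (cocone_in f) (Omf g)) (fun _ => 0) ->
  exists2 g' : family T Y, germ g' & germ_homotopic g (fcomp f g').
Proof.
(* The index shift undoes [Om]; the value in degree [0] is arbitrary. *)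
move=> [s es]; pose g' : family T Y :=
  fun k => if k is k'.+1 then bp1 _ ∘ s k' else 0.
have es' : eventually (fun k =>
    [/\ sdiff Y k.+1 ∘ g' k.+2 = g' k.+1 ∘ sdiff T k.+1 &
     g k.+2 - f k.+2 ∘ g' k.+2 =
       sdiff X k.+2 ∘ (bp2 _ ∘ s k.+1) + (bp2 _ ∘ s k) ∘ sdiff T k.+1]).
  apply: eventually_mono es => k; rewrite subr0 /fcomp /cocone_in /Omf /= => e.
  split.
    have := congr1 (comp (bp1 _)) e.
    rewrite compmDr !compA bp1i2 comp0m bp1_pair => /esym/eqP.
    by rewrite !compNm addrC subr_eq0 => /eqP <-.
  have := congr1 (comp (bp2 _)) e.
  rewrite compmDr !compA bp2i2 comp1m bp2_pair => ->.
  by rewrite {1}/bcopair compmDl -!compA [LHS]addrC !addrA addNr add0r.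
exists g'; first by apply/eventuallyS; apply: eventually_mono es' => k [].
exists (fun k => if k is k'.+1 then bp2 _ ∘ s k' else 0).
by apply/eventuallyS; apply: eventually_mono es' => k [].
Qed.

(** Exactness of [Hom(-, T)] at the same spot: a null homotopy of the
    restriction of [h] to [Om Y] is the missing component of a germ on
    [V = Y + Om X]. *)
Lemma cocone_factor T Y X (f : family Y X) (h : family (Om X) T) : germ h ->
  germ_homotopic (fcomp h (Omf f)) (fun _ => 0) ->
  exists2 h' : family (cocone f) T, germ h' & fcomp h' (cocone_in f) = h.
Proof.
move=> gh [s es].
pose h' : family (cocone f) T := fun k =>
  bcopair (bsum (Y k) (X k.+1))
    (if k is k'.+1 return hom (Y k) (T k) then s k' else 0) (h k).
exists h'; last first.
  by apply: functional_extensionality_dep => k; apply: bcopair_i2.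
apply/eventuallyS.
apply: eventually_mono (eventually_and (proj1 (eventuallyS _) gh) es) => k /=.
rewrite subr0 /fcomp /Omf /= => -[eh e].
rewrite [RHS]bcopair_pair; apply: bcopair_eq.
  rewrite -compA bcopair_i1 compmDl -!compA bp1i1 compm1 bcopair_i1 e.
  by rewrite compmN addrCA addNr addr0.
rewrite -compA bcopair_i2 compmDl -!compA bp1i2 bcopair_i2 !compm0 add0r.
exact: eh.
Qed.

(** Iterations peel off the innermost [Om] first, which makes
    [Omi m (Om R)] and [Omi m.+1 R] convertible. *)
Fixpoint Omi (m : nat) R : sequence E :=
  if m is m'.+1 then Omi m' (Om R) else R.

Fixpoint Omif (m : nat) R S (f : family R S) : family (Omi m R) (Omi m S) :=
  if m is m'.+1 return family (Omi m R) (Omi m S) then Omif m' (Omf f) else f.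

Lemma germ_Omif (m : nat) R S (f : family R S) : germ f -> germ (Omif m f).
Proof. by elim: m R S f => [|m IH] R S f //= /germ_Om /IH. Qed.

Lemma cocone_factor_Omi (m : nat) T Y X (f : family Y X)
    (h : family (Omi m.+1 X) T) : germ h ->
  germ_homotopic (fcomp h (Omif m.+1 f)) (fun _ => 0) ->
  exists2 h' : family (Omi m (cocone f)) T,
    germ h' & fcomp h' (Omif m (cocone_in f)) = h.
Proof.
elim: m Y X f h => [|m IH] Y X f h; first exact: cocone_factor.
exact: (IH _ _ (Omf f)).
Qed.

Fixpoint prependi (m : nat) R : sequence E :=
  if m is m'.+1 then prepend (prependi m' R) else R.

Lemma Omi_prependi (m : nat) R : Omi m (prependi m R) = R.
Proof. by elim: m => //= m IH; rewrite Om_prepend. Qed.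

End Cocone.

(** * Resolutions by approximations *)

Section Approximation.
Variables (E : exact_category) (N : sequence E -> Prop).
Implicit Types R S T X Y V : sequence E.

(** Up to suspension signs: [X] lies in [N * S N * ... * S^m N], where [A * B]
    consists of the extensions of objects of [B] by objects of [A]. *)
Fixpoint resolved (m : nat) X : Prop :=
  if m is m'.+1 then
    exists Y (f : family Y X), [/\ N Y, germ f & resolved m' (cocone f)]
  else N X.

(** Dimension shifting along the resolution: morphisms from [T] into the last
    layer of [X] are morphisms from [Omi m T] into [N]. *)
Lemma resolved_null (m : nat) T X : resolved m X ->
  (forall i Y, (i <= m)%N -> N Y -> null_germs (Omi i T) Y) -> null_germs T X.
Proof.
elim: m T X => [|m IH] T X /=; first by move=> NX /(_ 0%N X (leqnn _)); apply.
move=> [Y [f [NY gf res]]] null g gg.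
have [|g' gg' e] := cocone_lift (f := f) (g := g).
  apply: (IH (Om T) _ res).
    by move=> i Y' im; apply: (null i.+1).
  by apply: germ_comp; [apply: germ_cocone_in|apply: germ_Om].
apply: germ_homotopic_trans e _.
have := germ_homotopic_compl gf (null 0%N Y (leq0n _) NY g' gg').
by congr germ_homotopic; apply: functional_extensionality_dep => k;
  apply: compm0.
Qed.

(** A germ into [X] lifts to the first layer [Y] since its obstruction, a germ
    from [Om T] into the remaining layers, is null by [resolved_null]. *)
Lemma resolved_right_approx (m : nat) X : resolved m X ->
  exists Y (f : family Y X), [/\ N Y, germ f &
    forall T, (forall i Y', (0 < i <= m)%N -> N Y' ->
      null_germs (Omi i T) Y') ->
    forall g : family T X, germ g ->
    exists2 g' : family T Y, germ g' & germ_homotopic g (fcomp f g')].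
Proof.
case: m => [NX|m /= [Y [f [NY gf res]]]].
  exists X, (fid X); split=> //; first exact: germ_id.
  move=> T _ g gg; exists g => //; apply: germ_homotopic_eq.
  by apply: eventually_all => k; rewrite /fcomp /fid comp1m.
exists Y, f; split=> // T null g gg; apply: cocone_lift.
apply: (resolved_null res (T := Om T)).
  by move=> i Y' im; apply: (null i.+1).
by apply: germ_comp; [apply: germ_cocone_in|apply: germ_Om].
Qed.

(** The map [f] is the composite of the connecting maps of the resolution.  A
    germ on [Omi m X] factors through each of them in turn, because its
    restriction to the layers [Omi i Y'] is null. *)
Lemma resolved_left_approx (m : nat) X : resolved m X ->
  exists V (f : family (Omi m X) V), [/\ N V, germ f &
    forall T, (forall i Y', (0 < i <= m)%N -> N Y' ->
      null_germs (Omi i Y') T) ->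
    forall g : family (Omi m X) T, germ g ->
    exists2 g' : family V T, germ g' & germ_homotopic g (fcomp g' f)].
Proof.
elim: m X => [X NX|m IH X /= [Y [f [NY gf res]]]].
  exists X, (fid X); split=> //; first exact: germ_id.
  move=> T _ g gg; exists g => //; apply: germ_homotopic_eq.
  by apply: eventually_all => k; rewrite /fcomp /fid compm1.
have [V [u [NV gu univ]]] := IH _ res.
have gc := germ_Omif m (germ_cocone_in f).
exists V, (fcomp u (Omif m (cocone_in f))); split=> //; first exact: germ_comp.
move=> T null g gg.
have [|h' gh' h'E] := cocone_factor_Omi (m := m) (f := f) gg.
  apply: (null m.+1 Y) => //; first by rewrite leqnn.
  by apply: germ_comp => //; apply: (germ_Omif m.+1).
have [|g' gg' e] := univ T _ h' gh'.
  by move=> i Y' /andP[i0 im]; apply: null; rewrite i0 leqW.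
exists g' => //; rewrite -h'E.
have := germ_homotopic_compr gc e; congr germ_homotopic.
by apply: functional_extensionality_dep => k; rewrite /fcomp compA.
Qed.

End Approximation.

(** * Eventually exact sequences of projectives *)

Section Exactness.
Variable E : exact_category.
Implicit Types R S X Y V : sequence E.

(** Candidate cycles: [scyc k] is meant to be the kernel [Z k] of
    [R k -> R k.-1] and [sdiff R k] to factor as [R k.+1 -> Z k -> R k]. *)
Record cycles (R : sequence E) := Cycles {
  scyc : nat -> E;
  cinc : forall k, hom (scyc k) (R k);
  cprj : forall k, hom (R k.+1) (scyc k) }.

Definition exact_from (n : nat) R (c : cycles R) : Prop :=
  forall k, (n <= k)%N -> [/\ projective (R k.+1),
    conflation (cinc c k.+1) (cprj c k) &
    sdiff R k = cinc c k ∘ cprj c k].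

Lemma exact_from_leq (m n : nat) R (c : cycles R) :
  (m <= n)%N -> exact_from m c -> exact_from n c.
Proof. by move=> mn ec k /(leq_trans mn) /ec. Qed.

Section ExactFrom.
Variables (n : nat) (R : sequence E) (c : cycles R).
Hypothesis ec : exact_from n c.

Lemma exact_from_projective k : (n < k)%N -> projective (R k).
Proof. by case: k => // k /ec []. Qed.

Lemma exact_from_ker k : (n <= k)%N -> is_kernel (cinc c k.+1) (cprj c k).
Proof. by move=> /ec [_ /conf_ker]. Qed.

Lemma exact_from_epi k : (n <= k)%N -> adm_epi (cprj c k).
Proof. by move=> /ec [_ /conf_epi]. Qed.

Lemma exact_from_diff k : (n <= k)%N -> sdiff R k = cinc c k ∘ cprj c k.
Proof. by move=> /ec []. Qed.

Lemma exact_from_mono k : (n < k)%N -> forall T (u v : hom T (scyc c k)),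
  cinc c k ∘ u = cinc c k ∘ v -> u = v.
Proof.
by case: k => // k /exact_from_ker ker T u v; apply: kernel_mono ker _ _ _.
Qed.

Lemma exact_from_prj_inc k : (n <= k)%N -> cprj c k ∘ cinc c k.+1 = 0.
Proof. by move=> /exact_from_ker []. Qed.

Lemma exact_from_sq k : (n <= k)%N -> sdiff R k ∘ sdiff R k.+1 = 0.
Proof.
move=> nk; rewrite !exact_from_diff //; last exact: leqW.
by rewrite compA -(compA (cinc c k)) exact_from_prj_inc // compm0 comp0m.
Qed.

Lemma exact_from_ker_diff k : (n < k)%N ->
  is_kernel (cinc c k.+1) (sdiff R k).
Proof.
move=> nk; have ker := exact_from_ker (ltnW nk).
apply: kernel_intro => [|T u v|T f].
- rewrite exact_from_diff; last exact: ltnW.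
  by rewrite -compA exact_from_prj_inc ?compm0 // ltnW.
- exact: kernel_mono ker _ _ _.
- rewrite exact_from_diff; last exact: ltnW.
  rewrite -compA -(compm0 _ (cinc c k)) => /(exact_from_mono nk).
  exact: kernel_lift ker _ _.
Qed.

Definition exact_from_ses k (nk : (n <= k)%N) :
  ses (scyc c k.+1) (scyc c k) :=
  Ses (let: And3 _ h _ := ec nk in h).

(** Dimension shifting along the syzygies of [R]. *)
Lemma ext_vanish_shift (t q m : nat) (B : E) : (n <= m)%N ->
  ext_vanish (q + t) (scyc c m) B -> ext_vanish t (scyc c (q + m)) B.
Proof.
elim: q m => [//|q IH] m nm ext; rewrite addSnnS; apply: IH; first exact: leqW.
by apply: (ext _ (exact_from_ses nm)); case: (ec nm).
Qed.

End ExactFrom.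

(** If a germ factors through a projective on one syzygy, then this
    factorization is the start of a null homotopy, and the exactness of [S]
    continues it into all higher degrees. *)
Lemma null_of_factor (n k : nat) R S (c : cycles R) (c' : cycles S)
    (f : family R S) (u : hom (R k) (scyc c' k)) :
  exact_from n c -> exact_from n c' ->
  (forall j, (n <= j)%N -> sdiff S j ∘ f j.+1 = f j ∘ sdiff R j) ->
  (n < k)%N -> cinc c' k ∘ u ∘ cinc c k = f k ∘ cinc c k ->
  germ_homotopic f (fun _ => 0).
Proof.
move=> ec ec' fE nk uE.
have nk' := ltnW nk.
have [h0 h0E] := exact_from_projective ec nk u (exact_from_epi ec' nk').
(* The next component of the homotopy exists because [f - h d] has values in
   cycles; this is the invariant of the recursion. *)
have [||h [_ hP]] := @dep_choice (fun j => hom (R j) (S j.+1)) (fun _ => 0) k h0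
  (fun j h => sdiff S j ∘ (f j.+1 - h ∘ sdiff R j) = 0)
  (fun j h h' => f j.+1 = sdiff S j.+1 ∘ h' + h ∘ sdiff R j).
- rewrite compmBr fE // !compA (exact_from_diff ec nk') !compA -uE.
  rewrite (exact_from_diff ec' nk') -(compA (cinc c' k) (cprj c' k)) h0E.
  by rewrite subrr.
- move=> j h kj hE; have nj : (n < j)%N := leq_trans nk kj.
  have nj' := ltnW nj.
  have [|v vE] := kernel_lift (exact_from_ker ec' nj')
    (f := f j.+1 - h ∘ sdiff R j).
    apply: (exact_from_mono ec' nj).
    by rewrite compm0 compA -(exact_from_diff ec' nj').
  have [h' h'E] := exact_from_projective ec (nj' : (n < j.+1)%N) v
    (exact_from_epi ec' (leqW nj')).
  have QE : f j.+1 = sdiff S j.+1 ∘ h' + h ∘ sdiff R j.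
    by rewrite (exact_from_diff ec' (leqW nj')) -compA h'E vE subrK.
  exists h' => //; rewrite compmBr fE; last exact: leqW.
  rewrite compA -[sdiff S j.+1 ∘ h'](addrK (h ∘ sdiff R j)) -QE.
  rewrite compmBl -!compA (exact_from_sq ec nj') compm0 subr0 subrr.
  by [].
exists h, k => j /hP [_ ->].
by rewrite subr0.
Qed.

(** Comparison theorem.  The induced maps [z] on all the later cycles are kept,
    since they determine the cycles of the cocone of [f]. *)
Lemma comparison (n : nat) R S (c : cycles R) (c' : cycles S)
    (z0 : hom (scyc c n) (scyc c' n)) : exact_from n c -> exact_from n c' ->
  exists (f : family R S) (z : forall k, hom (scyc c k) (scyc c' k)),
    z n = z0 /\ forall k, (n <= k)%N ->
      cprj c' k ∘ f k.+1 = z k ∘ cprj c k /\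
      cinc c' k.+1 ∘ z k.+1 = f k.+1 ∘ cinc c k.+1.
Proof.
move=> ec ec'.
have [||x [x0 xP]] := @dep_choice
  (fun k => (hom (R k) (S k) * hom (scyc c k) (scyc c' k))%type)
  (fun _ => (0, 0)) n (0, z0) (fun _ _ => True)
  (fun k x y => cprj c' k ∘ y.1 = x.2 ∘ cprj c k /\
      cinc c' k.+1 ∘ y.2 = y.1 ∘ cinc c k.+1) => //.
  move=> j [f z] nj _ /=.
  have nj' : (n < j.+1)%N by [].
  have [f' f'E] := exact_from_projective ec nj' (z ∘ cprj c j)
    (exact_from_epi ec' nj).
  have [|z' z'E] := kernel_lift (exact_from_ker ec' nj) (f := f' ∘ cinc c j.+1).
    by rewrite compA f'E -compA (exact_from_prj_inc ec nj) compm0.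
  by exists (f', z').
exists (fun k => (x k).1), (fun k => (x k).2); split; first by rewrite x0.
by move=> k /xP [].
Qed.

Lemma comparison_germ (n : nat) R S (c : cycles R) (c' : cycles S)
    (f : family R S) (z : forall k, hom (scyc c k) (scyc c' k)) :
  exact_from n c -> exact_from n c' ->
  (forall k, (n <= k)%N -> cprj c' k ∘ f k.+1 = z k ∘ cprj c k /\
      cinc c' k.+1 ∘ z k.+1 = f k.+1 ∘ cinc c k.+1) ->
  germ f.
Proof.
move=> ec ec' fz; exists n.+1 => -[//|k] nk.
have [_ iz] := fz k nk; have [pf _] := fz k.+1 (leqW nk).
rewrite (exact_from_diff ec (leqW nk)) (exact_from_diff ec' (leqW nk)).
by rewrite -compA pf !compA iz.
Qed.

Lemma germ_cycles R S (c : cycles R) (c' : cycles S) (f : family R S)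
  (n k : nat) :
  exact_from n c -> exact_from n c' ->
  (forall j, (n <= j)%N -> sdiff S j ∘ f j.+1 = f j ∘ sdiff R j) ->
  (n.+1 < k)%N -> exists z : hom (scyc c k) (scyc c' k),
    cinc c' k ∘ z = f k ∘ cinc c k.
Proof.
case: k => // k ec ec' fE nk; apply: (kernel_lift (exact_from_ker_diff ec' nk)).
rewrite compA fE; last exact: ltnW.
rewrite -compA; have [-> _] := exact_from_ker_diff ec nk.
by rewrite compm0.
Qed.

(** The cycles of the cocone are the pullback [Z_k V] of [Z_k Y] and [X k.+1]
    over [Z_k X], up to a sign.  The next term [Y k.+1 + X k.+2] of the cocone
    covers [Z_k V], because this pullback is an extension of [Z_k Y] by
    [Z_(k+1) X] and the two summands cover these objects. *)
Lemma exact_cocone (n : nat) Y X (cY : cycles Y) (cX : cycles X)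
    (f : family Y X) (z : forall k, hom (scyc cY k) (scyc cX k)) :
  exact_from n cY -> exact_from n cX ->
  (forall k, (n <= k)%N -> cprj cX k ∘ f k.+1 = z k ∘ cprj cY k /\
      cinc cX k.+1 ∘ z k.+1 = f k.+1 ∘ cinc cY k.+1) ->
  exists cV : cycles (cocone f), exact_from n cV /\
    forall k, (n <= k)%N -> exists (a : hom (scyc cV k) (scyc cY k))
      (b : hom (scyc cV k) (X k.+1)), is_pullback a b (- z k) (cprj cX k).
Proof.
move=> eY eX fz.
pose T k := {D : E & (hom D (scyc cY k) * hom D (X k.+1))%type}.
have ex k : exists t : T k, (n <= k)%N ->
    is_pullback (tagged t).1 (tagged t).2 (- z k) (cprj cX k).
  have [nk|nk] := boolP (n <= k)%N; last first.
    by exists (Tagged (fun D => (hom D (scyc cY k) * hom D (X k.+1))%type)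
      (0 : hom (zobj E) _, 0 : hom (zobj E) _)).
  have [D [a [b [pb _]]]] := epi_pullback (conflation_exact E) (- z k)
    (exact_from_epi eX nk).
  by exists (Tagged (fun D => (hom D (scyc cY k) * hom D (X k.+1))%type)
    (a, b)).
pose Z k := tag (sval (cid (ex k))).
pose a k : hom (Z k) (scyc cY k) := (tagged (sval (cid (ex k)))).1.
pose b k : hom (Z k) (X k.+1) := (tagged (sval (cid (ex k)))).2.
have pb k : (n <= k)%N -> is_pullback (a k) (b k) (- z k) (cprj cX k).
  exact: svalP (cid (ex k)).
have exp k : exists p : hom (cocone f k.+1) (Z k), (n <= k)%N ->
    a k ∘ p = - (cprj cY k ∘ bp1 _) /\
    b k ∘ p = bcopair _ (f k.+1) (sdiff X k.+1).
  have [nk|nk] := boolP (n <= k)%N; last by exists 0.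
  have [|p [pb1 pa]] := pullback_lift (pb k nk)
    (u := bcopair (bsum (Y k.+1) (X k.+2)) (f k.+1) (sdiff X k.+1))
    (v := - (cprj cY k ∘ bp1 _)).
    rewrite compmDr !compA (proj1 (fz k nk)) compNm compmN opprK compA.
    rewrite (exact_from_diff eX (leqW nk)) compA (exact_from_prj_inc eX nk).
    by rewrite !comp0m addr0.
  by exists p.
pose p k := sval (cid (exp k)).
have pE k : (n <= k)%N -> a k ∘ p k = - (cprj cY k ∘ bp1 _) /\
    b k ∘ p k = bcopair _ (f k.+1) (sdiff X k.+1).
  exact: svalP (cid (exp k)).
pose i k : hom (Z k) (cocone f k) :=
  bpair (bsum (Y k) (X k.+1)) (cinc cY k ∘ a k) (b k).
exists (Cycles i p); split; last first.
  by move=> k nk; exists (a k), (b k); apply: pb.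
move=> k nk; have nk1 : (n <= k.+1)%N := leqW nk.
have kY := exact_from_ker eY nk; have kX := exact_from_ker eX nk.
have [ap bp] := pE k nk; have [fzp fzi] := fz k nk.
have dX := exact_from_diff eX nk1.
have [pbE _] := pb k nk; have [pbE1 _] := pb k.+1 nk1.
split=> /=.
- apply: projective_bsum; first exact:
  (exact_from_projective eY (nk : (n < k.+1)%N)).
  exact: (exact_from_projective eX (nk1 : (n < k.+2)%N)).
- apply: deflation_conflation.
    pose D := bsum (Y k.+1) (X k.+2); pose D' := bsum (Y k.+1) (scyc cX k.+1).
    (* [V k.+1 -> Z_k V] factors through [Y k.+1 + Z_(k+1) X], from which
       [bcopair m κ] is a deflation onto the pullback. *)
    have [|m [bm am]] := pullback_lift (pb k nk) (u := f k.+1)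
      (v := - cprj cY k).
      by rewrite fzp compNm compmN opprK.
    have [|κ [bκ aκ]] := pullback_lift (pb k nk) (u := cinc cX k.+1)
      (v := 0 : hom _ (scyc cY k)).
      by rewrite compm0 (exact_from_prj_inc eX nk).
    have cκ : conflation κ (a k).
      apply: deflation_conflation.
        exact: pullback_deflation (pb k nk) (exact_from_epi eX nk).
      apply: kernel_intro => // [T' u v uv|T' v av].
        apply: (kernel_mono kX).
        by rewrite -bκ -!compA uv.
      have [|w wE] := kernel_lift kX (f := b k ∘ v).
        by rewrite compA pbE -compA av compm0.
      exists w; apply: (pullback_eq (pb k nk)); first by rewrite compA bκ.
      by rewrite compA aκ comp0m av.
    have := adm_epi_comp
      (bcopair_deflation D' cκ (adm_epiN (exact_from_epi eY nk)) am)
      (bsum_deflation D D' (exact_from_epi eX nk1)).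
    congr adm_epi; rewrite bcopair_pair.
    apply: (pullback_eq (pb k nk)).
      by rewrite bp compmDr !compA bm bκ -dX.
    by rewrite ap compmDr !compA am aκ !comp0m addr0 compNm.
  apply: kernel_intro => [|T' u v|T' t pt0].
  + apply: (pullback_eq (pb k nk)).
      rewrite compA bp bcopair_pair compm0 dX compA -fzi -!compA pbE1.
      by rewrite compNm compmN subrr.
    rewrite compA ap compNm -compA bp1_pair compA (exact_from_prj_inc eY nk).
    by rewrite comp0m oppr0 compm0.
  + rewrite !bpair_comp => e; apply: (pullback_eq (pb k.+1 nk1)).
      by have := congr1 (comp (bp2 _)) e; rewrite !bp2_pair.
    apply: (kernel_mono kY).
    by have := congr1 (comp (bp1 _)) e; rewrite !bp1_pair !compA.
  + have [|y yE] := kernel_lift kY (f := bp1 _ ∘ t).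
      have := congr1 (comp (a k)) pt0; rewrite compA ap compm0 compNm -compA.
      by move/eqP; rewrite oppr_eq0 => /eqP.
    have [|w [bw aw]] := pullback_lift (pb k.+1 nk1) (u := bp2 _ ∘ t) (v := y).
      apply: (exact_from_mono eX (nk : (n < k.+1)%N)).
      have := congr1 (comp (b k)) pt0.
      rewrite compA bp compm0 compmDl -!compA -yE compA -fzi dX -!compA.
      by move/eqP; rewrite addrC addr_eq0 compNm compmN => /eqP.
    exists w; rewrite bpair_comp -compA aw yE bw.
    exact/esym/bpairE.
- rewrite /i bpair_comp -compA ap bp (exact_from_diff eY nk).
  by rewrite compmN compNm compA.
Qed.

End Exactness.

(** * Cluster tilting in the exact category *)

Section ExtLemmas.
Variable E : exact_category.

Lemma ext_vanish_projective (n : nat) (P B : E) :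
  projective P -> ext_vanish n P B.
Proof.
elim: n P => [|n IH] P pP K s ps; have [g gE] := ses_prj_lift s (idm P) pP.
all: have [|r rE] := ses_inc_lift (f := idm _ - g ∘ ses_prj s);
  first by rewrite compmBr compA gE compm1 comp1m subrr.
all: have rK : r ∘ ses_inc s = idm K;
  first by apply: (@ses_inc_mono _ _ _ s);
    rewrite compA rE compmBl comp1m compm1 -compA ses_prj_inc compm0 subr0.
- by move=> c; exists (c ∘ r); rewrite -compA rK compm1.
- exact/IH/(projective_retract rK).
Qed.

Lemma ext_vanish_retract (n : nat) (T X A B : E) (u : hom X A) (v : hom A X)
    (s : hom X B) (t : hom B X) : v ∘ u + t ∘ s = idm X ->
  ext_vanish n T A -> ext_vanish n T B -> ext_vanish n T X.
Proof.
move=> e; elim: n T => [|n IH] T extA extB K w pw; last first.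
  by apply: IH; [apply: extA pw|apply: extB pw].
move=> c; have [a aE] := extA K w pw (u ∘ c).
have [b bE] := extB K w pw (s ∘ c).
exists (v ∘ a + t ∘ b).
by rewrite compmDl -!compA aE bE !compA -compmDl e comp1m.
Qed.

(** Part of the long exact sequence of a pullback square: the connecting map
    embeds the extensions by [K] into those by [A], in one degree less, when
    those by [L] and [P] vanish; in degree zero the maps to [A] that lift to
    [L] and [P] are lost. *)
Lemma ext_vanish_pullback (n : nat) (T K L A P : E) (a : hom K L) (b : hom K P)
    (f : hom L A) (p : hom P A) : is_pullback a b f p -> adm_epi p ->
  ext_vanish n T L -> ext_vanish n T P ->
  (if n is m.+1 then ext_vanish m T A
   else forall g : hom T A, exists u v, g = f ∘ u + p ∘ v) ->
  ext_vanish n T K.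
Proof.
move=> pb ep; elim: n T => [|n IH] T extL extP extA K' s ps; last first.
  apply: IH; [exact: extL ps|exact: extP ps|].
  case: n extA {extL extP} => [|n] extA; last exact: extA ps.
  move=> g; have [g' <-] := extA K' s ps g.
  have [v <-] := ps _ _ p g' ep.
  by exists 0, (v ∘ ses_inc s); rewrite compm0 add0r compA.
move=> c; have [α αE] := extL K' s ps (a ∘ c).
have [β βE] := extP K' s ps (b ∘ c).
have [pbE _] := pb.
have [|g gE] := cokernel_desc (conf_coker (ses_conf s)) (f := f ∘ α - p ∘ β).
  by rewrite compmBl -!compA αE βE !compA pbE subrr.
have [u [v uv]] := extA g.
have [|w [bw aw]] := pullback_lift pb (u := β + v ∘ ses_prj s)
  (v := α - u ∘ ses_prj s).
  rewrite compmDr compmBr !compA; apply/eqP.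
  rewrite eq_sym subr_eq -addrA addrC -subr_eq -gE uv compmDl addrC.
  by [].
exists w; apply: (pullback_eq pb).
  by rewrite compA bw compmDl -compA ses_prj_inc compm0 addr0.
by rewrite compA aw compmBl -compA ses_prj_inc compm0 subr0.
Qed.

End ExtLemmas.

Section ClusterTilting.
Variables (d : nat) (E : exact_category) (M : E -> Prop).
Hypotheses (d_gt0 : (0 < d)%N) (enough : enough_projectives E)
  (ct : exact_dZ_cluster_tilting d M).
Implicit Types R S X Y V : sequence E.

Lemma tilting_ext_vanish (n : nat) (A B : E) : ~~ (d %| n.+1)%N ->
  M A -> M B -> ext_vanish n A B.
Proof.
by move=> dn MA MB; apply/(exact_ext_vanishP enough); apply: (proj2 ct).
Qed.

Lemma tilting_left_orth (A : E) :
  (forall n B, (n.+1 < d)%N -> M B -> ext_vanish n A B) -> M A.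
Proof.
have [[_ [orth _] _] _] := ct => ext; apply/orth => -[//|n] B nd MB.
by apply/(exact_ext_vanishP enough); apply: ext => //; lia.
Qed.

Lemma tilting_right_orth (A : E) :
  (forall n B, (n.+1 < d)%N -> M B -> ext_vanish n B A) -> M A.
Proof.
have [[_ [_ orth] _] _] := ct => ext; apply/orth => -[//|n] B nd MB.
by apply/(exact_ext_vanishP enough); apply: ext => //; lia.
Qed.

Lemma tilting_projective (P : E) : projective P -> M P.
Proof.
by move=> pP; apply: tilting_left_orth => n B _ _; apply: ext_vanish_projective.
Qed.

Lemma tilting_retract (X A B : E) (u : hom X A) (v : hom A X)
    (s : hom X B) (t : hom B X) :
  v ∘ u + t ∘ s = idm X -> M A -> M B -> M X.
Proof.
move=> e MA MB; apply: tilting_right_orth => n T nd MT.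
have dn : ~~ (d %| n.+1)%N by rewrite gtnNdvd.
by apply: (ext_vanish_retract e); apply: tilting_ext_vanish.
Qed.

Lemma tilting_iso (X A : E) (u : hom X A) : is_iso u -> M A -> M X.
Proof.
move=> [v vu _] MA; apply: (tilting_retract (u := u) (v := v) (s := 0 : hom X A)
  (t := 0)) => //.
by rewrite comp0m addr0.
Qed.

(** Dimension shifting turns the orthogonality of a [d]-th syzygy into the
    vanishing of [Ext^(d+i)(M, M)] for [0 < i < d]. *)
Lemma tilting_syzygy (n m q : nat) R (c : cycles R) : exact_from n c ->
  (n <= m)%N -> M (scyc c m) -> M (scyc c (q * d + m)).
Proof.
move=> ec nm Mm; elim: q => [//|q IH]; rewrite mulSn -addnA.
apply: tilting_left_orth => i B id MB.
apply: (ext_vanish_shift ec (q := d));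
  first by apply: leq_trans nm (leq_addl _ _).
apply: tilting_ext_vanish => //.
by rewrite -addnS dvdn_addr // gtnNdvd.
Qed.

(** For [r = 0] these are the objects of the subcategory of the theorem, and
    [tilted r] consists of their [r]-fold inverse suspensions. *)
Definition tilted (r : int) R : Prop :=
  exists n (c : cycles R), exact_from n c /\
    forall k : nat, (n <= k)%N -> (d %| k%:Z + r)%Z -> M (scyc c k).

Definition eventually_exact_seq R : Prop :=
  exists n (c : cycles R), exact_from n c.

Lemma tilted_exact r R : tilted r R -> eventually_exact_seq R.
Proof. by move=> [n [c [ec _]]]; exists n, c. Qed.

Lemma tilted_Om r R : tilted r R -> tilted (r + 1) (Om R).
Proof.
move=> [n [c [ec Mc]]].
exists n, (@Cycles E (Om R) _ (fun k => cinc c k.+1) (fun k => cprj c k.+1)).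
split=> [k nk|k nk /= dk]; first by apply: ec; apply: leqW.
by apply: Mc; [apply: leqW|move: dk; rewrite -addn1 PoszD (addrC r) addrA].
Qed.

Lemma tilted_Omi i r R : tilted r R -> tilted (r + i%:Z) (Omi i R).
Proof.
elim: i r R => [|i IH] r R tR; first by rewrite addr0.
by rewrite -addn1 addnC PoszD addrA; apply/IH/tilted_Om.
Qed.

Lemma exact_prepend R : eventually_exact_seq R ->
  eventually_exact_seq (prepend R).
Proof.
move=> [n [c ec]].
exists n.+1, (@Cycles E (prepend R)
  (fun k => if k is k'.+1 then scyc c k' else zobj E)
  (fun k => if k is k'.+1 then cinc c k' else 0)
  (fun k => if k is k'.+1 then cprj c k' else 0)).
by case=> // k nk; apply: ec.
Qed.

(** In a degree where the cycles of [S] lie in [M], the obstruction in [Ext^1]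
    to the nullity of a germ is shifted onto an [Ext^j(M, M)] with
    [0 < j < d]. *)
Lemma tilted_null (r s : int) R S : ~~ (d %| r - s)%Z ->
  tilted r R -> tilted s S -> null_germs R S.
Proof.
move=> drs [n [c [ec Mc]]] [n' [c' [ec' Mc']]] f [n0 fE].
pose N := (n + n' + n0)%N.
have eN : exact_from N c by apply: exact_from_leq ec; rewrite /N; lia.
have eN' : exact_from N c' by apply: exact_from_leq ec'; rewrite /N; lia.
have fN j : (N <= j)%N -> sdiff S j ∘ f j.+1 = f j ∘ sdiff R j.
  by move=> Nj; apply: fE; move: Nj; rewrite /N; lia.
(* [k] is a high degree in which the cycles of [S] lie in [M], and [k - j] the
   closest lower index for which those of [R] do. *)
have [j [j0 jd dj]] : exists j : nat,
  [/\ (0 < j)%N, (j < d)%N & (d %| r - s - j%:Z)%Z].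
  exists `|((r - s) %% d)%Z|%N; split.
  - by rewrite absz_gt0; apply: contra drs => /eqP /dvdz_mod0P.
  - have := ltz_pmod (r - s) (d := d); have := modz_ge0 (r - s) (d := d); lia.
  - rewrite gez0_abs; last by apply: modz_ge0; lia.
    by rewrite {1}(divz_eq (r - s) d) addrK dvdz_mull.
have [k [Nk dk]] : exists k : nat, (N + d + 2 <= k)%N /\ (d %| k%:Z + s)%Z.
  pose m := `|((- s) %% d)%Z|%N; exists (m + d * (N + d + 2))%N; split.
    by rewrite (leq_trans _ (leq_addl _ _)) // leq_pmull.
  have mE : m%:Z = ((- s) %% d)%Z by rewrite gez0_abs //; apply: modz_ge0; lia.
  have := divz_eq (- s) d; rewrite -mE; set q := (_ %/ _)%Z => sE.
  have -> : (m + d * (N + d + 2))%N%:Z + s =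
    ((N + d + 2)%N%:Z - q) * d%:Z by lia.
  exact: dvdz_mull.
have [z zE] := germ_cycles eN eN' fN (k := k) ltac:(lia).
have ext : ext_vanish 0 (scyc c k.-1) (scyc c' k).
  have -> : k.-1 = (j.-1 + (k - j))%N by lia.
  apply: (ext_vanish_shift eN); first by lia.
  apply: tilting_ext_vanish.
  - by rewrite addn0 prednK // gtnNdvd.
  - apply: Mc; first by move: Nk; rewrite /N; lia.
    have -> : (k - j)%N%:Z + r = (k%:Z + s) + (r - s - j%:Z) by lia.
    by rewrite rpredD.
  - by apply: Mc' => //; move: Nk; rewrite /N; lia.
case: k Nk dk z zE ext => [|k] Nk dk z zE ext; first by lia.
have Nk' : (N <= k)%N by lia.
have [|u uE] := ext _ (exact_from_ses eN Nk') _ z.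
  exact: (exact_from_projective eN (Nk' : (N < k.+1)%N)).
apply: (null_of_factor eN eN' fN (k := k.+1) (u := u)); first by lia.
by rewrite -compA uE zE.
Qed.

(** A retraction up to homotopy makes each high syzygy of [R] a retract of a
    syzygy of [S] plus the projective through which the homotopy factors. *)
Lemma tilted_retract (r : int) R S (u : family R S) (v : family S R) :
  eventually_exact_seq R -> tilted r S -> germ u -> germ v ->
  germ_homotopic (fcomp v u) (fid R) -> tilted r R.
Proof.
move=> [n [c ec]] [n' [c' [ec' Mc']]] [n0 uE] [n1 vE] [h [n2 hE]].
pose N := (n + n' + n0 + n1 + n2)%N.
have eN : exact_from N c by apply: exact_from_leq ec; rewrite /N; lia.
have eN' : exact_from N c' by apply: exact_from_leq ec'; rewrite /N; lia.
have uN j : (N <= j)%N -> sdiff S j ∘ u j.+1 = u j ∘ sdiff R j.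
  by move=> Nj; apply: uE; move: Nj; rewrite /N; lia.
have vN j : (N <= j)%N -> sdiff R j ∘ v j.+1 = v j ∘ sdiff S j.
  by move=> Nj; apply: vE; move: Nj; rewrite /N; lia.
exists N.+2, c; split; first by apply: exact_from_leq eN; lia.
case=> // k Nk dk.
have [z zE] := germ_cycles eN eN' uN Nk.
have [w wE] := germ_cycles eN' eN vN Nk.
have Nk' : (N <= k.+1)%N by lia.
apply: (tilting_retract (u := z) (v := w) (s := h k.+1 ∘ cinc c k.+1)
  (t := - cprj c k.+1)); last first.
- exact/tilting_projective/(exact_from_projective eN).
- by apply: Mc' => //; move: Nk; rewrite /N; lia.
apply: (exact_from_mono eN (ltnW Nk : (N < k.+1)%N)).
rewrite compmDr compm1 compA wE -compA zE compNm compmN.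
rewrite (compA (v k.+1)).
have e := hE k ltac:(move: Nk; rewrite /N; lia).
have di : sdiff R k ∘ cinc c k.+1 = 0.
  by have [] := exact_from_ker_diff eN (Nk : (N < k)%N).
have -> : v k.+1 ∘ u k.+1 =
    idm (R k.+1) + sdiff R k.+1 ∘ h k.+1 + h k ∘ sdiff R k.
  by rewrite -addrA -e /fcomp /fid addrC subrK.
rewrite !compmDl comp1m -(compA (h k)) di compm0 addr0.
by rewrite (exact_from_diff eN Nk') -!compA addrK.
Qed.

End ClusterTilting.

(** * Resolutions by cluster tilting objects *)

Section Resolved.
Variables (d : nat) (E : exact_category) (M : E -> Prop).
Hypotheses (d_gt0 : (0 < d)%N) (enough : enough_projectives E)
  (ct : exact_dZ_cluster_tilting d M).
Implicit Types R S X Y V : sequence E.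

Lemma projective_resolution (A : E) (n : nat) :
  exists R (c : cycles R), exact_from n c /\ scyc c n = A.
Proof.
pose T := {Z : E & {R : E & hom Z R}}.
pose Q (x y : T) (p : hom (tag (tagged y)) (tag x)) :=
  projective (tag (tagged y)) /\ conflation (tagged (tagged y)) p.
have [||x [x0 xP]] := @dep_choice (fun _ => T)
  (fun _ => Tagged (fun Z => {R : E & hom Z R}) (Tagged (hom A) (idm A))) n
  (Tagged (fun Z => {R : E & hom Z R}) (Tagged (hom A) (idm A)))
  (fun _ _ => True) (fun _ x y => exists p, Q x y p) => //.
  move=> _ x _ _; have [K [s ps]] := ses_cover enough (tag x).
  exists (Tagged (fun Z => {R : E & hom Z R})
    (Tagged (hom K) (ses_inc s))) => //.
  by exists (ses_prj s); split=> //; apply: ses_conf.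
have exp k : exists p, (n <= k)%N -> Q (x k) (x k.+1) p.
  have [nk|nk] := boolP (n <= k)%N; last by exists 0.
  by have [_ [p pQ]] := xP k nk; exists p.
pose p k := sval (cid (exp k)).
have pQ k : (n <= k)%N -> Q (x k) (x k.+1) (p k) := svalP (cid (exp k)).
pose R := @Sequence E (fun k => tag (tagged (x k)))
  (fun k => tagged (tagged (x k)) ∘ p k).
exists R, (@Cycles E R (fun k => tag (x k)) (fun k => tagged (tagged (x k))) p).
by split=> [k /pQ []|] //=; rewrite x0.
Qed.

(** [Y] resolves a right [M]-approximation of the cycles of [X].  Since maps
    from [M] into these cycles lift to it, [Ext^1(M, -)] vanishes on the cycles
    of the cocone, and the known vanishing moves up by one degree. *)
Lemma approximation_step (n j : nat) X (c : cycles X) :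
  exact_from n c -> (d %| n)%N -> (j.+1 < d)%N ->
  (forall i B, (i < j)%N -> M B -> ext_vanish i B (scyc c n)) ->
  exists Y (f : family Y X) (cV : cycles (cocone f)),
    [/\ tilted d M 0 Y, germ f, exact_from n cV &
    forall i B, (i < j.+1)%N -> M B -> ext_vanish i B (scyc cV n)].
Proof.
move=> ec dn jd ext.
have [[ff _ _] _] := ct; have [[A [f0 [MA f0P]]] _] := ff (scyc c n).
have [Y [cY [eY AE]]] := projective_resolution A n.
rewrite -AE in f0 f0P MA; clear A AE.
have [f [z [z0 fz]]] := comparison f0 eY ec.
have [cV [eV pb]] := exact_cocone eY ec fz.
exists Y, f, cV; split=> //.
- exists n, cY; split=> // k nk; rewrite addr0 => dk.
  have /dvdnP [q qE] : (d %| k - n)%N by exact: dvdn_sub dk dn.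
  by rewrite -(subnK nk) qE; apply: (tilting_syzygy d_gt0 enough ct _ eY).
- exact: comparison_germ eY ec fz.
move=> i B ij MB; have [a [b pbn]] := pb n (leqnn n).
have di : ~~ (d %| i.+1)%N by rewrite gtnNdvd //; lia.
apply: (ext_vanish_pullback pbn (exact_from_epi ec (leqnn n))).
- exact: (tilting_ext_vanish enough ct).
- apply: (tilting_ext_vanish enough ct) => //.
  apply: (tilting_projective d_gt0 enough ct).
  exact: (exact_from_projective ec (leqnn n : (n < n.+1)%N)).
case: i ij {di} => [|i] ij; last exact: ext.
move=> g; have [h hE] := f0P B g MB.
by exists (- h), 0; rewrite compm0 addr0 z0 compNm compmN opprK.
Qed.

(** After [d - 1] steps the cycles in one degree are right orthogonal to [M],
    hence in [M], and so are their [d]-th syzygies. *)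
Lemma tilted_resolved X : eventually_exact_seq X ->
  resolved (tilted d M 0) d.-1 X.
Proof.
move=> [n [c ec]].
suff main m j Y (cY : cycles Y) : (j + m = d.-1)%N -> exact_from (n * d)%N cY ->
    (forall i B, (i < j)%N -> M B -> ext_vanish i B (scyc cY (n * d))) ->
    resolved (tilted d M 0) m Y.
  apply: (main _ 0%N _ c) => //.
  by apply: exact_from_leq ec; rewrite leq_pmulr.
elim: m j Y cY => [|m IH] j Y cY jm eY ext /=.
  exists (n * d)%N, cY; split=> // k nk; rewrite addr0 => dk.
  have /dvdnP [q qE] : (d %| k - n * d)%N
    by exact: dvdn_sub dk (dvdn_mull _ (dvdnn d)).
  rewrite -(subnK nk) qE; apply: (tilting_syzygy d_gt0 enough ct _ eY) => //.
  apply: (tilting_right_orth d_gt0 enough ct) => i B id MB; apply: ext => //;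
    lia.
have jd : (j.+1 < d)%N by lia.
have [Z [f [cV [tZ gf eV extV]]]] :=
  approximation_step eY (dvdn_mull _ (dvdnn d)) jd ext.
by exists Z, f; split=> //; apply: IH extV; rewrite // addSnnS.
Qed.

Lemma tilted_right_approx X : eventually_exact_seq X ->
  exists Y (f : family Y X), [/\ tilted d M 0 Y, germ f &
    forall T, (forall i Y', (0 < i < d)%N -> tilted d M 0 Y' ->
      null_germs (Omi i T) Y') ->
    forall g : family T X, germ g ->
    exists2 g' : family T Y, germ g' & germ_homotopic g (fcomp f g')].
Proof.
move=> /tilted_resolved /resolved_right_approx [Y [f [tY gf univ]]].
exists Y, f; split=> // T null; apply: univ => i Y' id; apply: null; lia.
Qed.

(** [resolved_left_approx] only approximates a [(d - 1)]-fold inverse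
    suspension, so it is applied to the [(d - 1)]-fold suspension of [X]. *)
Lemma tilted_left_approx X : eventually_exact_seq X ->
  exists V (f : family X V), [/\ tilted d M 0 V, germ f &
    forall T, (forall i Y', (0 < i < d)%N -> tilted d M 0 Y' ->
      null_germs (Omi i Y') T) ->
    forall g : family X T, germ g ->
    exists2 g' : family V T, germ g' & germ_homotopic g (fcomp g' f)].
Proof.
move=> eX.
have eX' : eventually_exact_seq (prependi d.-1 X).
  by elim: (d.-1) => //= m; apply: exact_prepend.
have := resolved_left_approx (tilted_resolved eX').
rewrite Omi_prependi => -[V [f [tV gf univ]]].
exists V, f; split=> // T null; apply: univ => i Y' id; apply: null; lia.
Qed.

Lemma tilted_Omi_null i S R : (0 < i < d)%N -> tilted d M 0 R ->
  tilted d M 0 S ->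
  null_germs (Omi i R) S.
Proof.
move=> id tR tS; apply: (tilted_null d_gt0 enough ct (r := 0 + i%:Z)
  (s := 0)) => //.
  by rewrite add0r subr0 dvdzE /= gtnNdvd //; lia.
exact: tilted_Omi.
Qed.

End Resolved.

(** * Complexes and sequences *)

Section ComplexGerms.
Variable C : preadditive.
Implicit Types X Y Z : complex C.

Definition sequence_of X : sequence C :=
  @Sequence C (fun k => X (- k%:Z)) (fun k => cd X (- k.+1%:Z) (- k%:Z)).

Definition restrict X Y (f : cmap X Y) :
  family (sequence_of X) (sequence_of Y) :=
  fun k => f (- k%:Z).

Lemma germ_restrict X Y (f : cmap X Y) : germ (restrict f).
Proof. by apply: eventually_all => k; rewrite /restrict /= cm_comm. Qed.

Lemma oppzS (k : nat) : - k.+1%:Z + 1 = - k%:Z. Proof. lia. Qed.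
Lemma oppz_pred (k : nat) : - k%:Z - 1 = - k.+1%:Z. Proof. lia. Qed.

Lemma restrict_homotopic X Y (f g : cmap X Y) :
  homotopic f g -> germ_homotopic (restrict f) (restrict g).
Proof.
move=> [h fg]; exists (fun k => h (- k%:Z) (- k.+1%:Z)).
apply: eventually_all => k; have := fg (- k.+1%:Z).
by rewrite oppzS oppz_pred.
Qed.

Lemma cmap_of X Y (f : forall n : int, hom (X n) (Y n)) :
  (forall i j : int, j = i + 1 -> f j ∘ cd X i j = cd Y i j ∘ f i) ->
  exists F : cmap X Y, forall n, F n = f n.
Proof.
move=> fE; have comm (i j : int) : f j ∘ cd X i j = cd Y i j ∘ f i.
  have [/fE //|ij] := eqVneq j (i + 1).
  by rewrite !cd_shape // compm0 comp0m.
by exists (Cmap comm).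
Qed.

Lemma homotopic_of X Y (f g : cmap X Y)
    (h : forall i j : int, hom (X i) (Y j)) :
  (forall m l r : int, l = m + 1 -> r = l + 1 ->
    f l - g l = cd Y m l ∘ h l m + h r l ∘ cd X l r) ->
  homotopic f g.
Proof. by move=> e; exists h => n; apply: e; rewrite ?subrK. Qed.

(** The structure maps of a cone, reindexed so that the degrees of their
    source and target are independent variables. *)
Record cone_data X Y (f : cmap X Y) Z := ConeData {
  ci1 : forall m l : int, hom (X l) (Z m);
  ci2 : forall m : int, hom (Y m) (Z m);
  cp1 : forall m l : int, hom (Z m) (X l);
  cp2 : forall m : int, hom (Z m) (Y m);
  cone_bip : forall m l, l = m + 1 ->
    is_biproduct (ci1 m l) (ci2 m) (cp1 m l) (cp2 m);
  cone_p1d : forall m l r, l = m + 1 -> r = l + 1 ->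
    cp1 l r ∘ cd Z m l = - (cd X l r ∘ cp1 m l);
  cone_p2d : forall m l, l = m + 1 ->
    cp2 l ∘ cd Z m l = f l ∘ cp1 m l + cd Y m l ∘ cp2 m;
  cone_di1 : forall m l r, l = m + 1 -> r = l + 1 ->
    cd Z m l ∘ ci1 m l = - (ci1 l r ∘ cd X l r) + ci2 l ∘ f l;
  cone_di2 : forall m l, l = m + 1 -> cd Z m l ∘ ci2 m = ci2 l ∘ cd Y m l }.

Lemma cone_dataP X Y (f : cmap X Y) Z : is_cone f Z ->
  inhabited (cone_data f Z).
Proof.
move=> [i1 [i2 [p1 [p2 coneE]]]].
have injS : injective (fun m : int => (m, m + 1)) by move=> m n [].
have [j1 [j1E _]] := @extend_inj int (int * int)%type (fun m => (m, m + 1))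
  (fun p : int * int => hom (X p.2) (Z p.1)) (fun _ => 0) i1 injS.
have [q1 [q1E _]] := @extend_inj int (int * int)%type (fun m => (m, m + 1))
  (fun p : int * int => hom (Z p.1) (X p.2)) (fun _ => 0) p1 injS.
have bip m : is_biproduct (i1 m) (i2 m) (p1 m) (p2 m) by case: (coneE m).
have dE m : cd Z m (m + 1) = - (i1 (m + 1) ∘ cd X (m + 1) (m + 1 + 1) ∘ p1 m)
        + i2 (m + 1) ∘ f (m + 1) ∘ p1 m + i2 (m + 1) ∘ cd Y m (m + 1) ∘ p2 m.
  by case: (coneE m).
split; exists (fun m l => j1 (m, l)) i2 (fun m l => q1 (m, l)) p2.
- by move=> m _ ->; rewrite j1E q1E.
- move=> m _ _ -> ->; rewrite !q1E dE.
  have [e1 e2 e3 e4 e5] := bip (m + 1).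
  by rewrite !compmDr compmN !compA e1 e3 comp1m !comp0m !addr0.
- move=> m _ ->; rewrite !q1E dE.
  have [e1 e2 e3 e4 e5] := bip (m + 1).
  by rewrite !compmDr compmN !compA e2 e4 !comp1m !comp0m oppr0 add0r.
- move=> m _ _ -> ->; rewrite !j1E dE; have [e1 e2 e3 e4 e5] := bip m.
  by rewrite !compmDl compNm -!compA e1 e4 !compm1 !compm0 addr0.
- move=> m _ ->; rewrite dE; have [e1 e2 e3 e4 e5] := bip m.
  by rewrite !compmDl compNm -!compA e2 e3 !compm1 !compm0 oppr0 !add0r.
Qed.

Lemma comp_sandwich (A A' B B' : C) (a : hom B B') (f g : hom A B)
    (b : hom A' A) : f = g -> a ∘ f ∘ b = a ∘ g ∘ b.
Proof. by move=> ->. Qed.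

(** Written as a matrix, the contraction [h] of the cone contains the inverse
    germ [Y -> X], and its diagonal entries are the two homotopies up to
    sign. *)
Lemma cone_germ_inverse X Y (f : cmap X Y) Z (h : forall i j, hom (Z i) (Z j)) :
  is_cone f Z ->
  eventually (fun k => idm (Z (- k.+1%:Z)) =
    cd Z (- k.+2%:Z) (- k.+1%:Z) ∘ h (- k.+1%:Z) (- k.+2%:Z)
    + h (- k%:Z) (- k.+1%:Z) ∘ cd Z (- k.+1%:Z) (- k%:Z)) ->
  exists g : family (sequence_of Y) (sequence_of X), [/\ germ g,
    germ_homotopic (fcomp g (restrict f)) (fid _) &
    germ_homotopic (fcomp (restrict f) g) (fid _)].
Proof.
move=> /cone_dataP [D] idE.
have eS k : - k%:Z = - k.+1%:Z + 1 by lia.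
pose q k : hom (Y (- k%:Z)) (X (- k%:Z)) :=
  cp1 D (- k.+1%:Z) (- k%:Z) ∘ h (- k%:Z) (- k.+1%:Z) ∘ ci2 D (- k%:Z).
pose e k : hom (Y (- k%:Z)) (Y (- k.+1%:Z)) :=
  cp2 D (- k.+1%:Z) ∘ h (- k%:Z) (- k.+1%:Z) ∘ ci2 D (- k%:Z).
pose a k : hom (X (- k%:Z)) (X (- k.+1%:Z)) :=
  cp1 D (- k.+2%:Z) (- k.+1%:Z) ∘ h (- k.+1%:Z) (- k.+2%:Z)
    ∘ ci1 D (- k.+1%:Z) (- k%:Z).
exists q; split.
- apply: eventually_mono idE => k idE.
  have [_ _ p12 _ _] := cone_bip D (eS k).
  have := comp_sandwich (cp1 D _ (- k%:Z)) (ci2 D _) idE.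
  rewrite compm1 p12 compmDr compmDl !compA (cone_p1d D (eS k.+1) (eS k)).
  rewrite -(compA _ (cd Z _ _) (ci2 D _))
    (cone_di2 D (eS k)) !compNm => /esym/eqP.
  by rewrite addrC subr_eq0 => /eqP; rewrite /q /= !compA => ->.
- exists a; apply: eventually_mono (proj1 (eventuallyS _) idE).
  move=> k {}idE; have [p11 _ _ _ _] := cone_bip D (eS k.+1).
  have := comp_sandwich (cp1 D _ (- k.+1%:Z)) (ci1 D _ (- k.+1%:Z)) idE.
  rewrite compm1 p11 compmDr compmDl !compA (cone_p1d D (eS k.+2) (eS k.+1)).
  rewrite -(compA _ (cd Z _ _) (ci1 D _ _)) (cone_di1 D (eS k.+1) (eS k)).
  rewrite compmDr compmN !compNm => idE'.
  rewrite /fcomp /fid /restrict [sdiff _ _]/= [sdiff _ k]/= idE' /q /a !compA.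
  rewrite opprD opprK addrCA; congr (_ + _).
  by rewrite opprD opprK addrC subrK.
- exists (fun k => - e k); apply: eventually_mono idE => k idE.
  have [_ p22 _ _ _] := cone_bip D (eS k).
  have := comp_sandwich (cp2 D _) (ci2 D _) idE.
  rewrite compm1 p22 compmDr compmDl !compA (cone_p2d D (eS k.+1)).
  rewrite -(compA _ (cd Z _ _) (ci2 D _)) (cone_di2 D (eS k)) => idE'.
  rewrite /fcomp /fid /restrict [sdiff _ _]/= [sdiff _ k]/= idE' /q /e.
  rewrite compmN compNm !compmDl !compA -addrA opprD addrA subrr add0r opprD.
  by [].
Qed.

End ComplexGerms.

(** * Truncations *)

Section Truncation.
Variable E : exact_category.

(** The retraction [trunc_pr], [trunc_in] keeps the case analysis on degrees out
    of the types of later constructions. *)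
Definition trunc_obj (b : bool) (A : E) : E := if b then A else zobj E.

Definition trunc_pr (b : bool) (A : E) : hom A (trunc_obj b A) :=
  if b return hom A (trunc_obj b A) then idm A else 0.

Definition trunc_in (b : bool) (A : E) : hom (trunc_obj b A) A :=
  if b return hom (trunc_obj b A) A then idm A else 0.

Lemma trunc_pr_in b A : trunc_pr b A ∘ trunc_in b A = idm _.
Proof. by case: b => /=; rewrite ?comp1m // comp0m; apply/esym/zobjP. Qed.

Lemma trunc_in_pr (b : bool) A : b -> trunc_in b A ∘ trunc_pr b A = idm _.
Proof. by case: b => //= _; rewrite comp1m. Qed.

Lemma trunc_obj_zero (b : bool) A : ~~ b -> zero_obj (trunc_obj b A).
Proof. by case: b => // _; apply: zobjP. Qed.

Lemma trunc_obj_projective (b : bool) A : (b -> projective A) ->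
  projective (trunc_obj b A).
Proof. by case: b => [pA|_]; [apply: pA|apply/projective_zero/zobjP]. Qed.

Lemma cone_ex (X Y : complex E) (f : cmap X Y) : exists Z, is_cone f Z.
Proof.
have [g [gE g0]] := @extend_inj int (int * int)%type (fun n => (n, n))
  (fun p => hom (X p.1) (Y p.2)) (fun _ => 0) (fun n => f n)
  ltac:(by move=> m n []).
have {}g0 m n : m != n -> g (m, n) = 0.
  by move=> mn; apply: g0 => i [im im']; move: mn; rewrite -im -im' eqxx.
pose D n := bsum (X (n + 1)) (Y n).
pose dz i j : hom (bobj (D i)) (bobj (D j)) :=
  bpair (D j) (- cd X (i + 1) (j + 1) ∘ bp1 (D i))
    (bcopair (D i) (g (i + 1, j)) (cd Y i j)).
have shape i j : j != i + 1 -> dz i j = 0.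
  move=> ij; rewrite /dz g0 1?eq_sym // !cd_shape //; last by move: ij; lia.
  by rewrite /bcopair /bpair oppr0 !comp0m addr0 !compm0 addr0.
have sq i j k : dz j k ∘ dz i j = 0.
  have [ij|ij] := eqVneq j (i + 1); last by rewrite (shape i j) // compm0.
  have [jk|jk] := eqVneq k (j + 1); last by rewrite (shape j k) // comp0m.
  apply: bpair_eq.
    rewrite compm0 compA bp1_pair -compA bp1_pair compA compNm compmN cd_sq.
    by rewrite opprK comp0m.
  rewrite compm0 compA bp2_pair bcopair_pair /bcopair compmDr !compA cd_sq.
  by subst k j; rewrite comp0m addr0 !gE compmN cm_comm compNm addNr.
exists (Complex shape sq), (fun n => bi1 (D n)), (fun n => bi2 (D n)),
  (fun n => bp1 (D n)), (fun n => bp2 (D n)) => n; split=> /=.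
  exact: biproductP.
rewrite /dz gE /bpair /bcopair compmDr compNm compmN !compA addrA.
by [].
Qed.

(** The projection [T] of a complex onto its part [W] in degrees [< L] has a
    cone homotopy equivalent to its part [B] in degrees [>= L], suspended. *)
Lemma truncation_cone (Y W : complex E) (L : int) (T : cmap Y W)
    (S : forall n, hom (W n) (Y n)) :
  (forall n, T n ∘ S n = idm _) -> (forall n, n < L -> S n ∘ T n = idm _) ->
  (forall n, L <= n -> zero_obj (W n)) ->
  over_projectives Y -> right_bounded Y ->
  exists Z B, [/\ is_cone T Z, in_Kb B &
    @isomorphic (homotopy_category E) Z B].
Proof.
move=> TS ST W0 projY [N rY].
have S0 n : L <= n -> S n = 0 by move=> /W0; apply: zero_obj_from.
have T0 n : L <= n -> T n = 0 by move=> /W0; apply: zero_obj_to.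
have Sd i j : j < L -> i < L -> S j ∘ cd W i j = cd Y i j ∘ S i.
  move=> jL iL; rewrite -[LHS]compm1 -TS compA -(compA (S j)) -cm_comm.
  by rewrite !compA ST // comp1m.
have [Z coneZ] := cone_ex T; have [D] := cone_dataP coneZ.
pose b n := (L <= n + 1).
pose pr n : hom (Y (n + 1)) (trunc_obj (b n) (Y (n + 1))) := trunc_pr (b n) _.
pose inj n : hom (trunc_obj (b n) (Y (n + 1))) (Y (n + 1)) := trunc_in (b n) _.
have inj0 n : n + 1 < L -> inj n = 0.
  move=> nL; apply/zero_obj_from/trunc_obj_zero; rewrite /b; lia.
have pr0 n : n + 1 < L -> pr n = 0.
  move=> nL; apply/zero_obj_to/trunc_obj_zero; rewrite /b; lia.
have prinj n : pr n ∘ inj n = idm _ := trunc_pr_in _ _.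
have injpr n : L <= n + 1 -> inj n ∘ pr n = idm _ by move=> nL;
  apply: trunc_in_pr.
pose dB i j := pr j ∘ - cd Y (i + 1) (j + 1) ∘ inj i.
have shape i j : j != i + 1 -> dB i j = 0.
  move=> ij; rewrite /dB cd_shape; last by move: ij; lia.
  by rewrite oppr0 compm0 comp0m.
have sq i j k : dB j k ∘ dB i j = 0.
  rewrite /dB !compA -(compA _ (inj j) (pr j)).
  have [nL|nL] := lerP L (j + 1); last by rewrite inj0 // comp0m compm0 !comp0m.
  rewrite injpr // compm1 -(compA (pr k)) compNm (compmN (cd _ _ _)) cd_sq.
  by rewrite !oppr0 compm0 comp0m.
pose B := Complex shape sq.
have injd i j : j = i + 1 -> inj j ∘ cd B i j = - cd Y (i + 1) (j + 1) ∘ inj i.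
  move=> ij; rewrite /= /dB !compA.
  have [nL|nL] := lerP L (i + 1); last by rewrite (inj0 i) // !compm0.
  by rewrite injpr ?comp1m //; lia.
have [|u uE] := @cmap_of _ B Z (fun n => ci1 D n (n + 1) ∘ inj n).
  move=> i j ij; rewrite -compA injd // !compA.
  subst j; rewrite (cone_di1 D (erefl _) (erefl _)) compmN.
  rewrite compmDl !compNm; have [jL|jL] := lerP L (i + 1).
    by rewrite T0 // compm0 comp0m addr0.
  by rewrite inj0 // !compm0 addr0.
(* On [Z n = Y (n + 1) + W n] the retraction is [(y, x) |-> y + d x]: in the
   border degree [n = L - 1] the component [y] alone is not a chain map. *)
have [|v vE] := @cmap_of _ Z B (fun n => pr n ∘
    (cp1 D n (n + 1) + cd Y n (n + 1) ∘ S n ∘ cp2 D n)).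
  move=> i j ij; subst j; rewrite -(compA (pr (i + 1))) compmDl -!compA.
  rewrite (cone_p1d D (erefl _) (erefl _)) (cone_p2d D (erefl _)).
  have [jL|jL] := lerP L (i + 1).
    rewrite S0 // comp0m compm0 addr0 /= /dB.
    rewrite (compA (inj i)) injpr // comp1m compNm compmDr.
    by rewrite (compA (cd Y _ _) (cd Y _ _)) cd_sq comp0m addr0.
  rewrite /= /dB (inj0 i) // ?(compm0, comp0m).
  rewrite (compmDr (S _)) (compA (S _) (T _)) ST // comp1m.
  rewrite (compA (S _) (cd W _ _)) Sd //; last lia.
  rewrite -!compA (compmDr (cd Y _ _))
    (compA (cd Y _ _) (cd Y _ _)) cd_sq comp0m addr0.
  by rewrite addNr compm0.
exists Z, B; split=> //.
  split.
  - move=> n; apply: trunc_obj_projective => _; exact: projY.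
  - exists N => n Nn; rewrite /zero_obj; apply: zero_obj_to.
    have Y0 : zero_obj (Y (n + 1)) by apply: rY; lia.
    rewrite /= /trunc_obj; case: ifP => // _; exact: zobjP.
  - exists (L - 2) => n nL; apply: trunc_obj_zero; rewrite /b; lia.
exists (homotopy_class v), (homotopy_class u).
  rewrite /homotopy_class /= qcompE; apply/mkhomP/homotopic_sym.
  (* In degrees [< L] the homotopy [(y, x) |-> (x, 0)] contracts [Z]. *)
  apply: (@homotopic_of _ _ _ _ _ (fun l m => ci1 D m l ∘ S l ∘ cp2 D l)).
  move=> m l r lm rl; rewrite /= uE vE; subst r.
  have [_ _ _ _ bipE] := cone_bip D (erefl (l + 1)).
  have -> : cd Z m l ∘ (ci1 D m l ∘ S l ∘ cp2 D l) =
      - (ci1 D l (l + 1) ∘ (cd Y l (l + 1) ∘ (S l ∘ cp2 D l))) +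
        ci2 D l ∘ cp2 D l.
    rewrite !compA (cone_di1 D lm (erefl _)) !compmDl !compNm.
    by rewrite -(compA (ci2 D l)) TS compm1.
  rewrite -(compA _ (cp2 D (l + 1))) (cone_p2d D (erefl _)) -bipE.
  have [rL|rL] := lerP L (l + 1).
    rewrite (S0 (l + 1)) // compm0 comp0m addr0 -!compA
      (compA (inj l)) injpr // comp1m.
    by rewrite compmDr opprD addrACA subrr add0r addrC.
  rewrite inj0 // compm0 comp0m subr0 -!compA (compmDr (S _)).
  rewrite (compA (S _) (T _)) ST // comp1m (compA (S _) (cd W _ _)) Sd //;
    last lia.
  by rewrite compmDr -!compA [RHS]addrC !addrA addrK.
rewrite /homotopy_class /= qcompE; apply/mkhomP/homotopic_eq => n /=.
have [p1i1 _ _ p2i1 _] := cone_bip D (erefl (n + 1)).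
rewrite uE vE /= -(compA (pr n)) compmDl.
rewrite (compA (cp1 D _ _)) p1i1 comp1m -(compA _ (cp2 D _))
  (compA (cp2 D _)) p2i1.
by rewrite comp0m compm0 addr0 prinj.
Qed.

End Truncation.

(** * Complexes from sequences *)

Section Realization.
Variable E : exact_category.

Lemma exact_at_sequence (X : complex E) : eventually_exact X ->
  over_projectives X ->
  eventually_exact_seq (sequence_of X).
Proof.
move=> [N exN] projX; pose n := `|N|%N.
have ex k : exists t : {Z : E &
  (hom Z (X (- k%:Z)) * hom (X (- k.+1%:Z)) Z)%type},
    (n <= k)%N -> [/\ adm_epi (tagged t).2, adm_mono (tagged t).1,
      (tagged t).1 ∘ (tagged t).2 = cd X (- k.+1%:Z) (- k%:Z),
      is_cokernel (tagged t).2 (cd X (- k.+2%:Z) (- k.+1%:Z))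
      & is_kernel (tagged t).1 (cd X (- k%:Z) (- k%:Z + 1))].
  have [nk|nk] := boolP (n <= k)%N; last first.
    by exists (Tagged (fun Z =>
      (hom Z (X (- k%:Z)) * hom (X (- k.+1%:Z)) Z)%type)
      (0 : hom (zobj E) _, 0)).
  have := exN (- k%:Z) ltac:(lia); rewrite /exact_at oppz_pred.
  have -> : - k%:Z - 2 = - k.+2%:Z by lia.
  case=> Z [p [i ip]].
  by exists (Tagged (fun Z => (hom Z (X (- k%:Z)) * hom (X (- k.+1%:Z)) Z)%type)
    (i, p)).
pose Z k := tag (sval (cid (ex k))).
pose i k : hom (Z k) (X (- k%:Z)) := (tagged (sval (cid (ex k)))).1.
pose p k : hom (X (- k.+1%:Z)) (Z k) := (tagged (sval (cid (ex k)))).2.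
have ipP k : (n <= k)%N -> [/\ adm_epi (p k), adm_mono (i k),
      i k ∘ p k = cd X (- k.+1%:Z) (- k%:Z),
      is_cokernel (p k) (cd X (- k.+2%:Z) (- k.+1%:Z))
      & is_kernel (i k) (cd X (- k%:Z) (- k%:Z + 1))] := svalP (cid (ex k)).
exists n, (@Cycles E (sequence_of X) Z i p) => k nk.
have [ep _ ipE _ ker] := ipP k nk.
have [_ _ _ _] := ipP k.+1 (leqW nk); rewrite oppzS -ipE => ker1.
split=> //=; apply: deflation_conflation => //; have [ipi0 _] := ker1.
apply: kernel_intro => [|T u v|T f pf0].
- by apply: (kernel_mono ker); rewrite compA compm0.
- exact: kernel_mono ker1 _ _ _.
- by apply: (kernel_lift ker1); rewrite -compA pf0 compm0.
Qed.

Lemma sequence_exact_at (X : complex E) (n : nat) (c : cycles (sequence_of X)) :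
  exact_from n c -> eventually_exact X.
Proof.
move=> ec; exists (- n.+2%:Z) => i ni.
have [k nk ->] : exists2 k : nat, (n < k)%N & i = - k.+1%:Z.
  by exists (absz (i + 1)); lia.
rewrite /exact_at oppzS oppz_pred.
have -> : - k.+1%:Z - 2 = - k.+3%:Z by lia.
have nk1 : (n <= k.+1)%N by lia.
have nk2 : (n <= k.+2)%N by lia.
exists (scyc c k.+1), (cprj c k.+1), (cinc c k.+1); split.
- exact: (exact_from_epi ec nk1).
- by have [_ cf _] := ec k (ltnW nk); exists (scyc c k), (cprj c k).
- exact/esym/(exact_from_diff ec nk1).
- have [_ cf _] := ec k.+1 nk1; have coker := conf_coker cf.
  have [pi0 _] := coker; split.
    have -> : cd X (- k.+3%:Z) (- k.+2%:Z) = cinc c k.+2 ∘ cprj c k.+2.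
      exact: (exact_from_diff ec nk2).
    by rewrite compA pi0 comp0m.
  move=> T f; have -> : cd X (- k.+3%:Z) (- k.+2%:Z) = cinc c k.+2 ∘
    cprj c k.+2.
    exact: (exact_from_diff ec nk2).
  rewrite compA -(comp0m _ (cprj c k.+2)) =>
    /(adm_epi_epi (exact_from_epi ec nk2)).
  by case: coker => _; apply.
- exact: (exact_from_ker_diff ec nk).
Qed.

Section Realize.
Variables (K : nat) (R : sequence E).
Hypothesis sq : forall k, (K <= k)%N -> sdiff R k ∘ sdiff R k.+1 = 0.

Definition realized_obj (i : int) : E :=
  match i with Negz k => trunc_obj (K <= k)%N (R k.+1) | _ => zobj E end.

Definition realized_pr (k : nat) : hom (R k) (realized_obj (- k%:Z)) :=
  match k return hom (R k) (realized_obj (- k%:Z)) with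
  | 0 => 0 | k'.+1 => trunc_pr (K <= k')%N (R k'.+1) end.

Definition realized_in (k : nat) : hom (realized_obj (- k%:Z)) (R k) :=
  match k return hom (realized_obj (- k%:Z)) (R k) with
  | 0 => 0 | k'.+1 => trunc_in (K <= k')%N (R k'.+1) end.

Lemma realized_pr_in k : realized_pr k ∘ realized_in k = idm _.
Proof.
by case: k => [|k]; [rewrite comp0m; apply/esym/zobjP|apply: trunc_pr_in].
Qed.

Lemma realized_in_pr k : (K < k)%N -> realized_in k ∘ realized_pr k = idm _.
Proof. by case: k => // k Kk; apply: trunc_in_pr. Qed.

Lemma realized_obj_zero (i : int) : - K%:Z <= i -> zero_obj (realized_obj i).
Proof.
case: i => [k _|k kK] /=; first exact: zobjP.
by apply: trunc_obj_zero; lia.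
Qed.

Lemma realized_diff_ex :
  exists D : forall i j : int, hom (realized_obj i) (realized_obj j),
  (forall k, D (- k.+1%:Z) (- k%:Z) = realized_pr k ∘ sdiff R k ∘
    realized_in k.+1) /\
  (forall i j, (forall k : nat, ~ (i = - k.+1%:Z /\ j = - k%:Z)) -> D i j = 0).
Proof.
have [D [DE D0]] := @extend_inj nat (int * int)%type
  (fun k => (- k.+1%:Z, - k%:Z))
    (fun p => hom (realized_obj p.1) (realized_obj p.2))
  (fun _ => 0) (fun k => realized_pr k ∘ sdiff R k ∘ realized_in k.+1)
  ltac:(by move=> k l [_]; lia).
exists (fun i j => D (i, j)); split=> // i j no.
by apply: (D0 (i, j)) => k [ik jk]; case: (no k).
Qed.

Definition realized_diff := sval (cid realized_diff_ex).

Lemma realized_diffE k : realized_diff (- k.+1%:Z) (- k%:Z) = realized_pr k ∘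
  sdiff R k ∘ realized_in k.+1.
Proof. exact: (proj1 (svalP (cid realized_diff_ex))). Qed.

Lemma realized_diff_shape i j : j != i + 1 -> realized_diff i j = 0.
Proof.
move=> ij; apply: (proj2 (svalP (cid realized_diff_ex))) => k [iE jE].
by move: ij; rewrite iE jE oppzS eqxx.
Qed.

Lemma realized_diff_sq i j k : realized_diff j k ∘ realized_diff i j = 0.
Proof.
have [ij|ij] := eqVneq j (i + 1);
  last by rewrite (realized_diff_shape ij) compm0.
have [jk|jk] := eqVneq k (j + 1);
  last by rewrite (realized_diff_shape jk) comp0m.
have [jK|Kj] := lerP (- K%:Z) j.
  by rewrite (zero_obj_to (realized_diff i j)) ?compm0 //;
    apply: realized_obj_zero.
have [m Km jE] : exists2 m : nat, (K <= m)%N & j = - m.+1%:Z.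
  by exists (absz (j + 1)); lia.
have -> : k = - m%:Z by rewrite jk jE oppzS.
have -> : i = - m.+2%:Z by lia.
rewrite jE !realized_diffE !compA -(compA _ (realized_in m.+1)) realized_in_pr //.
rewrite compm1.
by rewrite -(compA _ (sdiff R m)) sq // compm0 comp0m.
Qed.

(** The terms in degrees [>= - K] are replaced by zero, which does not change
    germs. *)
Definition realize : complex E := Complex realized_diff_shape realized_diff_sq.

Definition realize_pr : family R (sequence_of realize) := realized_pr.
Definition realize_in : family (sequence_of realize) R := realized_in.

Lemma realize_sdiff k :
  sdiff (sequence_of realize) k = realized_pr k ∘ sdiff R k ∘ realized_in k.+1.
Proof. exact: realized_diffE. Qed.

Lemma realize_pr_comm k : (K <= k)%N ->
  sdiff (sequence_of realize) k ∘ realized_pr k.+1 = realized_pr k ∘ sdiff R k.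
Proof.
move=> Kk; rewrite realize_sdiff.
have : realized_pr k ∘ sdiff R k ∘ realized_in k.+1 ∘ realized_pr k.+1 =
    realized_pr k ∘ sdiff R k.
  by rewrite -(compA _ (realized_in k.+1)) realized_in_pr // compm1.
exact.
Qed.

Lemma realize_in_comm k : (K < k)%N ->
  sdiff R k ∘ realized_in k.+1 = realized_in k ∘ sdiff (sequence_of realize) k.
Proof.
move=> Kk; rewrite realize_sdiff.
have : sdiff R k ∘ realized_in k.+1 = realized_in k ∘
    (realized_pr k ∘ sdiff R k ∘ realized_in k.+1).
  by rewrite !compA realized_in_pr // comp1m.
exact.
Qed.

Lemma realize_exact (n : nat) (c : cycles R) : exact_from n c ->
  (n <= K)%N -> in_Kmb realize.
Proof.
move=> ec nK; split.
- case=> k /=; first exact/projective_zero/zobjP.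
  by apply: trunc_obj_projective => Kk; apply: exact_from_projective ec _ _;
    lia.
- by exists 0 => -[k|k] //= _; apply: zobjP.
pose c' := @Cycles E (sequence_of realize) (scyc c)
  (fun k => realized_pr k ∘ cinc c k)
  (fun k => cprj c k ∘ realized_in k.+1).
apply: (@sequence_exact_at _ K.+1 c') => k Kk.
have nk : (n <= k)%N by lia.
split=> /=.
- by apply: trunc_obj_projective => _; apply: exact_from_projective ec _ _; lia.
- have [_ cf _] := ec k nk.
  apply: (conf_iso (conflation_exact E) (is_iso_id _) _ (is_iso_id _) _ _ cf).
  + by exists (realized_in k.+1);
    [apply: realized_in_pr; lia|exact: (realized_pr_in k.+1)].
  + by rewrite compm1.
  + by rewrite comp1m -compA realized_in_pr ?compm1 //; lia.
- have := realize_sdiff k; rewrite /= => ->.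
  by rewrite (exact_from_diff ec nk) !compA.
Qed.

(** Extension by zero is a chain map because the target vanishes in the degrees
    where [f] does not commute with the differentials. *)
Lemma realize_cmap (X : complex E) (f : family (sequence_of X) R) :
  (forall k, (K <= k)%N ->
    sdiff R k ∘ f k.+1 = f k ∘ sdiff (sequence_of X) k) ->
  exists F : cmap X realize, forall k, F (- k%:Z) = realized_pr k ∘ f k.
Proof.
move=> fE.
pose F (i : int) : hom (X i) (realized_obj i) :=
  match i return hom (X i) (realized_obj i) with
  | Negz k => realized_pr k.+1 ∘ f k.+1 | _ => 0 end.
have FE k : F (- k%:Z) = realized_pr k ∘ f k by case: k => //=; rewrite comp0m.
have [|G GE] := @cmap_of _ X realize F; last by exists G => k; rewrite GE.
move=> i j ij; have [jK|Kj] := lerP (- K%:Z) j.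
  have j0 := realized_obj_zero jK.
  by rewrite (zero_obj_to (F j ∘ _) j0) (zero_obj_to (_ ∘ F i) j0).
have [m Km jE] : exists2 m : nat, (K <= m)%N & j = - m.+1%:Z.
  by exists (absz (j + 1)); lia.
have -> : i = - m.+2%:Z by lia.
rewrite jE !FE; transitivity (realized_pr m.+1 ∘ (sdiff R m.+1 ∘ f m.+2)).
  by rewrite fE ?leqW // compA.
by rewrite compA -realize_pr_comm ?leqW // -compA.
Qed.

End Realize.

End Realization.

(** * Morphisms of the singularity category are germs *)

Section Localization.
Variable E : exact_category.
Local Notation sing := (singularity_category E).
Local Notation sword := (@word (Kmb E) (@cone_in_Kb E)).
Implicit Types X Y Z : Kmb E.

Definition Kmb_seq X : sequence E := sequence_of (sval X).

Definition chain_rep X Y (f : hom X Y) : cmap (sval X) (sval Y) :=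
  @rephom (raw_homotopy_category E) _ _ f.

Lemma chain_repK X Y (f : hom X Y) : homotopy_class (chain_rep f) = f.
Proof. exact: (@rephomK (raw_homotopy_category E)). Qed.

Lemma chain_rep_class X Y (f : cmap (sval X) (sval Y)) :
  homotopic (@chain_rep X Y (homotopy_class f)) f.
Proof. exact: (@rephom_mkhom (raw_homotopy_category E)). Qed.

Lemma homotopy_class_eq (X Y : complex E) (f g : cmap X Y) :
  homotopy_class f = homotopy_class g <-> homotopic f g.
Proof. exact: (@mkhomP (raw_homotopy_category E)). Qed.

Lemma homotopy_class_comp (X Y Z : complex E) (g : cmap Y Z) (f : cmap X Y) :
  @comp (homotopy_category E) _ _ _ (homotopy_class g) (homotopy_class f)
  = homotopy_class (cmap_comp g f).
Proof. exact: (@qcompE (raw_homotopy_category E)). Qed.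

Definition class_germ X Y (f : hom X Y) : family (Kmb_seq X) (Kmb_seq Y) :=
  restrict (chain_rep f).

Lemma class_germ_homotopy_class X Y (f : cmap (sval X) (sval Y)) :
  germ_homotopic (@class_germ X Y (homotopy_class f)) (restrict f).
Proof. exact/restrict_homotopic/chain_rep_class. Qed.

Lemma class_germ_comp X Y Z (g : hom Y Z) (f : hom X Y) :
  germ_homotopic (class_germ (g ∘ f)) (fcomp (class_germ g) (class_germ f)).
Proof.
have -> : g ∘ f = homotopy_class (cmap_comp (chain_rep g) (chain_rep f))
    :> @hom (Kmb E) X Z.
  transitivity (@comp (homotopy_category E) _ _ _
    (homotopy_class (chain_rep g)) (homotopy_class (chain_rep f))).
    by rewrite !chain_repK.
  exact: homotopy_class_comp.
exact: class_germ_homotopy_class.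
Qed.

Lemma class_germ_id X : germ_homotopic (class_germ (idm X)) (fid (Kmb_seq X)).
Proof. exact: (@class_germ_homotopy_class X X (cmap_id (sval X))). Qed.

(** A complex homotopy equivalent to a bounded one is contractible in negative
    degrees, so [cone_germ_inverse] applies. *)
Lemma cone_in_Kb_inverse X Y (s : hom X Y) : cone_in_Kb s ->
  exists g : family (Kmb_seq Y) (Kmb_seq X), [/\ germ g,
    germ_homotopic (fcomp g (class_germ s)) (fid _) &
    germ_homotopic (fcomp (class_germ s) g) (fid _)].
Proof.
move=> [f [Z [B [-> coneZ [_ _ [L B0]] [a [b ba _]]]]]].
have := ba; rewrite -(rephomK (a : qhom _ _)) -(rephomK (b : qhom _ _)).
set b' := rephom _; set a' := rephom _.
rewrite [_ ∘ _]homotopy_class_comp => /homotopy_class_eq/homotopic_sym [h hE].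
have [|g [gg gf fg]] := cone_germ_inverse (h := h) coneZ.
  exists `|L|%N => k Lk; have := hE (- k.+1%:Z);
    rewrite oppzS oppz_pred /= => <-.
  rewrite (zero_obj_to (a' (- k.+1%:Z))) ?compm0 ?subr0 //.
  by apply: B0; lia.
exists g; split=> //.
  apply: germ_homotopic_trans gf; apply: germ_homotopic_compl => //.
  exact: class_germ_homotopy_class.
apply: germ_homotopic_trans fg; apply: germ_homotopic_compr => //.
exact: class_germ_homotopy_class.
Qed.

Fixpoint word_germ X Y (w : sword X Y) : family (Kmb_seq X) (Kmb_seq Y) :=
  match w in word _ A B return family (Kmb_seq A) (Kmb_seq B) with
  | word_mor _ _ f => class_germ f
  | word_inv _ _ s Ss => sval (cid (cone_in_Kb_inverse Ss))
  | word_comp _ _ _ u v => fcomp (word_germ u) (word_germ v)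
  end.

Lemma germ_word_germ X Y (w : sword X Y) : germ (word_germ w).
Proof.
elim: w => {X Y} [X Y f|X Y s Ss|X Y Z u gu v gv] /=.
- exact: germ_restrict.
- by case: (cid _) => g [].
- exact: germ_comp.
Qed.

Lemma fcompA (C : preadditive) (R S T U : sequence C) (h : family T U)
    (g : family S T) (f : family R S) :
      fcomp h (fcomp g f) = fcomp (fcomp h g) f.
Proof. by apply: functional_extensionality_dep => k; apply: compA. Qed.

Lemma fcomp1f (C : preadditive) (R S : sequence C) (f : family R S) :
  fcomp (fid S) f = f.
Proof. by apply: functional_extensionality_dep => k; apply: comp1m. Qed.

Lemma fcompf1 (C : preadditive) (R S : sequence C) (f : family R S) :
  fcomp f (fid R) = f.
Proof. by apply: functional_extensionality_dep => k; apply: compm1. Qed.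

Lemma word_germ_eq X Y (u v : sword X Y) :
  word_eq u v -> germ_homotopic (word_germ u) (word_germ v).
Proof.
elim=> {X Y u v} /=.
- by move=> *; apply: germ_homotopic_refl.
- by move=> *; apply: germ_homotopic_sym.
- by move=> A B u v w _ uv _; apply: germ_homotopic_trans.
- move=> X Y Z u u' v v' _ uu' _ vv'.
  by apply: germ_homotopic_comp => //; apply: germ_word_germ.
- by move=> *; rewrite fcompA; apply: germ_homotopic_refl.
- move=> A B u; rewrite -[X in germ_homotopic _ X]fcomp1f.
  apply: germ_homotopic_compr; [exact: germ_word_germ|exact: class_germ_id].
- move=> A B u; rewrite -[X in germ_homotopic _ X]fcompf1.
  apply: germ_homotopic_compl; [exact: germ_word_germ|exact: class_germ_id].
- by move=> *; apply: class_germ_comp.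
- move=> A B s Ss; case: (cid _) => g [_ gs _] /=.
  exact/(germ_homotopic_trans gs)/germ_homotopic_sym/class_germ_id.
- move=> A B s Ss; case: (cid _) => g [_ _ sg] /=.
  exact/(germ_homotopic_trans sg)/germ_homotopic_sym/class_germ_id.
Qed.

Definition raw_sing : raw_category :=
  RawCategory (@we_refl (Kmb E) (@cone_in_Kb E)) (@we_sym _ _) (@we_trans _ _)
    (@we_comp _ _) (@we_assoc _ _) (@we_1m _ _) (@we_m1 _ _).

Definition word_class X Y (w : sword X Y) : @hom sing X Y :=
  @mkhom raw_sing X Y w.

Definition sing_germ (X Y : sing) (f : hom X Y) :
  family (Kmb_seq X) (Kmb_seq Y) :=
  word_germ (@rephom raw_sing X Y f).

Lemma word_class_comp X Y Z (u : sword Y Z) (v : sword X Y) :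
  @comp sing X Y Z (word_class u) (word_class v) = word_class (word_comp u v).
Proof. exact: (@qcompE raw_sing). Qed.

Lemma word_class_eq X Y (u v : sword X Y) : word_eq u v ->
  word_class u = word_class v.
Proof. by move=> uv; apply/(@mkhomP raw_sing). Qed.

Lemma word_class_surj (X Y : sing) (f : hom X Y) : exists2 w : sword X Y,
  f = word_class w & sing_germ f = word_germ w.
Proof.
exists (@rephom raw_sing X Y f) => //.
exact/esym/(@rephomK raw_sing).
Qed.

Lemma germ_sing_germ (X Y : sing) (f : hom X Y) : germ (sing_germ f).
Proof. exact: germ_word_germ. Qed.

Lemma sing_germ_word_class X Y (w : sword X Y) :
  germ_homotopic (sing_germ (word_class w)) (word_germ w).
Proof. exact/word_germ_eq/(@rephom_mkhom raw_sing). Qed.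

Lemma sing_germ_comp (X Y Z : sing) (g : hom Y Z) (f : hom X Y) :
  germ_homotopic (sing_germ (g ∘ f)) (fcomp (sing_germ g) (sing_germ f)).
Proof.
have [u gE ->] := word_class_surj g; have [v fE ->] := word_class_surj f.
by rewrite gE fE word_class_comp; apply: sing_germ_word_class.
Qed.

Lemma sing_germ_id (X : sing) :
  germ_homotopic (sing_germ (idm X)) (fid (Kmb_seq X)).
Proof.
by apply: (germ_homotopic_trans
  (sing_germ_word_class (word_mor _ (idm (X : Kmb E))))); apply: class_germ_id.
Qed.

Definition chain_class X Y (f : cmap (sval X) (sval Y)) : @hom sing X Y :=
  word_class (word_mor _ (homotopy_class f : @hom (Kmb E) X Y)).

Lemma word_class_mor X Y (f : hom X Y) :
  word_class (word_mor _ f) = chain_class (chain_rep f).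
Proof. by rewrite /chain_class chain_repK. Qed.

Lemma chain_class_homotopic X Y (f g : cmap (sval X) (sval Y)) :
  homotopic f g -> @chain_class X Y f = chain_class g.
Proof. by move=> /homotopy_class_eq e; rewrite /chain_class e. Qed.

Lemma chain_class_comp X Y Z (g : cmap (sval Y) (sval Z))
  (f : cmap (sval X) (sval Y)) :
  @comp sing X Y Z (chain_class g) (chain_class f) =
    @chain_class X Z (cmap_comp g f).
Proof.
rewrite word_class_comp /chain_class -homotopy_class_comp; apply: word_class_eq.
exact/we_sym/(@we_mor (Kmb E)).
Qed.

Lemma sing_germ_chain_class X Y (f : cmap (sval X) (sval Y)) :
  germ_homotopic (sing_germ (@chain_class X Y f)) (restrict f).
Proof.
apply: (germ_homotopic_trans
  (sing_germ_word_class (word_mor _ (homotopy_class f : @hom (Kmb E) X Y)))).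
exact: class_germ_homotopy_class.
Qed.

Lemma word_class_inv X Y (s : hom X Y) (Ss : cone_in_Kb s) :
  @comp sing X Y X (word_class (word_inv Ss)) (word_class (word_mor _ s)) =
    idm (X : sing) /\
  @comp sing Y X Y (word_class (word_mor _ s)) (word_class (word_inv Ss)) =
    idm (Y : sing).
Proof.
rewrite !word_class_comp; split; apply: word_class_eq;
  [exact: we_invl|exact: we_invr].
Qed.

End Localization.

Section FullFaithful.
Variable E : exact_category.
Local Notation sing := (singularity_category E).
Local Notation sword := (@word (Kmb E) (@cone_in_Kb E)).
Implicit Types X Y Z : Kmb E.

Lemma Kmb_exact Y : eventually_exact_seq (Kmb_seq Y).
Proof. by case: Y => Y [projY rY exY]; apply: exact_at_sequence. Qed.

Definition exact_bound Y : nat := sval (cid (Kmb_exact Y)).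

(** Level of the [K]-th truncation of [Y], low enough for [Y] to be exact
    below it. *)
Definition trunc_level (K : nat) Y : nat := exact_bound Y + K.

Lemma exact_from_exact_bound Y :
  exists c, exact_from (exact_bound Y) (R := Kmb_seq Y) c.
Proof. exact: svalP (cid (Kmb_exact Y)). Qed.

Lemma trunc_level_sq K Y k : (trunc_level K Y <= k)%N ->
  sdiff (Kmb_seq Y) k ∘ sdiff (Kmb_seq Y) k.+1 = 0.
Proof.
move=> Kk; have [c ec] := exact_from_exact_bound Y; apply: (exact_from_sq ec).
by rewrite (leq_trans _ Kk) // leq_addr.
Qed.

Lemma trunc_level_Kmb K Y : in_Kmb (realize (@trunc_level_sq K Y)).
Proof.
by have [c ec] := exact_from_exact_bound Y; apply: (realize_exact _ ec);
  apply: leq_addr.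
Qed.

Definition trunc K Y : Kmb E := exist _ _ (@trunc_level_Kmb K Y).

Definition trunc_proj K Y : family (Kmb_seq Y) (Kmb_seq (trunc K Y)) :=
  realize_pr (@trunc_level_sq K Y).

Definition trunc_incl K Y : family (Kmb_seq (trunc K Y)) (Kmb_seq Y) :=
  realize_in (@trunc_level_sq K Y).

(** [f] prescribes [F] only in degrees [<= 0]; in the remaining degrees the
    target vanishes, so that [F] is determined by [f]. *)
Definition is_extension K X Y (f : family (Kmb_seq X) (Kmb_seq Y))
    (F : cmap (sval X) (sval (trunc K Y))) : Prop :=
  forall k, restrict F k = trunc_proj K Y k ∘ f k.

Lemma trunc_zero K Y (i : int) :
  - (trunc_level K Y)%:Z <= i -> zero_obj (sval (trunc K Y) i).
Proof. exact: realized_obj_zero. Qed.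

Lemma extension_ex K X Y (f : family (Kmb_seq X) (Kmb_seq Y)) :
  (forall k, (trunc_level K Y <= k)%N ->
    sdiff (Kmb_seq Y) k ∘ f k.+1 = f k ∘ sdiff (Kmb_seq X) k) ->
  exists F, @is_extension K X Y f F.
Proof. by move=> /(realize_cmap (@trunc_level_sq K Y)). Qed.

Lemma trunc_cmap_eq K X Y (F G : cmap (sval X) (sval (trunc K Y))) :
  (forall k, (trunc_level K Y < k)%N -> restrict F k = restrict G k) ->
  homotopic F G.
Proof.
move=> FG; apply: homotopic_eq => n.
have [nK|Kn] := lerP (- (trunc_level K Y)%:Z) n.
  have z := trunc_zero nK.
  by rewrite (zero_obj_to (F n) z) (zero_obj_to (G n) z).
have [k Kk ->] : exists2 k : nat, (trunc_level K Y < k)%N & n = - k%:Z.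
  by exists (absz n); lia.
exact: FG.
Qed.

Lemma trunc_map_ex K Y : exists F, @is_extension K Y Y (fid (Kmb_seq Y)) F.
Proof. by apply: extension_ex => k _; rewrite /fid compm1 comp1m. Qed.

Definition trunc_map K Y : cmap (sval Y) (sval (trunc K Y)) :=
  sval (cid (trunc_map_ex K Y)).

Lemma trunc_mapE K Y k : restrict (trunc_map K Y) k = trunc_proj K Y k.
Proof. by rewrite (svalP (cid (trunc_map_ex K Y)) k) compm1. Qed.

Lemma trunc_map_cone K Y :
  cone_in_Kb (homotopy_class (trunc_map K Y) : @hom (Kmb E) Y (trunc K Y)).
Proof.
pose L := trunc_level K Y; case: (svalP Y) => projY rY _.
pose S (i : int) : hom (sval (trunc K Y) i) (sval Y i) :=
  match i return hom (sval (trunc K Y) i) (sval Y i) with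
  | Negz k => trunc_incl K Y k.+1 | _ => 0 end.
have SE k : S (- k%:Z) = trunc_incl K Y k by case: k.
have TE k : trunc_map K Y (- k%:Z) = trunc_proj K Y k := trunc_mapE K Y k.
have [|||Z [B [coneZ KbB iso]]] :=
  @truncation_cone E _ _ (- L%:Z) (trunc_map K Y) S _ _ _ projY rY.
- move=> n; have [nL|Ln] := lerP (- L%:Z) n.
    have z := trunc_zero nL; rewrite (zero_obj_to (trunc_map K Y n) z) comp0m.
    exact/esym/z.
  have [k ->] : exists k : nat, n = - k%:Z by exists (absz n); lia.
  by rewrite TE SE; apply: realized_pr_in.
- move=> n Ln; have [k Lk ->] : exists2 k : nat, (L < k)%N & n = - k%:Z.
    by exists (absz n); lia.
  by rewrite TE SE; apply: (@realized_in_pr E L (Kmb_seq Y) k Lk).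
- exact: trunc_zero.
by exists (trunc_map K Y), Z, B.
Qed.

Lemma trunc_map_invertible K Y : exists t : @hom sing (trunc K Y) Y,
  t ∘ chain_class (trunc_map K Y) = idm (Y : sing) /\
  chain_class (trunc_map K Y) ∘ t = idm (trunc K Y : sing).
Proof. exact: (ex_intro _ _ (word_class_inv (trunc_map_cone K Y))). Qed.

Lemma trunc_map_inj K X Y (f g : @hom sing X Y) :
  chain_class (trunc_map K Y) ∘ f = chain_class (trunc_map K Y) ∘ g -> f = g.
Proof.
have [t [tT _]] := trunc_map_invertible K Y => e.
by rewrite -(comp1m f) -(comp1m g) -tT -!compA e.
Qed.

Lemma extension_homotopic X Y (f g : family (Kmb_seq X) (Kmb_seq Y)) :
  germ_homotopic f g -> eventually (fun K => forall F G,
    @is_extension K X Y f F -> @is_extension K X Y g G -> homotopic F G).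
Proof.
move=> [h [N fg]]; exists N.+1 => K NK F G eF eG.
have [H [HE _]] := @extend_inj nat (int * int)%type
  (fun k => (- k%:Z, - k.+1%:Z))
  (fun p => hom (sval X p.1) (sval (trunc K Y) p.2)) (fun _ => 0)
  (fun k => trunc_proj K Y k.+1 ∘ h k) ltac:(by move=> k l [?]; lia).
apply: (@homotopic_of _ _ _ _ _ (fun i j => H (i, j))) => m l r lm rl.
have [nL|Ln] := lerP (- (trunc_level K Y)%:Z) l.
  have z := trunc_zero nL.
  by rewrite (zero_obj_to (_ - _) z) (zero_obj_to (_ + _) z).
have [k kK kE] : exists2 k : nat, (trunc_level K Y <= k)%N & l = - k.+1%:Z.
  by exists (absz (l + 1)); lia.
have mE : m = - k.+2%:Z by lia.
have rE : r = - k%:Z by lia.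
clear lm rl; subst l m r; rewrite !HE.
have Nk : (N <= k)%N by move: kK; rewrite /trunc_level; lia.
have FE : F (- k.+1%:Z) = _ := eF k.+1.
have GE : G (- k.+1%:Z) = _ := eG k.+1.
rewrite FE GE -compmBr fg // compmDr !compA; congr (_ ∘ _ + _).
exact/esym/(@realize_pr_comm _ _ _ (@trunc_level_sq K Y) k.+1 (leqW kK)).
Qed.

(** Every morphism becomes, after a truncation of its target, the class of a
    chain map that extends its germ; proved by induction on words. *)
Lemma trunc_word X Y (w : sword X Y) : eventually (fun K =>
  forall F, @is_extension K X Y (word_germ w) F ->
  chain_class (trunc_map K Y) ∘ (word_class w : @hom sing X Y) = chain_class F).
Proof.
elim: w => {X Y} [X Y f|A B s Ss|X Y Z u IHu v IHv].
- exists 0%N => K _ F eF; rewrite word_class_mor chain_class_comp.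
  apply/chain_class_homotopic/trunc_cmap_eq => k _.
  rewrite eF; have e := trunc_mapE K Y k.
  by rewrite -e.
-
  (* It suffices to compare after composing with [s], whose germ is inverse to
     that of the word. *)
  have [N e] : eventually (fun K => forall F G,
      @is_extension K A A (fcomp (word_germ (word_inv Ss)) (class_germ s)) F ->
      @is_extension K A A (fid (Kmb_seq A)) G -> homotopic F G).
    apply: extension_homotopic => /=.
    by case: (cid _) => g [].
  exists N => K NK F eF.
  have [sinvl sinvr] := word_class_inv Ss.
  rewrite -[RHS]compm1 -sinvr compA; congr (_ ∘ _).
  rewrite word_class_mor chain_class_comp; apply: chain_class_homotopic.
  apply/homotopic_sym/(e K NK) => k; last by rewrite trunc_mapE /fid compm1.
  by rewrite /fcomp compA -eF.
- have [N0 gu] := germ_word_germ u; case: IHu => N1 IHu.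
  have [N2 gv] := germ_word_germ v; case: IHv => N3 IHv; pose K' := (N2 + N3)%N.
  exists (N0 + N1 + trunc_level K' Y + 1)%N => K NK F eF.
  have [G eG] : exists G, @is_extension K Y Z (word_germ u) G.
    by apply: extension_ex => k; rewrite /trunc_level => Kk; apply: gu; lia.
  have [F' eF'] : exists G, @is_extension K' X Y (word_germ v) G.
    by apply: extension_ex => k; rewrite /trunc_level /K' => Kk; apply: gv; lia.
  have lK : (trunc_level K' Y < trunc_level K Z)%N by rewrite {2}/trunc_level;
    lia.
  (* The germ of [u] also gives a chain map [e] on the truncation of [Y] through
     which [v] has become a chain map. *)
  have [e ee] : exists G, @is_extension K (trunc K' Y) Z
    (fcomp (word_germ u) (trunc_incl K' Y)) G.
    apply: extension_ex => k Kk.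
    rewrite /fcomp compA gu; last by move: Kk; rewrite /trunc_level; lia.
    rewrite -!compA; congr (_ ∘ _).
    exact: (@realize_in_comm _ _ _ (@trunc_level_sq K' Y) k (leq_trans lK Kk)).
  have eT k : (trunc_level K Z < k)%N ->
      restrict e k ∘ trunc_proj K' Y k = trunc_proj K Z k ∘ word_germ u k.
    move=> Kk; rewrite ee /fcomp -!compA.
    have -> : trunc_incl K' Y k ∘ trunc_proj K' Y k = idm _.
      exact: (@realized_in_pr E _ (Kmb_seq Y) k (ltn_trans lK Kk)).
    by rewrite compm1.
  rewrite -word_class_comp compA (IHu K _ G eG); last by lia.
  have -> : chain_class G = chain_class e ∘ chain_class (trunc_map K' Y).
    rewrite chain_class_comp; apply/chain_class_homotopic/trunc_cmap_eq => k Kk.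
    rewrite eG -eT //; have <- := trunc_mapE K' Y k.
    by [].
  rewrite -compA (IHv K' (leq_addl _ _) F' eF') chain_class_comp.
  apply/chain_class_homotopic/trunc_cmap_eq => k Kk.
  rewrite eF /= /fcomp compA -eT // -compA -eF'.
  by [].
Qed.

(** The germ [f] is represented by the roof [X -> trunc K Y <- Y]. *)
Lemma sing_germ_full (X Y : sing) (f : family (Kmb_seq X) (Kmb_seq Y)) :
  germ f ->
  exists F : hom X Y, germ_homotopic (sing_germ F) f.
Proof.
move=> [K gf].
have [F eF] : exists F, @is_extension K X Y f F.
  by apply: extension_ex => k; rewrite /trunc_level => Kk; apply: gf; lia.
have [t [tT Tt]] := trunc_map_invertible K Y.
exists (t ∘ chain_class F).
have gT := sing_germ_chain_class (trunc_map K Y).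
have gt : germ_homotopic (fcomp (sing_germ t) (restrict (trunc_map K Y)))
  (fid (Kmb_seq Y)).
  apply: germ_homotopic_trans (sing_germ_id Y); rewrite -tT.
  apply: germ_homotopic_trans (germ_homotopic_sym (sing_germ_comp _ _)).
  apply: germ_homotopic_compl; first exact: germ_sing_germ.
  exact: germ_homotopic_sym.
apply: germ_homotopic_trans (sing_germ_comp _ _) _.
apply: (@germ_homotopic_trans _ _ _ _ (fcomp (sing_germ t) (restrict F))).
  by apply: germ_homotopic_compl;
    [exact: germ_sing_germ|exact: sing_germ_chain_class].
have -> : restrict F = fcomp (restrict (trunc_map K Y)) f.
  by apply: functional_extensionality_dep => k; rewrite eF /fcomp trunc_mapE.
rewrite fcompA -[X in germ_homotopic _ X]fcomp1f.
by apply: germ_homotopic_compr => //; exists K.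
Qed.

(** By [trunc_word], morphisms with homotopic germs agree after the projection
    onto some truncation, which is invertible. *)
Lemma sing_germ_faithful (X Y : sing) (f g : hom X Y) :
  germ_homotopic (sing_germ f) (sing_germ g) -> f = g.
Proof.
have [u -> ->] := word_class_surj f; have [v -> ->] := word_class_surj g => uv.
have [N gu] := germ_word_germ u; have [N' gv] := germ_word_germ v.
have [K0 H] := eventually_and (extension_homotopic uv)
  (eventually_and (trunc_word u) (trunc_word v)).
pose K := (K0 + N + N')%N.
have [F eF] : exists F, @is_extension K X Y (word_germ u) F.
  by apply: extension_ex => k; rewrite /trunc_level /K => Kk; apply: gu; lia.
have [G eG] : exists F, @is_extension K X Y (word_germ v) F.
  by apply: extension_ex => k; rewrite /trunc_level /K => Kk; apply: gv; lia.
have [FG [uF vG]] := H K ltac:(rewrite /K; lia).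
apply: (@trunc_map_inj K); rewrite (uF F eF) (vG G eG).
exact: chain_class_homotopic (FG F G eF eG).
Qed.

End FullFaithful.

(** * Suspensions *)

Section NullGerms.
Variable E : exact_category.
Implicit Types R S : sequence E.

Lemma null_germs_homotopy R S S' (u : family S' S) (v : family S S') :
  germ u -> germ v -> germ_homotopic (fcomp v u) (fid S') ->
  null_germs R S -> null_germs R S'.
Proof.
move=> gu gv vu null f gf.
have e := germ_homotopic_compl gv (null _ (germ_comp gu gf)).
apply: (@germ_homotopic_trans _ _ _ _ (fcomp v (fcomp u f))).
  rewrite fcompA -[X in germ_homotopic X _]fcomp1f;
    apply: germ_homotopic_compr => //.
  exact: germ_homotopic_sym.
apply: germ_homotopic_trans e _; apply: germ_homotopic_eq.
by apply: eventually_all => k; apply: compm0.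
Qed.

Lemma germ_homotopic_Omif i R S (f g : family R S) :
  germ_homotopic f g -> germ_homotopic (Omif i f) (Omif i g).
Proof.
elim: i R S f g => [//|i IH] R S f g /= [h hE]; apply: IH.
by exists (fun k => h k.+1); apply: (proj1 (eventuallyS _) hE).
Qed.

Lemma Omif_comp i R S T (g : family S T) (f : family R S) :
  Omif i (fcomp g f) = fcomp (Omif i g) (Omif i f).
Proof.
elim: i R S T g f => [//|i IH] R S T g f.
exact: (IH _ _ _ (Omf g) (Omf f)).
Qed.

Lemma Omif_id i R : Omif i (fid R) = fid (Omi i R).
Proof. by elim: i R => [//|i IH] R; exact: (IH (Om R)). Qed.

Lemma null_germs_Omi_homotopy i R R' S (u : family R' R) (v : family R R') :
  germ u -> germ v -> germ_homotopic (fcomp v u) (fid R') ->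
  null_germs (Omi i R) S -> null_germs (Omi i R') S.
Proof.
move=> gu gv vu null f gf.
have e := germ_homotopic_compr (germ_Omif i gu)
  (null _ (germ_comp gf (germ_Omif i gv))).
apply: (@germ_homotopic_trans _ _ _ _ (fcomp (fcomp f (Omif i v)) (Omif i u))).
  rewrite -fcompA -Omif_comp -[X in germ_homotopic X _]fcompf1.
  apply: germ_homotopic_compl => //; rewrite -Omif_id.
  exact/germ_homotopic_sym/germ_homotopic_Omif.
apply: germ_homotopic_trans e _; apply: germ_homotopic_eq.
by apply: eventually_all => k; apply: comp0m.
Qed.

Lemma null_germs_Omi i R S : null_germs R S -> null_germs (Omi i R) (Omi i S).
Proof.
elim: i R S => [//|i IH] R S null; apply: IH => f gf.
pose f' : family R S := fun k =>
  if k is k'.+1 return hom (R k) (S k) then f k' else 0.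
have [|h e] := null f'; first by apply/eventuallyS.
by exists (fun k => h k.+1); apply: (proj1 (eventuallyS _) e).
Qed.

Definition negseq S : sequence E := @Sequence E S (fun k => - sdiff S k).

(** The signs [(-1)^k] identify a sequence with its negative. *)
Lemma null_germs_neg R S : null_germs R S -> null_germs R (negseq S).
Proof.
move=> null f gf.
have [|h e] := null (fun k => if odd k then - f k else f k).
  apply: eventually_mono gf => k /= e; case: (odd k) => /=.
    by rewrite compNm -e compNm opprK.
  by rewrite compmN -e compNm.
exists (fun k => if odd k then h k else - h k).
apply: eventually_mono e => k /=; rewrite !subr0; case: (odd k) => /= e.
  by rewrite e compNm compmN opprK.
by rewrite -[f k.+1]opprK e !compNm opprD.
Qed.

(** A common form of the sequences of [X] and of its shifts, on which iterating
    [Om] only changes [a]. *)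
Definition subsequence_of (X : complex E) (b : bool) (a : nat -> int) :
  sequence E :=
  @Sequence E (fun k => X (a k))
    (fun k => if b then - cd X (a k.+1) (a k) else cd X (a k.+1) (a k)).

Lemma Omi_subsequence i X b a :
  Omi i (subsequence_of X b a) = subsequence_of X b (fun k => a (i + k)%N).
Proof. by elim: i a => [//|i IH] a; apply: (IH (fun k => a k.+1)). Qed.

(** Up to the sign of the differential, the [i]-fold inverse suspension of the
    sequence of [Sigma i X] is the sequence of [X]. *)
Lemma null_germs_Sigma (i : nat) R (X : singularity_category E) :
  null_germs R (Kmb_seq (Sigma i X)) -> null_germs (Omi i R) (Kmb_seq X).
Proof.
move=> null0; have {null0} := null_germs_Omi (i := i) null0.
have -> : Kmb_seq (Sigma i X) =
  subsequence_of (sval X) (odd i) (fun k => - k%:Z + i%:Z).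
  by [].
rewrite Omi_subsequence.
have -> : (fun k : nat => - (i + k)%N%:Z + i%:Z) = (fun k : nat => - k%:Z).
  by apply: functional_extensionality_dep => k; lia.
case: (odd i) => // /null_germs_neg null f gf.
have [|h e] := null f.
  by apply: eventually_mono gf => k; rewrite /= opprK.
by exists h; apply: eventually_mono e => k; rewrite /= opprK.
Qed.

End NullGerms.

(** * The cluster tilting subcategory *)

Section Main.
Variables (d : nat) (E : exact_category) (M : E -> Prop).
Hypotheses (d_gt0 : (0 < d)%N) (enough : enough_projectives E)
  (ct : exact_dZ_cluster_tilting d M).
Local Notation sing := (singularity_category E).

Lemma realize_sequence (R : sequence E) : eventually_exact_seq R ->
  exists (U : sing) (u : family R (Kmb_seq U)) (v : family (Kmb_seq U) R),
    [/\ germ u, germ v, germ_homotopic (fcomp v u) (fid _) &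
      germ_homotopic (fcomp u v) (fid _)].
Proof.
move=> [n [c ec]]; have sq k (nk : (n <= k)%N) := exact_from_sq ec nk.
exists (exist _ _ (realize_exact sq ec (leqnn n))), (realize_pr sq),
  (realize_in sq).
split.
- by exists n => k nk; apply: realize_pr_comm.
- by exists n.+1 => k nk; apply: realize_in_comm.
- by apply: germ_homotopic_eq; exists n.+1 => k nk; apply: realized_in_pr.
- by apply: germ_homotopic_eq; apply: eventually_all => k;
  apply: realized_pr_in.
Qed.

(** Two kernels of the same map are isomorphic, so membership in [M] can be
    tested on any of them. *)
Lemma tilted_kernelP (r : int) (X : sing) :
  tilted d M r (Kmb_seq X) <-> eventually (fun k => (d %| k%:Z + r)%Z ->
    exists (Z : E) (z : hom Z (sval X (- k%:Z))),
      is_kernel z (cd (sval X) (- k%:Z) (- k%:Z + 1)) /\ M Z).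
Proof.
have kerc n (c : cycles (Kmb_seq X)) k : exact_from n c -> (n < k)%N ->
    is_kernel (cinc c k.+1) (cd (sval X) (- k.+1%:Z) (- k.+1%:Z + 1)).
  by move=> ec nk; rewrite oppzS; exact: (exact_from_ker_diff ec nk).
split=> [[n [c [ec Mc]]]|[N MN]].
  exists n.+2 => -[//|k] nk dk.
  exists (scyc c k.+1), (cinc c k.+1); split; first exact: kerc ec nk.
  by apply: Mc => //; lia.
have [n [c ec]] := Kmb_exact X.
exists (n + N).+2, c; split; first by apply: exact_from_leq ec; lia.
case=> // k nk dk; have [|Z [z [kerz MZ]]] := MN k.+1 _ dk; first by lia.
have kerck := kerc n c k ec ltac:(lia).
have [a isoa _] := kernel_iso kerck kerz (fun _ _ => iff_refl _).
exact: (tilting_iso d_gt0 enough ct isoa MZ).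
Qed.

Lemma eventual_cyclesP (X : sing) :
  eventual_cycles_in d M X <-> tilted d M 0 (Kmb_seq X).
Proof.
rewrite tilted_kernelP; split=> [[N MN]|[N MN]].
  exists (d * absz N)%N => k Nk; rewrite addr0 => /dvdnP [q qE].
  have {}qE : k = (q * d)%N := qE.
  have [|Z [z kz]] := MN (- q%:Z).
    have : (absz N <= q)%N by move: Nk; rewrite qE mulnC leq_pmul2r.
    lia.
  have -> : - k%:Z = d%:Z * - q%:Z by rewrite qE PoszM mulrN mulrC.
  by exists Z, z.
exists (- N%:Z) => i iN.
have -> : d%:Z * i = - (d * absz i)%N%:Z by nia.
apply: MN; last by rewrite addr0 PoszM dvdz_mulr.
by rewrite (leq_trans _ (leq_pmull _ d_gt0)) //; lia.
Qed.

Lemma tilted_Sigma (i : int) (X : sing) :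
  tilted d M 0 (Kmb_seq X) -> tilted d M (- i) (Kmb_seq (Sigma i X)).
Proof.
move=> /eventual_cyclesP [N MN]; apply/tilted_kernelP.
exists (absz i + d * absz N)%N => k Nk /dvdzP [q qE].
have ki : - k%:Z + i = d%:Z * - q by lia.
have [|Z [z [kz MZ]]] := MN (- q); first by nia.
rewrite -ki in z kz; exists Z, z; split=> //=.
rewrite /shift_d; have -> : - k%:Z + 1 + i = - k%:Z + i + 1 by lia.
by case: ifP => // _; apply: is_kernelN.
Qed.

Lemma null_germs_vanish (X Y : sing) :
  null_germs (Kmb_seq X) (Kmb_seq Y) <-> (forall f g : hom X Y, f = g).
Proof.
split=> [null f g|eqXY f gf].
  by apply/sing_germ_faithful/null_germs_eq => //; apply: germ_sing_germ.
have [F Ff] := sing_germ_full gf.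
have [|G G0] := @sing_germ_full E X Y (fun _ => 0).
  by apply: eventually_all => k; rewrite compm0 comp0m.
apply: germ_homotopic_trans (germ_homotopic_sym Ff) _.
by rewrite (eqXY F G).
Qed.

Lemma tilted_realize (R : sequence E) : tilted d M 0 R ->
  exists (U : sing) (u : family R (Kmb_seq U)) (v : family (Kmb_seq U) R),
    [/\ eventual_cycles_in d M U, germ u, germ v &
      germ_homotopic (fcomp v u) (fid _)].
Proof.
move=> tR; have [U [u [v [gu gv vu uv]]]] := realize_sequence (tilted_exact tR).
exists U, u, v; split=> //; apply/eventual_cyclesP.
exact: (tilted_retract d_gt0 enough ct (Kmb_exact U) tR gv gu uv).
Qed.

Lemma sing_right_approx (X : sing) :
  exists (Y : sing) (F : hom Y X), eventual_cycles_in d M Y /\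
    forall (Y' : sing) (G : hom Y' X), eventual_cycles_in d M Y' ->
    exists H, F ∘ H = G.
Proof.
have [Y [f [tY gf univ]]] := tilted_right_approx d_gt0 enough ct (Kmb_exact X).
have [U [u [v [NU gu gv vu]]]] := tilted_realize tY.
have [F Ff] := sing_germ_full (germ_comp gf gv).
exists U, F; split=> // Y' G /eventual_cyclesP NY'.
have [|g' gg' e] := univ (Kmb_seq Y') _ (sing_germ G) (germ_sing_germ G).
  by move=> i S id tS; apply: (tilted_Omi_null d_gt0 enough ct id).
have [H HE] := sing_germ_full (germ_comp gu gg').
exists H; apply: sing_germ_faithful;
  apply: germ_homotopic_trans (sing_germ_comp _ _) _.
apply: (@germ_homotopic_trans _ _ _ _ (fcomp (fcomp f v) (fcomp u g'))).
  by apply: germ_homotopic_comp => //; [exact: germ_sing_germ|exact: germ_comp].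
apply: (germ_homotopic_trans _ (germ_homotopic_sym e)).
rewrite fcompA -(fcompA f v u); apply: germ_homotopic_compr => //.
rewrite -[X in germ_homotopic _ X]fcompf1.
exact: germ_homotopic_compl.
Qed.

Lemma sing_left_approx (X : sing) :
  exists (Y : sing) (F : hom X Y), eventual_cycles_in d M Y /\
    forall (Y' : sing) (G : hom X Y'), eventual_cycles_in d M Y' ->
    exists H, H ∘ F = G.
Proof.
have [Y [f [tY gf univ]]] := tilted_left_approx d_gt0 enough ct (Kmb_exact X).
have [U [u [v [NU gu gv vu]]]] := tilted_realize tY.
have [F Ff] := sing_germ_full (germ_comp gu gf).
exists U, F; split=> // Y' G /eventual_cyclesP NY'.
have [|g' gg' e] := univ (Kmb_seq Y') _ (sing_germ G) (germ_sing_germ G).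
  by move=> i S id tS; apply: (tilted_Omi_null d_gt0 enough ct id).
have [H HE] := sing_germ_full (germ_comp gg' gv).
exists H; apply: sing_germ_faithful;
  apply: germ_homotopic_trans (sing_germ_comp _ _) _.
apply: (@germ_homotopic_trans _ _ _ _ (fcomp (fcomp g' v) (fcomp u f))).
  by apply: germ_homotopic_comp => //; [exact: germ_sing_germ|exact: germ_comp].
apply: (germ_homotopic_trans _ (germ_homotopic_sym e)).
rewrite fcompA -(fcompA g' v u); apply: germ_homotopic_compr => //.
rewrite -[X in germ_homotopic _ X]fcompf1.
exact: germ_homotopic_compl.
Qed.

Lemma sing_rigid (i : int) (X Y : sing) : ~~ (d %| i)%Z ->
  eventual_cycles_in d M X -> eventual_cycles_in d M Y ->
  tri_ext_vanish (@Sigma E) i X Y.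
Proof.
move=> di /eventual_cyclesP tX /eventual_cyclesP tY.
apply/null_germs_vanish.
apply: (tilted_null d_gt0 enough ct _ tX (tilted_Sigma i tY)).
by rewrite sub0r opprK.
Qed.

(** The identity of [X] lifts to the right approximation, so [X] is a retract
    of it. *)
Lemma sing_left_orth (X : sing) :
  (forall (i : nat) (Y : sing), (1 <= i <= d.-1)%N ->
    eventual_cycles_in d M Y -> tri_ext_vanish (@Sigma E) i X Y) ->
  eventual_cycles_in d M X.
Proof.
move=> ext; apply/eventual_cyclesP.
have [Y [f [tY gf univ]]] := tilted_right_approx d_gt0 enough ct (Kmb_exact X).
have [|g' gg' e] := univ (Kmb_seq X) _ (fid _) (germ_id _).
  move=> i S id /tilted_realize [U [u [v [NU gu gv vu]]]].
  apply: (null_germs_homotopy gu gv vu); apply: null_germs_Sigma.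
  by apply/null_germs_vanish/ext => //; lia.
apply: (tilted_retract d_gt0 enough ct (Kmb_exact X) tY gg' gf).
exact: germ_homotopic_sym.
Qed.

(** Dually, the identity of [X] factors through the left approximation. *)
Lemma sing_right_orth (X : sing) :
  (forall (i : nat) (Y : sing), (1 <= i <= d.-1)%N ->
    eventual_cycles_in d M Y -> tri_ext_vanish (@Sigma E) i Y X) ->
  eventual_cycles_in d M X.
Proof.
move=> ext; apply/eventual_cyclesP.
have [Y [f [tY gf univ]]] := tilted_left_approx d_gt0 enough ct (Kmb_exact X).
have [|g' gg' e] := univ (Kmb_seq X) _ (fid _) (germ_id _).
  move=> i S id /tilted_realize [U [u [v [NU gu gv vu]]]].
  apply: (null_germs_Omi_homotopy gu gv vu); apply: null_germs_Sigma.
  by apply/null_germs_vanish/ext => //; lia.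
apply: (tilted_retract d_gt0 enough ct (Kmb_exact X) tY gf gg').
exact: germ_homotopic_sym.
Qed.

End Main.

Theorem theorem1p2 (d : nat) (E : exact_category) (M : E -> Prop) :
  (0 < d)%N ->
  enough_projectives E ->
  exact_dZ_cluster_tilting d M ->
  tri_dZ_cluster_tilting (@Sigma E) d (eventual_cycles_in d M).
Proof.
move=> d_gt0 enough ct.
have rigid : dZ_rigid (tri_ext_vanish (@Sigma E)) d (eventual_cycles_in d M).
  by move=> i X Y; apply: sing_rigid.
have vanish (i : nat) X Y : (1 <= i <= d.-1)%N ->
    eventual_cycles_in d M X -> eventual_cycles_in d M Y ->
    tri_ext_vanish (@Sigma E) i X Y.
  by move=> id; apply: rigid; rewrite dvdzE /= gtnNdvd //; lia.
split=> //; split.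
  by move=> X; split; [exact: sing_right_approx|exact: sing_left_approx].
split=> X; split=> [NX i Y id NY|].
- exact: vanish.
- exact: sing_left_orth.
- exact: vanish.
- exact: sing_right_orth.
Qed.
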